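(* Let $K\subset\mathbb{R}^n$ be a $C^\infty_+$ unconditional convex body. Equality in $$n\int_{\Omega_+}(F-\bar F_+)^2\,dV_K\le\int_{\Omega_+}|\nabla^{\log}F|_{g_{\log}}^2\,dV_K,\qquad \bar F_+=\frac{\int_{\Omega_+}F\,dV_K}{\int_{\Omega_+}dV_K},$$ is attained by the functions $$F_i=\frac{x_iX_i}{h}-\frac1n,\qquad i=1,\dots,n.$$
   Context: Throughout $n\ge2$. A convex body is a compact convex subset of $\mathbb{R}^n$ with nonempty interior; it is $C^\infty_+$ if its boundary is $C^\infty$ and has positive Gauss curvature; it is unconditional if its support function is invariant under all coordinate reflections. $S^{n-1}$ carries the round metric $\bar g$ with Levi-Civita connection $\bar\nabla$ and standard measure $dx$. $h=h_K>0$ is the support function of $K$, $X(x)=Dh(x)=\bar\nabla h(x)+h(x)x$ ($x\in S^{n-1}$) is the inverse Gauss map with components $X_1,\dots,X_n$, $dV_K=h\det(\bar\nabla^2h+hI)\,dx$, and $g=\frac1h(\bar\nabla^2h+h\bar g)$ is the centro-affine metric on $S^{n-1}$. Let $$\Omega_+=\{x\in S^{n-1}:X_i(x)>0,\ i=1,\dots,n\},$$ which for unconditional $K$ equals $\{x\in S^{n-1}:x_i>0\ \forall i\}$. The logarithmic centro-affine metric on $\Omega_+$ is $$g_{\log}=g+\sum_{i=1}^n\frac{x_iX_i}{h}\,d\log X_i\otimes d\log X_i$$ (equivalently, the affine metric induced on $\Omega_+$ by the immersion $Y=(\log X_1,\dots,\log X_n)$ and the transversal vector $(1,\dots,1)$).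 $\nabla^{\log}F$ is the $g_{\log}$-gradient: $g_{\log}(\nabla^{\log}F,V)=dF(V)$, and $|\nabla^{\log}F|^2_{g_{\log}}=g_{\log}(\nabla^{\log}F,\nabla^{\log}F)$. *)

(* Defs.v *)
From HB Require Import structures.
From mathcomp Require Import all_boot all_order all_algebra.
From mathcomp Require Import all_classical all_reals all_analysis.
From mathcomp Require Import measurable_realfun.
Set Implicit Arguments.
Unset Strict Implicit.
Unset Printing Implicit Defensive.
Import Order.TTheory GRing.Theory Num.Theory.
Import numFieldNormedType.Exports.
Local Open Scope classical_set_scope.
Local Open Scope ring_scope.

(* The library norm on 'rV[R]_n is the sup norm (same topology); Euclidean
   notions go through [dot]. *)
Definition dot (R : realType) (n : nat) (u v : 'rV[R]_n) : R :=
  \sum_i u 0 i * v 0 i.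

Definition enorm (R : realType) (n : nat) (u : 'rV[R]_n) : R :=
  Num.sqrt (dot u u).

Definition normalize (R : realType) (n : nat) (u : 'rV[R]_n) : 'rV[R]_n :=
  (enorm u)^-1 *: u.

Definition ebasis (R : realType) (n : nat) (i : 'I_n) : 'rV[R]_n :=
  delta_mx 0 i.
Arguments ebasis {R n} i.

(* Coordinate-generated, i.e. Borel, sigma-algebra on R^n. *)
Section measurable_rV.
Variables (R : realType) (n : nat).

Let coors : 'I_n -> 'rV[R]_n -> R := fun i x => x 0 i.

Let rV_set0 : g_sigma_preimage coors set0.
Proof. exact: sigma_algebra0. Qed.

Let rV_setC A : g_sigma_preimage coors A -> g_sigma_preimage coors (~` A).
Proof. exact: sigma_algebraC. Qed.

Let rV_bigcup (F : (set 'rV[R]_n)^nat) :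
  (forall i, g_sigma_preimage coors (F i)) ->
  g_sigma_preimage coors (\bigcup_i (F i)).
Proof. exact: sigma_algebra_bigcup. Qed.

HB.instance Definition _ := @isMeasurable.Build default_measure_display
  'rV[R]_n (g_sigma_preimage coors) rV_set0 rV_setC rV_bigcup.

End measurable_rV.

Definition cons_rV (R : realType) (n : nat) (p : R * 'rV[R]_n) : 'rV[R]_n.+1 :=
  \row_i (if unlift ord0 i is Some j then p.2 0 j else p.1).

Fixpoint lebesgue_rV (R : realType) (n : nat) : set 'rV[R]_n -> \bar R :=
  match n with
  | 0 => fun A => \d_(0 : 'rV[R]_0) A
  | m.+1 => fun A =>
      product_measure1 (@lebesgue_measure R) (@lebesgue_rV R m)
        (@cons_rV R m @^-1` A)
  end.

Section lebesgue_rV_measure.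
Variable R : realType.

Lemma measurable_coord (n : nat) (i : 'I_n) :
  measurable_fun [set: 'rV[R]_n] (fun x : 'rV[R]_n => x 0 i).
Proof.
move=> _ Y mY; rewrite setTI; apply: sub_sigma_algebra => /=.
rewrite -bigcup_seq/=; exists i => /=; first by rewrite mem_index_enum.
by exists Y => //; rewrite setTI.
Qed.

Lemma measurable_to_rV (d : measure_display) (T : measurableType d) (n : nat)
    (f : T -> 'rV[R]_n) :
  (forall i, measurable_fun [set: T] (fun t => f t 0 i)) ->
  measurable_fun [set: T] f.
Proof.
move=> mf _ Y mY; rewrite setTI; move: Y mY.
apply: smallest_sub.
  split; first by rewrite /= preimage_set0.
  - by move=> A mA; rewrite /= setTD preimage_setC; exact: measurableC.
  - by move=> F mF; rewrite /= preimage_bigcup; exact: bigcup_measurable.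
rewrite -bigcup_seq => A [i _ [B mB <-]] /=; rewrite setTI.
by have := mf i measurableT B mB; rewrite setTI.
Qed.

Lemma measurable_cons_rV (n : nat) :
  measurable_fun [set: R * 'rV[R]_n] (@cons_rV R n).
Proof.
apply: measurable_to_rV => i.
rewrite (_ : (fun _ => _) = fun t : R * 'rV[R]_n =>
  if unlift ord0 i is Some j then t.2 0 j else t.1); last first.
  by apply/funext => t; rewrite mxE.
case: (unlift ord0 i) => [j|]; last exact: measurable_fst.
apply: (@measurableT_comp _ _ _ _ _ _ (fun x : 'rV[R]_n => x 0 j)).
  exact: measurable_coord.
exact: measurable_snd.
Qed.

Let uncons (n : nat) (x : 'rV[R]_n.+1) : R * 'rV[R]_n :=
  (x 0 0, \row_j x 0 (lift ord0 j)).

Let consK (n : nat) : cancel (@cons_rV R n) (@uncons n).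
Proof.
move=> [t x]; congr (_, _); first by rewrite mxE unlift_none.
by apply/rowP => j; rewrite !mxE liftK.
Qed.

Let measurable_uncons (n : nat) : measurable_fun setT (@uncons n).
Proof.
apply/measurable_fun_pairP; split; first exact: measurable_coord.
apply: measurable_to_rV => j.
rewrite (_ : (fun _ => _) = fun t : 'rV[R]_n.+1 => t 0 (lift ord0 j)).
  exact: measurable_coord.
by apply/funext => t; rewrite mxE.
Qed.

Let lebesgue_rV_ex (n : nat) :
  exists m : {sigma_finite_measure set 'rV[R]_n -> \bar R},
    m = @lebesgue_rV R n :> (set 'rV[R]_n -> \bar R).
Proof.
elim: n => [|n [m mE]].
  by exists (\d_(0 : 'rV[R]_0) : {sigma_finite_measure set _ -> \bar R}).
pose p : {measure set (measurableTypeR R * 'rV[R]_n)%type -> \bar R} :=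
  product_measure1 (@lebesgue_measure R) m.
pose nu : {measure set 'rV[R]_n.+1 -> \bar R} :=
  measure_function_pushforward__canonical__measure_function_Measure p
    (@measurable_cons_rV n).
have nuE : nu = @lebesgue_rV R n.+1 :> (set _ -> _) by rewrite /= -mE.
have sf : sigma_finite setT nu.
  have /sigma_finiteP[F [FT ndF Foo]] := sigma_finiteT (@lebesgue_measure R).
  have /sigma_finiteP[G [GT ndG Goo]] := sigma_finiteT m.
  exists (fun k => @uncons n @^-1` (F k `*` G k)).
    rewrite -preimage_bigcup (_ : \bigcup_i _ = setT) ?preimage_setT//.
    rewrite -subTset => -[x y] _.
    have [i _ Fix] : (\bigcup_i F i) x by rewrite -FT.
    have [j _ Gjy] : (\bigcup_i G i) y by rewrite -GT.
    exists (maxn i j) => //; split => /=.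
    - by move: Fix; exact/subsetPset/ndF/leq_maxl.
    - by move: Gjy; exact/subsetPset/ndG/leq_maxr.
  move=> k; have [mF Fk] := Foo k; have [mG Gk] := Goo k; split.
    rewrite -[X in measurable X]setTI; apply: measurable_uncons => //.
    exact: measurableX.
  rewrite /= /pushforward -comp_preimage (_ : _ \o _ = id); last first.
    by apply/funext => x /=; exact: consK.
  by rewrite preimage_id product_measure1E// lte_mul_pinfty// ge0_fin_numE.
pose S := @Measure_isSigmaFinite.Build _ _ _ (Measure.sort nu) sf.
pose M : {sigma_finite_measure set 'rV[R]_n.+1 -> \bar R} :=
  HB.pack (Measure.sort nu) S.
by exists M.
Qed.

Let lebesgue_rV0 (n : nat) : @lebesgue_rV R n set0 = 0%E.
Proof. by have [m <-] := lebesgue_rV_ex n; exact: measure0. Qed.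

Let lebesgue_rV_ge0 (n : nat) A : (0 <= @lebesgue_rV R n A)%E.
Proof. by have [m <-] := lebesgue_rV_ex n; exact: measure_ge0. Qed.

Let lebesgue_rV_sigma_additive (n : nat) :
  semi_sigma_additive (@lebesgue_rV R n).
Proof.
by have [m <-] := lebesgue_rV_ex n; exact: measure_semi_sigma_additive.
Qed.

HB.instance Definition _ (n : nat) := isMeasure.Build _ _ _ (@lebesgue_rV R n)
  (lebesgue_rV0 n) (@lebesgue_rV_ge0 n) (@lebesgue_rV_sigma_additive n).

Let lebesgue_rV_sigma_finite (n : nat) : sigma_finite setT (@lebesgue_rV R n).
Proof. by have [m <-] := lebesgue_rV_ex n; exact: sigma_finiteT. Qed.

HB.instance Definition _ (n : nat) :=
  Measure_isSigmaFinite.Build _ _ _ (@lebesgue_rV R n)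
    (lebesgue_rV_sigma_finite n).

End lebesgue_rV_measure.

Section sphere_measure.
Variables (R : realType) (n : nat).

Lemma measurable_enorm : measurable_fun [set: 'rV[R]_n] (@enorm R n).
Proof.
apply: (@measurableT_comp _ _ _ _ _ _ (@Num.sqrt R)).
  by apply: continuous_measurable_fun; exact: sqrt_continuous.
apply: measurable_sum => i.
by apply: measurable_funM; exact: measurable_coord.
Qed.

Lemma measurable_normalize : measurable_fun [set: 'rV[R]_n] (@normalize R n).
Proof.
apply: measurable_to_rV => i.
rewrite (_ : (fun _ => _) = fun u : 'rV[R]_n => (enorm u `^ (-1)) * u 0 i).
  apply: measurable_funM; last exact: measurable_coord.
  apply: (@measurableT_comp _ _ _ _ _ _ (fun a : R => a `^ (-1))).
    exact: measurable_powR.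
  exact: measurable_enorm.
by apply/funext => u; rewrite mxE powR_inv1// sqrtr_ge0.
Qed.

Definition punctured_ball : set 'rV[R]_n := [set y | 0 < enorm y <= 1].

Lemma measurable_punctured_ball : measurable punctured_ball.
Proof.
rewrite (_ : punctured_ball = @enorm R n @^-1` `]0, 1]).
  by rewrite -[X in measurable X]setTI; exact: measurable_enorm.
by apply/seteqP; split => y /=; rewrite in_itv.
Qed.

(* Standard measure of the unit sphere, as a Borel measure on R^n carried by
   the sphere: n times the volume of the cone {t x : 0 < t <= 1, x in A}. *)
Definition sphere_measure (A : set 'rV[R]_n) : \bar R :=
  (n%:R%:E * lebesgue_rV (@normalize R n @^-1` A `&` punctured_ball))%E.

Let sphere_measure_ex : exists m : {measure set 'rV[R]_n -> \bar R},
  m = sphere_measure :> (set _ -> _).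
Proof.
pose nu : {measure set 'rV[R]_n -> \bar R} :=
  mrestr (@lebesgue_rV R n) measurable_punctured_ball.
pose mu : {measure set 'rV[R]_n -> \bar R} :=
  measure_function_pushforward__canonical__measure_function_Measure nu
    measurable_normalize.
by exists (mscale (n%:R%:nng : {nonneg R}) mu).
Qed.

Let sphere_measure0 : sphere_measure set0 = 0%E.
Proof. by have [m <-] := sphere_measure_ex; exact: measure0. Qed.

Let sphere_measure_ge0 A : (0 <= sphere_measure A)%E.
Proof. by have [m <-] := sphere_measure_ex; exact: measure_ge0. Qed.

Let sphere_measure_sigma_additive : semi_sigma_additive sphere_measure.
Proof.
by have [m <-] := sphere_measure_ex; exact: measure_semi_sigma_additive.
Qed.

HB.instance Definition _ := isMeasure.Build _ _ _ sphere_measure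
  sphere_measure0 sphere_measure_ge0 sphere_measure_sigma_additive.

End sphere_measure.
Arguments sphere_measure {R n}.

Section euclidean.
Variables (R : realType) (n : nat).
Implicit Types (f : 'rV[R]_n -> R) (x u v N : 'rV[R]_n) (A : 'M[R]_n).

Definition grad f x : 'rV[R]_n := \row_i 'D_(ebasis i) f x.

Fixpoint iter_partial (s : seq 'I_n) f : 'rV[R]_n -> R :=
  if s is i :: s' then fun x => 'D_(ebasis i) (iter_partial s' f) x else f.

Definition smooth_on (U : set 'rV[R]_n) f :=
  forall (s : seq 'I_n) x, U x ->
    {for x, continuous (iter_partial s f)} /\
    forall i, derivable (iter_partial s f) x (ebasis i).

Definition tangent x : set 'rV[R]_n := [set u | dot u x = 0].

Definition tangent_proj x : 'M[R]_n := 1%:M - x^T *m x.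

(* Determinant of the endomorphism of the hyperplane orthogonal to the unit
   vector [x] obtained by compressing u |-> u *m A to it; the extra term
   makes the matrix act as the identity on the line spanned by [x]. *)
Definition tangent_det x A : R :=
  \det (tangent_proj x *m A *m tangent_proj x + x^T *m x).

End euclidean.

(* Intrinsic calculus on the unit sphere.  A function on the sphere is the
   restriction of a function on R^n; it is differentiated through its radially
   constant extension, so only its values on the sphere matter. *)
Section sphere_calculus.
Variables (R : realType) (n : nat).
Implicit Types (f : 'rV[R]_n -> R) (x u v : 'rV[R]_n).

Definition sphere : set 'rV[R]_n := [set x | dot x x = 1].

Definition sdiff f x u : R := 'D_u (f \o @normalize R n) x.

(* Tangent to the sphere: the radially constant extension has no radial
   derivative. *)
Definition sgrad f x : 'rV[R]_n := \row_i sdiff f x (ebasis i).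

(* Levi-Civita connection of the round metric: tangential part of the
   Euclidean derivative. *)
Definition sconn (V : 'rV[R]_n -> 'rV[R]_n) x u : 'rV[R]_n :=
  'D_u (V \o @normalize R n) x *m tangent_proj x.

Definition shess f x u v : R := dot (sconn (sgrad f) x u) v.

Definition shess_mx f x : 'M[R]_n :=
  \matrix_(i, j) shess f x (ebasis i) (ebasis j).

End sphere_calculus.
Arguments sphere {R n}.

Section convex_bodies.
Variables (R : realType) (n : nat).
Implicit Types (K : set 'rV[R]_n) (phi : 'rV[R]_n -> R) (x y u v p : 'rV[R]_n).

Definition convex_body K := [/\ compact K, convex_set K & K° !=set0].

Definition support_fun K y : R := sup [set dot x y | x in K].

Definition coord_reflection (i : 'I_n) y : 'rV[R]_n :=
  \row_j (if j == i then - y 0 j else y 0 j).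

Definition unconditional K := forall (i : 'I_n) y,
  support_fun K (coord_reflection i y) = support_fun K y.

(* [phi] is a smooth defining function of K on the neighbourhood U of p;
   its gradient at boundary points is an outer normal. *)
Definition local_defining K p (U : set 'rV[R]_n) phi :=
  [/\ open U, U p, smooth_on U phi,
      forall x, U x -> (K x <-> phi x <= 0) & grad phi p != 0].

Definition unit_normal phi y : 'rV[R]_n := normalize (grad phi y).

(* Determinant of the Weingarten map u |-> D_u nu on the tangent hyperplane of
   a level set of [phi]; the sign is such that boundaries of convex sets
   {phi <= 0} have nonnegative principal curvatures. *)
Definition gauss_curvature phi p : R :=
  tangent_det (unit_normal phi p) ('J (unit_normal phi) p).

Definition Cinf_plus K := forall p, (K `\` K°) p ->
  exists U phi, local_defining K p U phi /\ 0 < gauss_curvature phi p.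

Definition inv_gauss K x : 'rV[R]_n := grad (support_fun K) x.

Definition Omega_plus K : set 'rV[R]_n :=
  [set x | sphere x /\ forall i, 0 < inv_gauss K x 0 i].

Definition cone_density K x : R :=
  support_fun K x *
  tangent_det x (shess_mx (support_fun K) x + (support_fun K x)%:M).

(* Integration against dV_K = h det(Hess h + h I) dx. *)
Definition dV_integrable K (D : set 'rV[R]_n) (F : 'rV[R]_n -> R) :=
  sphere_measure.-integrable D (fun x => (F x * cone_density K x)%:E).

Definition dV_integral K (D : set 'rV[R]_n) (F : 'rV[R]_n -> R) : R :=
  \int[sphere_measure]_(x in D) (F x * cone_density K x).

Definition centro_affine_metric K x u v : R :=
  (support_fun K x)^-1 *
  (shess (support_fun K) x u v + support_fun K x * dot u v).

Definition g_log K x u v : R :=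
  centro_affine_metric K x u v +
  \sum_i x 0 i * inv_gauss K x 0 i / support_fun K x *
    (sdiff (fun y => ln (inv_gauss K y 0 i)) x u *
     sdiff (fun y => ln (inv_gauss K y 0 i)) x v).

(* The g_log-gradient, selected by its defining property; g_log is positive
   definite on the tangent space at points of Omega_plus. *)
Definition grad_log K (F : 'rV[R]_n -> R) x : 'rV[R]_n :=
  xget 0 [set V | tangent x V /\
    forall u, tangent x u -> g_log K x V u = sdiff F x u].

Definition grad_log_sqnorm K (F : 'rV[R]_n -> R) x : R :=
  g_log K x (grad_log K F x) (grad_log K F x).

Definition mean_plus K (F : 'rV[R]_n -> R) : R :=
  dV_integral K (Omega_plus K) F / dV_integral K (Omega_plus K) (cst 1).

Definition F_extremal K (i : 'I_n) x : R :=
  x 0 i * inv_gauss K x 0 i / support_fun K x - n%:R^-1.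

End convex_bodies.

(* Main.v *)
Require Import Defs.
From HB Require Import structures.
From mathcomp Require Import all_boot all_order all_algebra.
From mathcomp Require Import all_classical all_reals all_analysis.
From mathcomp Require Import ring lra perm measurable_realfun.
Import Order.TTheory GRing.Theory Num.Theory.
Import numFieldNormedType.Exports.
Set Implicit Arguments.
Unset Strict Implicit.
Unset Printing Implicit Defensive.
Local Open Scope classical_set_scope.
Local Open Scope ring_scope.

(** Let [h] be the support function, [X] its gradient and
    [nu i = x_i X_i / h].  The map [Phi = h X], the gradient of [h ^ 2 / 2],
    has Jacobian [J = X^T X + h D^2 h], and on the sphere
    [dV = h ^ (-n) det J dx].  If [G] is homogeneous of degree [1 - n], the
    rows of cofactors give a field [G cof_i(J)] of divergence
    [det (J with row i replaced by grad G)] (Piola's identity), and such a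
    divergence has integral zero over the positive part of the sphere when
    the field is tangent to the coordinate hyperplanes.  For
    [G = Phi_i h ^ (-n)] this gives [int (1 - n nu_i) dV = 0], hence
    [F_i = nu_i - 1 / n] has mean zero; for [G = Phi_i h ^ (-n) nu_i] it gives
    [int (nu_i (1 - n nu_i) + |grad_log nu_i| ^ 2) dV = 0].  The difference of
    the two is the equality.

    Curvature makes the maximiser of [dot _ y] over [K] unique, so that [h]
    is differentiable with the maximiser as gradient; the maximiser is a
    continuous right inverse of a smooth extension of the Gauss map whose
    differential is invertible, hence is smooth. *)

(** * Differential calculus on row vectors *)

Lemma cvg_sumr {R : realType} {T : Type} {F : set_system T} {FF : Filter F}
    (I : Type) (r : seq I) (P : pred I) (f : I -> T -> R) (l : I -> R) :
  (forall i, P i -> f i @ F --> l i) ->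
  (fun x => \sum_(i <- r | P i) f i x) @ F --> \sum_(i <- r | P i) l i.
Proof.
move=> fl; elim: r => [|i r IH].
  by rewrite big_nil; under eq_fun do rewrite big_nil; exact: cvg_cst.
rewrite big_cons; under eq_fun do rewrite big_cons.
by case: ifPn => // Pi; apply: cvgD; first exact: fl.
Qed.

Section Gradient.
Context {R : realType} {n : nat}.
Implicit Types (f g : 'rV[R]_n -> R) (x u v : 'rV[R]_n).

Lemma rV_ebasis u : u = \sum_i u 0 i *: (ebasis i : 'rV[R]_n).
Proof. exact: row_sum_delta. Qed.

Lemma dotC u v : dot u v = dot v u.
Proof. by apply: eq_bigr => i _; rewrite mulrC. Qed.

Lemma dotDl u v w : dot (u + v) w = dot u w + dot v w :> R.
Proof. by rewrite -big_split; apply: eq_bigr => i _; rewrite mxE mulrDl. Qed.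

Lemma dotZl (a : R) u v : dot (a *: u) v = a * dot u v.
Proof. by rewrite mulr_sumr; apply: eq_bigr => i _; rewrite mxE mulrA. Qed.

Lemma dotNl u v : dot (- u) v = - dot u v.
Proof. by rewrite -scaleN1r dotZl mulN1r. Qed.

Lemma dotBl u v w : dot (u - v) w = dot u w - dot v w :> R.
Proof. by rewrite dotDl dotNl. Qed.

Lemma dotDr u v w : dot w (u + v) = dot w u + dot w v :> R.
Proof. by rewrite dotC dotDl !(dotC w). Qed.

Lemma dotZr (a : R) u v : dot u (a *: v) = a * dot u v.
Proof. by rewrite dotC dotZl dotC. Qed.

Lemma dotNr u v : dot u (- v) = - dot u v.
Proof. by rewrite dotC dotNl dotC. Qed.

Lemma dotBr u v w : dot w (u - v) = dot w u - dot w v :> R.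
Proof. by rewrite dotDr dotNr. Qed.

Lemma dot0l u : dot 0 u = 0.
Proof. by rewrite /dot big1 // => i _; rewrite mxE mul0r. Qed.

Lemma dot0r u : dot u 0 = 0.
Proof. by rewrite dotC dot0l. Qed.

Lemma dot_ebasisl (i : 'I_n) u : dot (ebasis i) u = u 0 i.
Proof.
rewrite /dot (bigD1 i) //= mxE !eqxx mul1r big1 ?addr0 // => j ji.
by rewrite mxE (negPf ji) andbF mul0r.
Qed.

Lemma dot_ebasisr (i : 'I_n) u : dot u (ebasis i) = u 0 i.
Proof. by rewrite dotC dot_ebasisl. Qed.

Lemma dot_mulmx u v : u *m v^T = (dot u v)%:M.
Proof.
apply/matrixP => i j; rewrite !ord1 !mxE /= mulr1n.
by apply: eq_bigr => k _; rewrite mxE.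
Qed.

Lemma dot_ge0 u : 0 <= dot u u.
Proof. by apply: sumr_ge0 => i _; rewrite -expr2 sqr_ge0. Qed.

Lemma dot_eq0 u : (dot u u == 0) = (u == 0).
Proof.
apply/eqP/eqP => [|->]; last exact: dot0l.
move=> /eqP; rewrite psumr_eq0; last by move=> i _; rewrite -expr2 sqr_ge0.
move=> /allP h; apply/rowP => i; rewrite mxE; apply/eqP.
by have := h i (mem_index_enum i); rewrite -expr2 sqrf_eq0.
Qed.

Lemma dot_gt0 u : u != 0 -> 0 < dot u u.
Proof. by move=> u0; rewrite lt_neqAle dot_ge0 eq_sym dot_eq0 u0. Qed.

Lemma coord_le_norm u (i : 'I_n) : `|u 0 i| <= `|u|.
Proof.
rewrite [leRHS]/Num.Def.normr /= mx_normrE.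
exact: (le_bigmax _ (fun k : 'I_1 * 'I_n => `|u k.1 k.2|) (0, i)).
Qed.

Lemma norm_le_coord u (a : R) : 0 <= a -> (forall i, `|u 0 i| <= a) -> `|u| <= a.
Proof.
move=> a0 ua; rewrite /Num.Def.normr /= mx_normrE.
by apply: bigmax_le => // -[i j] _ /=; rewrite ord1.
Qed.

Lemma normr_ebasis (i : 'I_n) : `|ebasis i : 'rV[R]_n| = 1.
Proof.
apply/eqP; rewrite eq_le norm_le_coord //=.
  by have := coord_le_norm (ebasis i) i; rewrite mxE !eqxx normr1.
by move=> j; rewrite mxE; case: (_ && _); rewrite ?normr1 ?normr0.
Qed.

Lemma dot_le_norm u v : `|dot u v| <= n%:R * `|u| * `|v|.
Proof.
apply: (le_trans (ler_norm_sum _ _ _)).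
rewrite -mulrA -[n in n%:R]card_ord mulr_natl -sumr_const ler_sum // => i _.
by rewrite normrM ler_pM // coord_le_norm.
Qed.

Lemma norm2_le_dot u : `|u| ^+ 2 <= dot u u.
Proof.
have [->|u0] := eqVneq u 0; first by rewrite normr0 dot0l expr0n.
rewrite -ler_sqrt ?sqr_ge0 ?dot_ge0 // sqrtr_sqr normr_id.
apply: norm_le_coord; rewrite ?sqrtr_ge0 // => i.
rewrite -sqrtr_sqr ler_sqrt ?dot_ge0 // /dot (bigD1 i) //= -expr2 lerDl.
by apply: sumr_ge0 => j _; rewrite -expr2 sqr_ge0.
Qed.

Lemma continuous_dotl v : continuous (fun u => dot u v).
Proof.
move=> u; apply: (@cvg_sumr _ _ (nbhs u)) => i _.
by apply: cvgM; [exact: coord_continuous|exact: cvg_cst].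
Qed.

Lemma derive_grad f x u : differentiable f x ->
  'D_u f x = \sum_i u 0 i * 'D_(ebasis i) f x.
Proof.
move=> df; rewrite deriveE // [X in 'd f x X]rV_ebasis linear_sum.
by apply: eq_bigr => i _; rewrite linearZ /= deriveE.
Qed.

Lemma derive_grad_dot f x u : differentiable f x -> 'D_u f x = dot u (grad f x).
Proof. by move=> df; rewrite derive_grad //; apply: eq_bigr => i _; rewrite mxE. Qed.

(** With [differentiable_dot] as converse, this trades differentials for remainder estimates, the
    form in which all the geometric differentiability proofs below work. *)
Lemma is_diff_dot f x u :
  (forall e, 0 < e -> \forall h \near (0 : 'rV[R]_n),
     `|f (x + h) - f x - dot h u| <= e * `|h|) ->
  differentiable f x /\ grad f x = u.
Proof.
move=> H.
have lin : linear (fun h : 'rV[R]_n => dot h u : R^o).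
  by move=> a v w; rewrite dotDl dotZl.
pose L : {linear 'rV[R]_n -> R^o} := HB.pack (fun h : 'rV[R]_n => dot h u : R^o)
  (GRing.isLinear.Build _ _ _ _ _ lin).
have Lc : continuous L by exact: continuous_dotl.
have DU := @diff_unique R _ R^o f L x Lc.
(* [E] is the little-o premise of [DU]: the remainder f (x + h) - f x - dot h u is negligible
   against h. *)
have E : ltac:(let T := type of DU in match T with ?A -> _ => exact A end).
  apply/eqaddoP => e e0; near=> h.
  rewrite /= !fctE /= opprD addrA (addrC h); near: h.
  exact: H.
have dE := DU E.
have df : differentiable f x.
  by apply/(@diff_locallyP _ _ R^o); rewrite dE.
split => //; apply/rowP => i; rewrite mxE deriveE // dE.
by rewrite /= dot_ebasisl.
Unshelve. all: by end_near. Qed.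

Lemma differentiable_dot f x : differentiable f x ->
  forall e, 0 < e -> \forall h \near (0 : 'rV[R]_n),
     `|f (x + h) - f x - dot h (grad f x)| <= e * `|h|.
Proof.
move=> df e e0.
have /diff_locally/eqaddoP/(_ e e0) := df.
apply: filterS => h; rewrite !fctE /= opprD addrA (addrC h) -deriveE //.
by rewrite derive_grad_dot.
Qed.

End Gradient.

(** * Derivatives along lines and the mean value bound *)

Section Lines.
Context {R : realType} {n : nat}.
Implicit Types (f g : 'rV[R]_n -> R) (x u v : 'rV[R]_n).

Lemma continuous_dist_near f x (e : R) : {for x, continuous f} -> 0 < e ->
  \forall y \near x, `|f y - f x| <= e.
Proof.
move=> cf e0; have /cvgrPdist_le/(_ _ e0) : f @ x --> f x by exact: cf.
by apply: filterS => y; rewrite distrC.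
Qed.

Lemma is_derive_line f x v (a : R) : derivable f (x + a *: v) v ->
  is_derive a (1 : R) (fun t : R => f (x + t *: v)) ('D_v f (x + a *: v)).
Proof.
have E : (fun h : R => h^-1 *: (((fun t : R => f (x + t *: v)) \o shift a) (h *: 1)
            - f (x + a *: v))) =
         (fun h : R => h^-1 *: ((f \o shift (x + a *: v)) (h *: v) - f (x + a *: v))).
  apply/funext => h /=; congr (_ *: (f _ - _)).
  by rewrite scalerDl [h *: 1]mulr1 addrC -addrA [a *: v + x]addrC.
move=> df; apply: DeriveDef; first by rewrite /derivable E.
by rewrite /derive E.
Qed.

(** The derivative is controlled on a symmetric interval so that the sign of [b] need not be known
    when the bound is applied. *)
Lemma mvt_bound (g dg : R -> R) (b e : R) :
  (forall t, `|t| <= `|b| -> is_derive t (1 : R) g (dg t)) ->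
  (forall t, `|t| <= `|b| -> `|dg t| <= e) -> `|g b - g 0| <= e * `|b|.
Proof.
move=> dgE dgb.
have gc t : `|t| <= `|b| -> {for t, continuous g}.
  move=> /dgE dt; apply/differentiable_continuous/derivable1_diffP.
  exact: ex_derive.
have within_cont (c d : R) : (forall t, c <= t <= d -> `|t| <= `|b|) ->
    {within `[c, d], continuous g}.
  move=> H; apply: continuous_in_subspaceT => t /[!inE] /= /[!in_itv] /= tcd.
  exact/gc/H.
have [b0|/ltW b0] := leP 0 b.
  have H t : 0 <= t <= b -> `|t| <= `|b|.
    by move=> /andP[t0 tb]; rewrite !ger0_norm.
  have [|c] := @MVT_segment R g dg 0 b b0 _ (within_cont _ _ H).
    by move=> t /[!in_itv] /= /andP[/ltW t0 /ltW tb]; apply/dgE/H/andP.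
  rewrite in_itv /= => /H cb ->; rewrite subr0 normrM ler_wpM2r //.
  exact: dgb.
have H t : b <= t <= 0 -> `|t| <= `|b|.
  by move=> /andP[t0 tb]; rewrite !ler0_norm // lerN2.
have [|c] := @MVT_segment R g dg b 0 b0 _ (within_cont _ _ H).
  by move=> t /[!in_itv] /= /andP[/ltW t0 /ltW tb]; apply/dgE/H/andP.
rewrite in_itv /= => /H cb E; rewrite -normrN opprB E sub0r normrM normrN.
by rewrite ler_wpM2r // dgb.
Qed.

(** The point x + h is reached from x by changing one coordinate at a time; on each axis-parallel
    step the mean value bound applies to f minus its expected linear part. *)
Lemma continuous_partial_differentiable f x :
  (\forall y \near x, forall i, derivable f y (ebasis i)) ->
  (forall i, {for x, continuous (fun y => 'D_(ebasis i) f y)}) ->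
  differentiable f x.
Proof.
move=> fd fc; apply: (proj1 (@is_diff_dot _ _ f x (grad f x) _)) => e e0.
(* There are n steps, each with error at most e' |h|; the denominator n + 1 is nonzero in dimension
   0 as well. *)
pose e' := e / n.+1%:R.
have e'0 : 0 < e' by rewrite divr_gt0.
have : \forall y \near x, (forall i, derivable f y (ebasis i)) /\
    (forall i, `|'D_(ebasis i) f y - 'D_(ebasis i) f x| <= e').
  apply: filterI => //.
  apply: (@filter_forall _ _
    (fun i y => `|'D_(ebasis i) f y - 'D_(ebasis i) f x| <= e') (nbhs x) _) => i.
  exact: (continuous_dist_near (fc i)).
move=> /nbhs_ballP[r /= r0 H].
near=> h.
have hr : `|h| < r by near: h; exact: (@nbhs0_lt R 'rV[R]_n).
pose hk (k : nat) : 'rV[R]_n := \row_i (if (i < k)%N then h 0 i else 0).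
have hkn : hk n = h by apply/rowP => i; rewrite mxE ltn_ord.
have hk0 : hk 0%N = 0 by apply/rowP => i; rewrite !mxE.
have hkS (k : 'I_n) : hk k.+1 = hk k + h 0 k *: ebasis k.
  apply/rowP => i; rewrite !mxE ltnS leq_eqVlt eqxx /=.
  have [->|ik] := eqVneq i k; first by rewrite eqxx ltnn mulr1 add0r.
  by rewrite (inj_eq val_inj) (negPf ik) /= mulr0 addr0.
have -> : f (x + h) - f x - dot h (grad f x) = \sum_(k < n)
    (f (x + hk k.+1) - f (x + hk k) - h 0 k * 'D_(ebasis k) f x).
  rewrite sumrB; congr (_ - _).
    rewrite -(big_mkord xpredT (fun k => f (x + hk k.+1) - f (x + hk k))).
    by rewrite telescope_sumr // hkn hk0 addr0.
  by apply: eq_bigr => k _; rewrite mxE.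
apply: (@le_trans _ _ (\sum_(k < n) e' * `|h|)); last first.
  rewrite sumr_const card_ord -mulr_natl mulrA ler_wpM2r //.
  by rewrite /e' mulrCA ger_pMr // ler_pdivrMr // mul1r ler_nat.
apply: (le_trans (ler_norm_sum _ _ _)); apply: ler_sum => k _.
pose g t := f (x + hk k + t *: ebasis k) - t * 'D_(ebasis k) f x.
have B t : `|t| <= `|h 0 k| -> ball x r (x + hk k + t *: ebasis k).
  move=> tk; rewrite -ball_normE /ball_ /= -addrA opprD addNKr normrN.
  apply: le_lt_trans hr; apply: norm_le_coord => // i; rewrite !mxE /=.
  have [->|ik] := eqVneq i k.
    by rewrite ltnn mulr1 add0r (le_trans tk) // coord_le_norm.
  rewrite mulr0 addr0; case: ifP => _; last by rewrite normr0.
  exact: coord_le_norm.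
have dg t : `|t| <= `|h 0 k| -> is_derive t (1 : R) g
    ('D_(ebasis k) f (x + hk k + t *: ebasis k) - 'D_(ebasis k) f x).
  move=> /B/H[/(_ k) dk _].
  apply: is_deriveB.
    exact: is_derive_line.
  under eq_fun do rewrite mulrC.
  by apply: is_derive_eq; rewrite [LHS]mulr1.
have := mvt_bound dg (fun t tk => (H _ (B t tk)).2 k).
rewrite /g scale0r addr0 mul0r subr0 -(addrA x) -hkS => gE.
rewrite [X in `|X|]addrAC.
apply: (le_trans gE); apply: ler_wpM2l; first exact: ltW.
exact: coord_le_norm.
Unshelve. all: by end_near. Qed.

End Lines.

Lemma cvg_rV {R : realType} {n : nat} {T : Type} {F : set_system T}
    {FF : Filter F} (g : T -> 'rV[R]_n) (l : 'rV[R]_n) :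
  (forall j, (fun t => g t 0 j) @ F --> l 0 j) -> g @ F --> l.
Proof.
move=> gl; apply/cvgrPdist_le => e e0.
have : \forall t \near F, forall j, `|l 0 j - g t 0 j| <= e.
  apply: (@filter_forall _ _ (fun j t => `|l 0 j - g t 0 j| <= e) F _) => j.
  by have /cvgrPdist_le/(_ _ e0) := gl j.
apply: filterS => t H; apply: norm_le_coord; first exact: ltW.
by move=> j; rewrite !mxE.
Qed.

Section ChainRule.
Context {R : realType} {m n : nat}.

Lemma differentiable_rV (g : 'rV[R]_m -> 'rV[R]_n) x :
  (forall j, differentiable (fun y => g y 0 j) x) -> differentiable g x.
Proof.
move=> dg.
have -> : g = \sum_(j < n) (fun y => g y 0 j *: (ebasis j : 'rV[R]_n)).
  by apply/funext => y; rewrite [LHS]rV_ebasis fct_sumE.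
apply: differentiable_sum => j.
exact: (@differentiableZl _ _ _ (fun y => g y 0 j)).
Qed.

Lemma differentiable_comp_rV (f : 'rV[R]_n -> R) (g : 'rV[R]_m -> 'rV[R]_n) x :
  differentiable f (g x) -> (forall j, differentiable (fun y => g y 0 j) x) ->
  differentiable (fun y => f (g y)) x.
Proof. by move=> df dg; apply: differentiable_comp => //; exact: differentiable_rV. Qed.

Lemma derive_comp_rV (f : 'rV[R]_n -> R) (g : 'rV[R]_m -> 'rV[R]_n) x u :
  differentiable f (g x) -> (forall j, differentiable (fun y => g y 0 j) x) ->
  'D_u (fun y => f (g y)) x =
  \sum_j 'D_u (fun y => g y 0 j) x * 'D_(ebasis j) f (g x).
Proof.
move=> df dg; have dg' := differentiable_rV dg.
rewrite deriveE; last exact: differentiable_comp_rV.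
rewrite diff_comp //= -deriveE // -deriveE // derive_grad //.
apply: eq_bigr => j _; rewrite derive_mx ?mxE //; exact: diff_derivable.
Qed.

End ChainRule.

(** * Functions of class C^k *)

Section Smooth.
Context {R : realType} {n : nat}.
Implicit Types (f g : 'rV[R]_n -> R) (U V : set 'rV[R]_n).

(** Differentiability, and not mere existence of partial derivatives, is asked at every order below
    [k], so that the chain and product rules apply without further verification. *)
Fixpoint Ck (k : nat) U f : Prop :=
  match k with
  | 0 => forall x, U x -> {for x, continuous f}
  | k'.+1 => (forall x, U x -> differentiable f x) /\
             forall i, Ck k' U (fun x => 'D_(ebasis i) f x)
  end.

Lemma CkW k U f : Ck k.+1 U f -> Ck k U f.
Proof.
elim: k f => [|k IH] f [df dif] /=.
  by move=> x /df; exact: differentiable_continuous.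
by split => // i; exact: IH.
Qed.

Lemma Ck_le k l U f : (k <= l)%N -> Ck l U f -> Ck k U f.
Proof.
move=> /subnK <-; elim: (l - k)%N => // d IH /CkW; exact: IH.
Qed.

Lemma CkS_derive k U f i : Ck k.+1 U f -> Ck k U (fun x => 'D_(ebasis i) f x).
Proof. by move=> [_ H]; exact: H. Qed.

Lemma CkS_differentiable k U f x : Ck k.+1 U f -> U x -> differentiable f x.
Proof. by move=> [df _]; exact: df. Qed.

Lemma Ck_continuous k U f x : Ck k U f -> U x -> {for x, continuous f}.
Proof. by move=> /(Ck_le (leq0n k)) H Ux; exact: H. Qed.

Lemma Ck_sub k U V f : V `<=` U -> Ck k U f -> Ck k V f.
Proof.
move=> VU; elim: k f => [|k IH] f /=; first by move=> H x /VU; exact: H.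
by move=> [df dif]; split => [x /VU/df //|i]; exact: IH.
Qed.

(** Continuity and derivatives are taken in the whole space, hence are conditions at single points;
    this is why [V] only has to contain x. *)
Lemma Ck_local k U f :
  (forall x, U x -> exists2 V, V x & Ck k V f) -> Ck k U f.
Proof.
elim: k f => [|k IH] f H /=.
  by move=> x /H[V Vx]; exact.
split=> [x /H[V Vx [df _]]|i]; first exact: df.
by apply: IH => x /H[V Vx [_ dif]]; exists V => //; exact: dif.
Qed.

Lemma Ck_ext k U f g : open U -> {in U, f =1 g} -> Ck k U f -> Ck k U g.
Proof.
move=> oU; have near_eq (p q : 'rV[R]_n -> R) x : {in U, p =1 q} -> U x ->
    \forall y \near x, p y = q y.
  move=> pq Ux; have : nbhs x U by exact: open_nbhs_nbhs.
  by apply: filterS => y Uy; apply: pq; rewrite inE.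
elim: k f g => [|k IH] f g fg /=.
  move=> H x Ux; change (g @ x --> g x); rewrite -fg ?inE //.
  apply: cvg_trans (H x Ux); apply: (@near_eq_cvg _ _ (nbhs x)).
  exact: near_eq fg Ux.
move=> [df dif]; split=> [x Ux|i].
  have /is_diff_dot[] // : forall e, 0 < e -> \forall h \near (0 : 'rV[R]_n),
     `|g (x + h) - g x - dot h (grad f x)| <= e * `|h|.
  move=> e e0; have := differentiable_dot (df x Ux) e0.
  have : \forall h \near (0 : 'rV[R]_n), f (x + h) = g (x + h).
    have := near_eq _ _ _ fg Ux; rewrite [X in X -> _](near_shift 0).
    by apply: filterS => h /=; rewrite subr0 addrC.
  apply: filterS2 => h <-; rewrite -fg ?inE //.
apply: IH (dif i) => x /[1!inE] Ux; apply: near_eq_derive.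
exact: near_eq.
Qed.

Lemma Ck_cst k U (a : R) : Ck k U (fun _ => a).
Proof.
elim: k a => [|k IH] a /=; first by move=> x _; exact: cst_continuous.
split=> [x _|i]; first exact: differentiable_cst.
have -> : (fun x => 'D_(ebasis i) (fun _ : 'rV[R]_n => a) x) = (fun=> 0).
  by apply/funext => x; rewrite derive_cst.
exact: IH.
Qed.

Lemma Ck_coord k U i : Ck k U (fun x => x 0 i).
Proof.
case: k => [|k] /=; first by move=> x _; exact: coord_continuous.
have dc x : differentiable (fun x : 'rV[R]_n => x 0 i) x.
  exact: differentiable_coord.
split=> [x _ //|j].
have -> : (fun x => 'D_(ebasis j) (fun x : 'rV[R]_n => x 0 i : R^o) x) =
    (fun=> (ebasis j : 'rV[R]_n) 0 i); last exact: Ck_cst.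
apply/funext => x; apply: cvg_lim => //.
apply: cvg_near_cst; near=> h.
rewrite /= !mxE addrK; apply: mulKf; near: h; exact: nbhs_dnbhs_neq.
Unshelve. all: by end_near. Qed.

Lemma CkD k U f g : open U -> Ck k U f -> Ck k U g -> Ck k U (fun x => f x + g x).
Proof.
move=> oU; elim: k f g => [|k IH] f g /=.
  by move=> cf cg x Ux; exact: (cvgD (cf x Ux) (cg x Ux)).
move=> [df dif] [dg dig]; split=> [x Ux|i].
  by apply: differentiableD; [exact: df|exact: dg].
apply: Ck_ext (IH _ _ (dif i) (dig i)) => // x /[1!inE] Ux.
by rewrite deriveD //; apply: diff_derivable; [exact: df|exact: dg].
Qed.

Lemma CkM k U f g : open U -> Ck k U f -> Ck k U g -> Ck k U (fun x => f x * g x).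
Proof.
move=> oU; elim: k f g => [|k IH] f g.
  by move=> cf cg x Ux; exact: (cvgM (cf x Ux) (cg x Ux)).
move=> Cf Cg; have [df dif] := Cf; have [dg dig] := Cg; split=> [x Ux|i].
  by apply: differentiableM; [exact: df|exact: dg].
have := CkD oU (IH _ _ (CkW Cf) (dig i)) (IH _ _ (CkW Cg) (dif i)).
apply: Ck_ext => // x /[1!inE] Ux.
by rewrite deriveM //; apply: diff_derivable; [exact: df|exact: dg].
Qed.

Lemma CkN k U f : open U -> Ck k U f -> Ck k U (fun x => - f x).
Proof.
move=> oU Cf; have := CkM oU (Ck_cst k U (-1)) Cf.
by apply: Ck_ext => // x _; rewrite mulN1r.
Qed.

Lemma CkB k U f g : open U -> Ck k U f -> Ck k U g -> Ck k U (fun x => f x - g x).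
Proof. by move=> oU Cf Cg; apply: CkD => //; exact: CkN. Qed.

Lemma Ck_sum k U (I : Type) (r : seq I) (P : pred I) (f : I -> 'rV[R]_n -> R) :
  open U -> (forall i, P i -> Ck k U (f i)) ->
  Ck k U (fun x => \sum_(i <- r | P i) f i x).
Proof.
move=> oU Cf; elim: r => [|i r IH].
  have -> : (fun x => \sum_(i <- [::] | P i) f i x) = (fun=> 0).
    by apply/funext => x; rewrite big_nil.
  exact: Ck_cst.
have -> : (fun x => \sum_(j <- i :: r | P j) f j x) = (fun x =>
    if P i then f i x + \sum_(j <- r | P j) f j x else \sum_(j <- r | P j) f j x).
  by apply/funext => x; rewrite big_cons.
case: (boolP (P i)) => Pi //.
by apply: CkD => //; exact: Cf.
Qed.

Lemma Ck_prod k U (I : Type) (r : seq I) (P : pred I) (f : I -> 'rV[R]_n -> R) :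
  open U -> (forall i, P i -> Ck k U (f i)) ->
  Ck k U (fun x => \prod_(i <- r | P i) f i x).
Proof.
move=> oU Cf; elim: r => [|i r IH].
  have -> : (fun x => \prod_(i <- [::] | P i) f i x) = (fun=> 1).
    by apply/funext => x; rewrite big_nil.
  exact: Ck_cst.
have -> : (fun x => \prod_(j <- i :: r | P j) f j x) = (fun x =>
    if P i then f i x * \prod_(j <- r | P j) f j x else \prod_(j <- r | P j) f j x).
  by apply/funext => x; rewrite big_cons.
case: (boolP (P i)) => Pi //.
by apply: CkM => //; exact: Cf.
Qed.

Lemma CkX k U f d : open U -> Ck k U f -> Ck k U (fun x => f x ^+ d).
Proof.
move=> oU Cf; elim: d => [|d IH].
  by under eq_fun do rewrite expr0; exact: Ck_cst.
by under eq_fun do rewrite exprS; exact: CkM.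
Qed.

Lemma CkV k U f : open U -> (forall x, U x -> f x != 0) ->
  Ck k U f -> Ck k U (fun x => (f x)^-1).
Proof.
move=> oU f0; elim: k => [|k IH] Cf.
  by move=> x Ux; exact: (cvgV (f0 x Ux) (Cf x Ux)).
have [df dif] := Cf; split=> [x Ux|i].
  by apply: differentiableV; [exact: df|exact: f0].
have := CkM oU (CkN oU (CkX 2 oU (IH (CkW Cf)))) (dif i).
apply: Ck_ext => // x /[1!inE] Ux.
rewrite deriveV; [|exact: f0|exact: (diff_derivable (df _ Ux))].
by rewrite exprVn [RHS]/GRing.scale.
Qed.

Lemma Ck_det k U d (A : 'rV[R]_n -> 'M[R]_d) : open U ->
  (forall i j, Ck k U (fun x => A x i j)) -> Ck k U (fun x => \det (A x)).
Proof.
move=> oU CA; rewrite /determinant; apply: Ck_sum => // s _.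
by apply: CkM => //; [exact: Ck_cst|apply: Ck_prod].
Qed.

End Smooth.

Lemma Ck_comp {R : realType} {m n : nat} k (U : set 'rV[R]_n) (V : set 'rV[R]_m)
    (f : 'rV[R]_n -> R) (g : 'rV[R]_m -> 'rV[R]_n) :
  open V -> (forall x, V x -> U (g x)) -> Ck k U f ->
  (forall j, Ck k V (fun x => g x 0 j)) -> Ck k V (fun x => f (g x)).
Proof.
move=> oV VU; elim: k f => [|k IH] f Cf Cg.
  move=> x Vx; apply: (@continuous_comp _ _ _ g f); last by apply: Cf; exact: VU.
  by apply: (@cvg_rV _ _ _ (nbhs x)) => j; exact: Cg.
have [df dif] := Cf; split=> [x Vx|i].
  apply: differentiable_comp_rV => [|j]; first exact/df/VU.
  exact: CkS_differentiable (Cg j) Vx.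
have := @Ck_sum _ _ k V _ (index_enum 'I_n) xpredT
  (fun j x => 'D_(ebasis i) (fun y => g y 0 j) x * 'D_(ebasis j) f (g x)) oV.
move=> H; apply: Ck_ext (H _) => // [x /[1!inE] Vx|j _].
  rewrite derive_comp_rV // => [|j]; first exact/df/VU.
  exact: CkS_differentiable (Cg j) Vx.
apply: (CkM oV (CkS_derive i (Cg j))).
by apply: (IH _ (dif j)) => l; exact: CkW.
Qed.

(** * Symmetry of second derivatives *)

Section Schwarz.
Context {R : realType} {n : nat}.
Implicit Types (f : 'rV[R]_n -> R) (U : set 'rV[R]_n).

Let second_difference f x (i j : 'I_n) (s : R) :=
  f (x + s *: ebasis i + s *: ebasis j) - f (x + s *: ebasis i)
  - f (x + s *: ebasis j) + f x.

(** Two nested mean value bounds: the inner one moves along e_i and controls an increment of 'D_j f,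
    the outer one moves along e_j and controls the increment of f itself. *)
Let second_difference_approx f U x (i j : 'I_n) (e : R) : open U -> Ck 2 U f ->
  U x -> 0 < e -> \forall s \near (0 : R),
  `|second_difference f x i j s - s * s * 'D_(ebasis i) ('D_(ebasis j) f) x|
    <= e * (`|s| * `|s|).
Proof.
move=> oU [df /(_ j)[dfj /(_ i) cf]] Ux e0.
set c := 'D_(ebasis i) _ x.
have : \forall y \near x, U y /\ `|'D_(ebasis i) ('D_(ebasis j) f) y - c| <= e.
  apply: filterI; first exact: open_nbhs_nbhs.
  exact: (continuous_dist_near (cf _ Ux)).
move=> /nbhs_ballP[r /= r0 H]; near=> s.
have Hb (t t' : R) : `|t| <= `|s| -> `|t'| <= `|s| ->
    ball x r (x + t' *: ebasis j + t *: ebasis i).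
  move=> ts t's; rewrite -ball_normE /ball_ /= -addrA opprD addNKr normrN.
  apply: (@le_lt_trans _ _ (`|s| + `|s|)).
    apply: (le_trans (ler_normD _ _)).
    by rewrite !normrZ !normr_ebasis !mulr1 lerD.
  rewrite -mulr2n -(mulr_natl _ 2) -ltr_pdivlMl // mulrC.
  by near: s; apply: (@nbhs0_lt R R); rewrite divr_gt0.
have inner t : `|t| <= `|s| -> `|'D_(ebasis j) f (x + t *: ebasis j + s *: ebasis i)
    - 'D_(ebasis j) f (x + t *: ebasis j) - s * c| <= e * `|s|.
  move=> ts; pose k a := 'D_(ebasis j) f (x + t *: ebasis j + a *: ebasis i) - a * c.
  have dk a : `|a| <= `|s| -> is_derive a (1 : R) k
      ('D_(ebasis i) ('D_(ebasis j) f) (x + t *: ebasis j + a *: ebasis i) - c).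
    move=> /Hb/(_ ts)/H[Ua _]; apply: is_deriveB.
      exact/(is_derive_line (f := 'D_(ebasis j) f))/diff_derivable/dfj.
    under eq_fun do rewrite mulrC.
    by apply: is_derive_eq; rewrite [LHS]mulr1.
  have := mvt_bound dk (fun a as_ => (H _ (Hb _ _ as_ ts)).2).
  by rewrite /k scale0r addr0 mul0r subr0 [X in `|X|]addrAC.
pose g t := f (x + s *: ebasis i + t *: ebasis j) - f (x + t *: ebasis j) - t * (s * c).
have dg t : `|t| <= `|s| -> is_derive t (1 : R) g
   ('D_(ebasis j) f (x + s *: ebasis i + t *: ebasis j)
    - 'D_(ebasis j) f (x + t *: ebasis j) - s * c).
  move=> ts; apply: is_deriveB; first apply: is_deriveB.
  - apply/is_derive_line/diff_derivable/df.
    by have := (H _ (Hb s t (lexx _) ts)).1; rewrite addrAC.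
  - apply/is_derive_line/diff_derivable/df.
    have := (H _ (Hb 0 t _ ts)).1; rewrite scale0r addr0; apply.
    by rewrite normr0.
  under eq_fun do rewrite mulrC.
  by apply: is_derive_eq; rewrite [LHS]mulr1.
have dgb t : `|t| <= `|s| -> `|'D_(ebasis j) f (x + s *: ebasis i + t *: ebasis j)
    - 'D_(ebasis j) f (x + t *: ebasis j) - s * c| <= e * `|s|.
  by move=> ts; have := inner t ts; rewrite [x + _ + _]addrAC.
have := mvt_bound dg dgb.
rewrite /g scale0r !addr0 mul0r subr0 -!mulrA => gE.
apply: le_trans gE; rewrite le_eqVlt; apply/orP; left; apply/eqP.
by congr `|_|; rewrite /second_difference; ring.
Unshelve. all: by end_near. Qed.

(** The second difference is symmetric in i and j and approximates s^2 times either mixed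
    derivative; one small nonzero s is enough to compare them. *)
Lemma Ck_schwarz f U x (i j : 'I_n) : open U -> Ck 2 U f -> U x ->
  'D_(ebasis i) ('D_(ebasis j) f) x = 'D_(ebasis j) ('D_(ebasis i) f) x.
Proof.
move=> oU Cf Ux; apply/eqP; rewrite -subr_eq0 -normr_le0.
apply/ler_addgt0Pl => e e0; rewrite addr0.
have e2 : 0 < e / 2 by rewrite divr_gt0.
have A1 := second_difference_approx i j oU Cf Ux e2.
have A2 := second_difference_approx j i oU Cf Ux e2.
have A0 : \forall s \near (0 : R)^', s != 0 by exact: nbhs_dnbhs_neq.
have [s [s0 [H1 H2]]] := filter_ex (filterI A0 (nbhs_dnbhs (filterI A1 A2))).
have E : second_difference f x j i s = second_difference f x i j s.
  by rewrite /second_difference [x + _ + _]addrAC; ring.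
have s20 : 0 < `|s| * `|s| by rewrite mulr_gt0 ?normr_gt0.
rewrite {}E in H2; move: H1 H2.
move: (second_difference f x i j s) ('D_(ebasis i) _ x) ('D_(ebasis j) _ x).
move=> D a b H1 H2; rewrite -(ler_pM2r s20) -!normrM.
rewrite distrC in H1.
apply: le_trans (le_trans (lerD H1 H2) _); last by rewrite -mulrDl -splitr normrM.
apply: le_trans (ler_normD _ _); rewrite le_eqVlt; apply/orP; left; apply/eqP.
by congr `|_|; ring.
Qed.

End Schwarz.

(** * Derivative of a determinant *)

Section DetDerivative.
Context {R : realType} {n : nat}.
Implicit Types (x u : 'rV[R]_n).

Lemma is_derive_sumr (I : Type) (r : seq I) (f : I -> 'rV[R]_n -> R)
    (df : I -> R) x u :
  (forall i, is_derive x u (f i) (df i)) ->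
  is_derive x u (fun y => \sum_(i <- r) f i y) (\sum_(i <- r) df i).
Proof.
move=> dfE; elim: r => [|i r IH].
  rewrite big_nil; have -> : (fun y => \sum_(i <- [::]) f i y) = cst 0.
    by apply/funext => y; rewrite big_nil.
  exact: is_derive_cst.
rewrite big_cons; have -> : (fun y => \sum_(j <- i :: r) f j y) =
    f i + (fun y => \sum_(j <- r) f j y).
  by apply/funext => y; rewrite big_cons.
exact: is_deriveD.
Qed.

Lemma is_derive_prodr (I : eqType) (r : seq I) (f : I -> 'rV[R]_n -> R)
    (df : I -> R) x u : uniq r ->
  (forall i, is_derive x u (f i) (df i)) ->
  is_derive x u (fun y => \prod_(i <- r) f i y)
    (\sum_(k <- r) \prod_(i <- r) (if i == k then df i else f i x)).
Proof.
move=> + dfE; elim: r => [_|a r IH /= /andP[ar ur]].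
  rewrite big_nil; have -> : (fun y => \prod_(i <- [::]) f i y) = cst 1.
    by apply/funext => y; rewrite big_nil.
  exact: is_derive_cst.
have -> : (fun y => \prod_(j <- a :: r) f j y) =
    f a * (fun y => \prod_(j <- r) f j y).
  by apply/funext => y; rewrite big_cons.
have := IH ur => {}IH; apply: is_derive_eq.
rewrite /= big_cons addrC; congr (_ + _).
  rewrite big_cons eqxx [LHS]mulrC; congr (_ * _).
  rewrite !big_seq; apply: eq_bigr => i ir.
  by case: eqVneq ar => // <-; rewrite ir.
rewrite [LHS]mulr_sumr !big_seq; apply: eq_bigr => k kr.
rewrite big_cons; congr (_ * _).
by case: eqVneq ar => // ->; rewrite kr.
Qed.

(** Cofactors are treated as determinants with a row replaced by a basis vector, so that
    differentiating them needs no minors. *)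
Definition set_row (d : nat) (k : 'I_d) (v : 'rV[R]_d) (A : 'M[R]_d) : 'M[R]_d :=
  \matrix_(i, j) (if i == k then v 0 j else A i j).

Lemma is_derive_det (d : nat) (A : 'rV[R]_n -> 'M[R]_d) (dA : 'M[R]_d) x u :
  (forall i j, is_derive x u (fun y => A y i j) (dA i j)) ->
  is_derive x u (fun y => \det (A y)) (\sum_k \det (set_row k (row k dA) (A x))).
Proof.
move=> dAE; rewrite /determinant.
have := @is_derive_sumr _ (index_enum 'S_d)
  (fun s y => (-1) ^+ s * \prod_i A y i (s i))
  (fun s => (-1) ^+ s * \sum_k \prod_i (if i == k then dA i (s i) else A x i (s i)))
  x u.
move=> H; apply: (is_derive_eq (H _)) => [s|].
  apply: is_deriveZ; apply: (@is_derive_prodr _ _ (fun i y => A y i (s i))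
     (fun i => dA i (s i))) => //; exact: index_enum_uniq.
rewrite exchange_big /=; apply: eq_bigr => s _; rewrite mulr_sumr.
apply: eq_bigr => k _; congr (_ * _); apply: eq_bigr => i _.
by rewrite !mxE; case: eqVneq => [->|].
Qed.

End DetDerivative.

(** * Cofactors and Piola's identity *)

Section Piola.
Context {R : realType} {n : nat}.
Implicit Types (U : set 'rV[R]_n) (A : 'M[R]_n) (v w : 'rV[R]_n).

Lemma cofactor_set_row (k j : 'I_n) v A :
  cofactor (set_row k v A) k j = cofactor A k j.
Proof.
rewrite /cofactor; congr (_ * \det _); apply/matrixP => a b.
by rewrite !mxE eq_sym (negPf (neq_lift _ _)).
Qed.

Lemma det_set_row (k : 'I_n) v A :
  \det (set_row k v A) = \sum_j v 0 j * cofactor A k j.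
Proof.
rewrite (expand_det_row _ k); apply: eq_bigr => j _.
by rewrite cofactor_set_row mxE eqxx.
Qed.

Lemma det_set_row_ebasis (k j : 'I_n) A :
  \det (set_row k (ebasis j) A) = cofactor A k j.
Proof.
rewrite det_set_row (bigD1 j) //= mxE !eqxx mul1r big1 ?addr0 // => l lj.
by rewrite mxE (negPf lj) andbF mul0r.
Qed.

Lemma det_set_row_row (k : 'I_n) A : \det (set_row k (row k A) A) = \det A.
Proof.
congr (\det _); apply/matrixP => i j; rewrite !mxE.
by case: eqVneq => [->|].
Qed.

Lemma det_set_row_sum (k : 'I_n) (I : finType) (a : I -> R) (v : I -> 'rV[R]_n) A :
  \det (set_row k (\sum_l a l *: v l) A) = \sum_l a l * \det (set_row k (v l) A).
Proof.
rewrite det_set_row; under [RHS]eq_bigr do rewrite det_set_row mulr_sumr.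
rewrite [RHS]exchange_big; apply: eq_bigr => j _.
rewrite summxE mulr_suml; apply: eq_bigr => l _.
by rewrite mxE mulrA.
Qed.

Lemma det_set_row_other (k l : 'I_n) A : k != l ->
  \det (set_row k (row l A) A) = 0.
Proof.
move=> kl; apply: (determinant_alternate kl) => j.
by rewrite !mxE eqxx eq_sym (negPf kl).
Qed.

(** Polarization: the determinant with v + w in both rows vanishes, and so do two of the four terms
    of its expansion. *)
Lemma det_set_row_swap (k l : 'I_n) v w A : k != l ->
  \det (set_row k v (set_row l w A)) = - \det (set_row k w (set_row l v A)).
Proof.
move=> kl.
have lk : (l == k) = false by rewrite eq_sym; exact: negPf.
have same z : \det (set_row k z (set_row l z A)) = 0.
  apply: (determinant_alternate kl) => j.
  by rewrite !mxE !eqxx lk.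
have addk a b c : \det (set_row k (a + b) (set_row l c A)) =
    \det (set_row k a (set_row l c A)) + \det (set_row k b (set_row l c A)).
  rewrite !det_set_row -big_split; apply: eq_bigr => j _.
  by rewrite mxE mulrDl.
have comm z y : set_row k z (set_row l y A) = set_row l y (set_row k z A).
  apply/matrixP => i j; rewrite !mxE.
  by case: (eqVneq i k) => [->|//]; rewrite eq_sym lk.
have addl a b c : \det (set_row k c (set_row l (a + b) A)) =
    \det (set_row k c (set_row l a A)) + \det (set_row k c (set_row l b A)).
  rewrite !comm !det_set_row -big_split; apply: eq_bigr => j _.
  by rewrite mxE mulrDl.
have := same (v + w); rewrite addk !addl !same add0r addr0.
by move/eqP; rewrite addr_eq0 => /eqP.
Qed.

(** Row k is the gradient of [Phi k], so replacing a row replaces one component. This is the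
    transpose of the convention of ['J], where rows are indexed by directions. *)
Definition jac (Phi : 'I_n -> 'rV[R]_n -> R) (x : 'rV[R]_n) : 'M[R]_n :=
  \matrix_(k, l) 'D_(ebasis l) (Phi k) x.

Lemma Ck_cofactor_jac k U (Phi : 'I_n -> 'rV[R]_n -> R) (i j : 'I_n) :
  open U -> (forall l, Ck k.+1 U (Phi l)) ->
  Ck k U (fun x => cofactor (jac Phi x) i j).
Proof.
move=> oU CP.
have -> : (fun x => cofactor (jac Phi x) i j) =
    (fun x => \det (set_row i (ebasis j) (jac Phi x))).
  by apply/funext => x; rewrite det_set_row_ebasis.
apply: Ck_det => // a b.
have -> : (fun x => set_row i (ebasis j) (jac Phi x) a b) =
   (fun x => if a == i then (ebasis j : 'rV[R]_n) 0 b else 'D_(ebasis b) (Phi a) x).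
  by apply/funext => x; rewrite !mxE.
by case: eqP => _; [exact: Ck_cst|exact: CkS_derive].
Qed.

(* Differentiating the cofactor row by row produces the second derivatives of
   [Phi k], symmetric in [j, l], against determinants antisymmetric in them. *)
Lemma cofactor_jac_div_free U (Phi : 'I_n -> 'rV[R]_n -> R) (x : 'rV[R]_n)
    (i : 'I_n) : open U -> (forall k, Ck 2 U (Phi k)) -> U x ->
  \sum_j 'D_(ebasis j) (fun y => cofactor (jac Phi y) i j) x = 0.
Proof.
move=> oU CP Ux.
pose a (k j l : 'I_n) := 'D_(ebasis j) ('D_(ebasis l) (Phi k)) x.
pose D (k j l : 'I_n) :=
  \det (set_row k (ebasis l) (set_row i (ebasis j) (jac Phi x))).
have aC k j l : a k j l = a k l j by exact: Ck_schwarz (CP k) Ux.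
have DC k j l : k != i -> D k j l = - D k l j by exact: det_set_row_swap.
have dC j : 'D_(ebasis j) (fun y => cofactor (jac Phi y) i j) x =
    \sum_(k | k != i) \sum_l a k j l * D k j l.
  pose dA : 'M[R]_n := \matrix_(k, l) (if k == i then 0 else a k j l).
  have dAE k l : is_derive x (ebasis j)
      (fun y => set_row i (ebasis j) (jac Phi y) k l) (dA k l).
    have -> : (fun y => set_row i (ebasis j) (jac Phi y) k l) = (fun y =>
        if k == i then (ebasis j : 'rV[R]_n) 0 l else 'D_(ebasis l) (Phi k) y).
      by apply/funext => y; rewrite !mxE.
    rewrite [dA k l]mxE; case: eqP => _; first exact: is_derive_cst.
    have [_ /(_ l)[dk _]] := CP k.
    by apply: derivableP; apply: diff_derivable; exact: dk.
  have -> : (fun y => cofactor (jac Phi y) i j) =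
      (fun y => \det (set_row i (ebasis j) (jac Phi y))).
    by apply/funext => y; rewrite det_set_row_ebasis.
  rewrite (@derive_val _ _ _ _ _ _ _ (is_derive_det dAE)).
  (* Row i is the constant vector e_j, so differentiating it contributes nothing. *)
  rewrite (bigD1 i) //= det_set_row big1 ?add0r => [|l _]; last first.
    by rewrite !mxE eqxx mul0r.
  apply: eq_bigr => k ki; rewrite -det_set_row_sum; congr (\det (set_row _ _ _)).
  rewrite [LHS]rV_ebasis; apply: eq_bigr => l _.
  by rewrite !mxE (negPf ki).
rewrite (eq_bigr _ (fun j _ => dC j)) exchange_big /= big1 // => k ki.
set S := LHS.
have : S = - S.
  rewrite /S {1}exchange_big /= -sumrN; apply: eq_bigr => j _.
  rewrite -sumrN; apply: eq_bigr => l _.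
  by rewrite aC DC // mulrN.
by move/eqP; rewrite -addr_eq0 -mulr2n mulrn_eq0 => /eqP.
Qed.

(** By the product rule only the derivatives of [g] survive, and they assemble into an expansion
    along row i. *)
Lemma divergence_cofactor U (Phi : 'I_n -> 'rV[R]_n -> R) (g : 'rV[R]_n -> R)
    (x : 'rV[R]_n) (i : 'I_n) :
  open U -> (forall k, Ck 2 U (Phi k)) -> Ck 1 U g -> U x ->
  \sum_j 'D_(ebasis j) (fun y => g y * cofactor (jac Phi y) i j) x =
  \det (set_row i (grad g x) (jac Phi x)).
Proof.
move=> oU CP Cg Ux; rewrite det_set_row.
have dc j : derivable (fun y => cofactor (jac Phi y) i j) x (ebasis j).
  apply: diff_derivable; have C := Ck_cofactor_jac i j oU CP.
  exact: (CkS_differentiable C Ux).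
have dg j : derivable g x (ebasis j).
  by apply: diff_derivable; exact: (CkS_differentiable Cg Ux).
transitivity (\sum_j (g x * 'D_(ebasis j) (fun y => cofactor (jac Phi y) i j) x
    + cofactor (jac Phi x) i j * 'D_(ebasis j) g x)).
  by apply: eq_bigr => j _; rewrite deriveM.
rewrite big_split /= -mulr_sumr (cofactor_jac_div_free _ oU) // mulr0 add0r.
by apply: eq_bigr => j _; rewrite mxE mulrC.
Qed.

End Piola.

(** * Lebesgue integration and the divergence theorem *)

Section BorelRV.
Context {R : realType} {n : nat}.

Definition cube (m : nat) (a b : R) : set 'rV[R]_m :=
  [set y | forall i, y 0 i \in `]a, b[%R].

Lemma measurable_coord_preimage (i : 'I_n) (A : set R) : measurable A ->
  measurable [set y : 'rV[R]_n | A (y 0 i)].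
Proof. by move=> mA; rewrite -[X in measurable X]setTI; exact: measurable_coord. Qed.

Lemma measurable_cube (a b : R) : measurable (@cube n a b).
Proof.
have -> : @cube n a b = \bigcap_(i in [set: 'I_n]) [set y | y 0 i \in `]a, b[%R].
  by apply/seteqP; split => y H; [move=> i _; exact: H|move=> i; exact: H].
apply: fin_bigcap_measurable => // i _.
exact: (measurable_coord_preimage i (A := [set` `]a, b[%R])).
Qed.

(** The sigma-algebra is generated by the coordinates, so an open set is exhibited as a countable
    union of boxes with rational centre and radius 1 / (k + 1). *)
Lemma open_measurable_rV (U : set 'rV[R]_n) : open U -> measurable U.
Proof.
move=> oU.
pose B (p : 'rV[rat]_n * nat) : set 'rV[R]_n :=
  [set y | forall i, `|y 0 i - ratr (p.1 0 i)| < p.2.+1%:R^-1].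
have mB p : measurable (B p).
  have -> : B p = \bigcap_(i in [set: 'I_n])
      [set y | y 0 i \in `]ratr (p.1 0 i) - p.2.+1%:R^-1, ratr (p.1 0 i) + p.2.+1%:R^-1[%R].
    apply/seteqP; split => y H; [move=> i _|move=> i].
      by have := H i; rewrite ltr_distl /= in_itv.
    by have := H i I; rewrite ltr_distl /= in_itv.
  apply: fin_bigcap_measurable => // i _.
  exact: (measurable_coord_preimage i (A := [set` `]_, _[%R])).
have -> : U = \bigcup_p (if `[< B p `<=` U >] then B p else set0).
  apply/seteqP; split => [y Uy|y [p _]]; last by case: asboolP => // H /H.
  have /nbhs_ballP[r /= r0 Hr] : nbhs y U by exact: open_nbhs_nbhs.
  (* The box around the rational point q contains y and has radius below r / 2, so it lies in the
     ball of radius r around y. *)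
  have [k kr] : exists k : nat, k.+1%:R^-1 < r / 2.
    have r2 : 0 < r / 2 by rewrite divr_gt0.
    have [k _ /(_ _ (leqnn k)) H] := near_infty_natSinv_lt (PosNum r2).
    by exists k.
  have ek : 0 < k.+1%:R^-1 :> R by [].
  have q_ (i : 'I_n) : {q : rat | `|y 0 i - ratr q| < k.+1%:R^-1}.
    apply: cid; have [|q] := @rat_in_itvoo R (y 0 i - k.+1%:R^-1) (y 0 i + k.+1%:R^-1).
      by rewrite ltrBlDr -addrA ltrDl addr_gt0.
    by rewrite in_itv /= => qi; exists q; rewrite distrC ltr_distl.
  exists (\row_i sval (q_ i), k) => //; rewrite asboolT.
    by move=> i; rewrite !mxE; exact: svalP (q_ i).
  move=> z Bz; apply: Hr; rewrite -ball_normE /ball_ /=.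
  apply: (@le_lt_trans _ _ (k.+1%:R^-1 + k.+1%:R^-1)); last by rewrite [ltRHS]splitr ltrD.
  apply: norm_le_coord => [|i]; first by rewrite addr_ge0.
  rewrite !mxE; have := Bz i; rewrite !mxE /= => /ltW B1.
  have /ltW B2 := svalP (q_ i).
  rewrite -[y 0 i](subrK (ratr (sval (q_ i)))) -addrA (le_trans (ler_normD _ _)) //.
  by rewrite lerD // distrC.
apply: countable_bigcupT_measurable; first exact: countableP.
by move=> p; case: ifP.
Qed.

Lemma continuous_on_measurable (U : set 'rV[R]_n) (f : 'rV[R]_n -> R) : open U ->
  (forall x, U x -> {for x, continuous f}) -> measurable_fun U f.
Proof.
move=> oU cf; apply: (measurability _ (RGenOpens.measurableE R)).
move=> _ [_ [a [b ->] <-]]; apply: open_measurable_rV.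
rewrite openE => x [Ux fx]; apply: filterI; first exact: open_nbhs_nbhs.
have ab : nbhs (f x) [set` `]a, b[%R].
  by apply: open_nbhs_nbhs; split => //; exact: interval_open.
exact: (cf x Ux _ ab).
Qed.

End BorelRV.

(** * Integration over a cube, one coordinate split off *)

Section CubeIntegral.
Context {R : realType}.
Implicit Types (a b : R).
Local Notation mu := (@lebesgue_measure R).

Let cons_cube (n : nat) a b (t : R) (y : 'rV[R]_n) :
  cube a b (cons_rV (t, y)) = (t \in `]a, b[%R /\ cube a b y).
Proof.
apply/propext; split=> [H|[ty Hy] i].
  split=> [|i]; first by have := H ord0; rewrite mxE unlift_none.
  by have := H (lift ord0 i); rewrite mxE liftK.
by rewrite mxE; case: unliftP => [j _|_].
Qed.

Let product_cube_lty (n : nat) a b : (lebesgue_rV (@cube R n a b) < +oo)%E ->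
  ((mu \x @lebesgue_rV R n)%E
    (([set` `]a, b[%R] : set (measurableTypeR R)) `*` cube a b) < +oo)%E.
Proof.
move=> IH; have mI : measurable ([set` `]a, b[%R] : set (measurableTypeR R)) by [].
rewrite (@product_measure1E _ _ _ _ _ mu (@lebesgue_rV R n)) //; last exact: measurable_cube.
rewrite lte_mul_pinfty ?measure_ge0 //.
have : (mu [set` `]a, b[%R] < +oo)%E by rewrite lebesgue_measure_itv; case: ifP; rewrite ltry.
by rewrite ge0_fin_numE.
Qed.

Lemma lebesgue_cube_lty (n : nat) a b : (lebesgue_rV (@cube R n a b) < +oo)%E.
Proof.
elim: n => [|n IH]; first by rewrite /= diracE ltry.
rewrite [lebesgue_rV _]/=; apply: le_lt_trans (product_cube_lty IH).
rewrite le_eqVlt; apply/orP; left; apply/eqP; congr product_measure1.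
by apply/seteqP; split=> -[t y] /=; rewrite cons_cube.
Qed.

Lemma compact_bounded_fun (n : nat) (A : set 'rV[R]_n) (f : 'rV[R]_n -> R) :
  compact A -> (forall x, A x -> {for x, continuous f}) ->
  exists M, forall x, A x -> `|f x| <= M.
Proof.
move=> cA cf; have [A0|/set0P/negP/negPn/eqP ->] := pselect (A !=set0); last by exists 0.
have [c _ H] : exists2 c, c \in A & forall t, t \in A -> `|f t| <= `|f c|.
  apply: (compact_EVT_max (f := fun x => `|f x|)) => //.
  apply: continuous_in_subspaceT => x /[1!inE] Ax.
  exact: (cvg_norm (cf x Ax)).
by exists `|f c| => x Ax; apply: H; rewrite inE.
Qed.

Lemma cube_bounded_fun (n : nat) (f : 'rV[R]_n -> R) a b : continuous f ->
  exists M, forall y, cube a b y -> `|f y| <= M.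
Proof.
move=> cf; have cA : compact [set y : 'rV[R]_n | forall i, [set` `[a, b]%R] (y ord0 i)].
  by apply: (@rV_compact _ _ (fun=> [set` `[a, b]%R])) => i; exact: segment_compact.
have [|M H] := compact_bounded_fun cA (f := f); first by move=> x _; exact: cf.
exists M => y cy; apply: H => i; have := cy i.
by rewrite /= !in_itv /= => /andP[/ltW -> /ltW ->].
Qed.

(** [lebesgue_rV] in dimension n + 1 is by definition the image of a product measure under
    [cons_rV]. Extending the integrand by zero turns the cube into the full product space, ready for
    Fubini. *)
Lemma integral_cube_rVS (n : nat) (g : 'rV[R]_n.+1 -> R) a b : continuous g ->
  let f := (fun p => (g (cons_rV p))%:E) \_
    (([set` `]a, b[%R] : set (measurableTypeR R)) `*` cube a b) in
  (mu \x @lebesgue_rV R n)%E.-integrable setT f /\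
  (\int[@lebesgue_rV R n.+1]_(y in cube a b) (g y)%:E =
   \int[(mu \x @lebesgue_rV R n)%E]_p f p)%E.
Proof.
move=> cg; set A := _ `*` _ => f.
have mg : measurable_fun setT g.
  by apply: continuous_on_measurable => [|x _]; [exact: openT|exact: cg].
have mA : measurable A by apply: measurableX => //; exact: measurable_cube.
have fE : f = ((EFin \o g) \_ (cube a b)) \o @cons_rV R n.
  apply/funext => -[t y]; rewrite /f /patch /=.
  have -> : ((t, y) \in A) = (cons_rV (t, y) \in cube a b).
    by apply/idP/idP; rewrite !inE /= cons_cube.
  by [].
have intf : (mu \x @lebesgue_rV R n)%E.-integrable setT f.
  apply: (integrable_mkcond _ mA).1.
  apply: measurable_bounded_integrable => //.
  - exact: product_cube_lty (lebesgue_cube_lty n a b).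
  - apply: measurable_funTS; apply: measurableT_comp => //; exact: measurable_cons_rV.
  - have [M HM] := @cube_bounded_fun _ g a b cg.
    exists M; split; first exact: num_real.
    move=> M' MM' -[t y] Aty /=; apply: (le_trans _ (ltW MM')); apply: HM.
    by rewrite cons_cube.
split => //; rewrite integral_mkcond.
pose p : {measure set (measurableTypeR R * 'rV[R]_n)%type -> \bar R} :=
  (mu \x @lebesgue_rV R n)%E.
rewrite (@eq_measure_integral _ _ _ _
  (measure_function_pushforward__canonical__measure_function_Measure p
    (@measurable_cons_rV R n))); last by [].
rewrite integral_pushforward //=.
- by rewrite preimage_setT fE.
- exact: measurable_cons_rV.
- apply/(measurable_restrictT _ _).1; first exact: measurable_cube.
  by apply: measurable_funTS; exact: measurableT_comp.
- by rewrite preimage_setT -fE.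
Qed.

End CubeIntegral.

(** * Integrals of derivatives over a cube *)

Section CubeDivergence.
Context {R : realType}.
Local Notation mu := (@lebesgue_measure R).

Lemma integral_derive_eq0 (G g : R -> R) (a b : R) : a < b -> continuous g ->
  (forall t, is_derive t (1 : R) G (g t)) -> G a = G b ->
  (\int[mu]_(t in [set` `]a, b[%R]) (g t)%:E = 0)%E.
Proof.
move=> ab cg dG Gab.
have cG t : {for t, continuous G}.
  by apply/differentiable_continuous/derivable1_diffP; exact: ex_derive.
have mg : measurable_fun [set` `]a, b[%R] (EFin \o g).
  apply/measurable_EFinP; apply: measurable_funTS.
  exact: continuous_measurable_fun.
rewrite -(@integral_itv_bndoo _ a b _ true false) //.
rewrite (@continuous_FTC2 _ g G) //.
- by rewrite Gab subee.
- exact: continuous_subspaceT.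
- split=> [t _||]; first exact: ex_derive.
  + exact: (cvg_at_right_filter (cG a)).
  + exact: (cvg_at_left_filter (cG b)).
- by move=> t _; rewrite derive1E derive_val.
Qed.

Let is_derive_cons0 (n : nat) (G : 'rV[R]_n.+1 -> R) (t d : R) (y : 'rV[R]_n) :
  is_derive (cons_rV (t, y)) (ebasis ord0) G d ->
  is_derive t (1 : R) (fun s => G (cons_rV (s, y))) d.
Proof.
move=> dG; have E : cons_rV (t, y) = cons_rV (0, y) + t *: ebasis ord0 :> 'rV[R]_n.+1.
  apply/rowP => i; rewrite !mxE /=; case: unliftP => [j ->|->].
    by rewrite eq_sym (negPf (neq_lift _ _)) mulr0 addr0.
  by rewrite eqxx mulr1 add0r.
rewrite E in dG.
have -> : (fun s => G (cons_rV (s, y))) =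
    (fun s => G (cons_rV (0, y) + s *: ebasis ord0)).
  apply/funext => s; congr G; apply/rowP => i; rewrite !mxE /=.
  case: unliftP => [j ->|->].
    by rewrite eq_sym (negPf (neq_lift _ _)) mulr0 addr0.
  by rewrite eqxx mulr1 add0r.
rewrite -(@derive_val _ _ _ _ _ _ _ dG); apply: is_derive_line.
exact: ex_derive.
Qed.

Let is_derive_consS (n : nat) (G : 'rV[R]_n.+1 -> R) (t d : R) (y : 'rV[R]_n) (j : 'I_n) :
  is_derive (cons_rV (t, y)) (ebasis (lift ord0 j)) G d ->
  is_derive y (ebasis j) (fun z => G (cons_rV (t, z))) d.
Proof.
have E (h : R) : cons_rV (t, h *: ebasis j + y) =
    h *: ebasis (lift ord0 j) + cons_rV (t, y) :> 'rV[R]_n.+1.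
  apply/rowP => i; rewrite !mxE /=; case: unliftP => [k ->|->].
    by rewrite !mxE (inj_eq lift_inj) /=.
  by rewrite (negPf (neq_lift _ _)) mulr0 add0r.
have E' : (fun h : R => h^-1 *: (((fun z => G (cons_rV (t, z))) \o shift y)
    (h *: ebasis j) - G (cons_rV (t, y)))) = (fun h : R => h^-1 *: ((G \o
    shift (cons_rV (t, y))) (h *: ebasis (lift ord0 j)) - G (cons_rV (t, y)))).
  by apply/funext => h /=; rewrite E.
move=> [dG <-]; apply: DeriveDef; first by rewrite /derivable E'.
by rewrite /derive E'.
Qed.

(** Induction on the dimension. If j is not the split-off coordinate, the slices have integral zero
    by induction; otherwise the fundamental theorem of calculus applies on each line. *)
Lemma integral_cube_derive_eq0 (n : nat) (j : 'I_n) (G g : 'rV[R]_n -> R) (a b : R) :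
  a < b -> continuous g -> (forall y, is_derive y (ebasis j) G (g y)) ->
  (forall y : 'rV[R]_n, y 0 j = a \/ y 0 j = b -> G y = 0) ->
  (\int[@lebesgue_rV R n]_(y in cube a b) (g y)%:E = 0)%E.
Proof.
move=> ab; elim: n j G g => [[]//|n IH] j G g cg dG G0.
have [intf ->] := integral_cube_rVS a b cg.
set f := _ \_ _ in intf *.
have cons_cont (y : 'rV[R]_n) : continuous (fun t : R => cons_rV (t, y)).
  move=> t; apply: cvg_rV => i; under eq_fun do rewrite mxE.
  by rewrite mxE; case: unliftP => [k _|_]; [exact: cvg_cst|exact: cvg_id].
have cons_cont' (t : R) : continuous (fun y : 'rV[R]_n => cons_rV (t, y)).
  move=> y; apply: (@cvg_rV _ _ _ (nbhs y)) => i; under eq_fun do rewrite mxE.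
  rewrite mxE; case: unliftP => [k _|_]; last exact: cst_continuous.
  exact: coord_continuous.
have fE t y : f (t, y) = if (t \in `]a, b[%R) && (y \in cube a b)
    then (g (cons_rV (t, y)))%:E else 0%E.
  rewrite /f /patch /=; congr (if _ then _ else _).
  by apply/idP/andP; rewrite !inE /= => -[].
have [k jE|jE] := unliftP ord0 j.
  rewrite -(@integral12_prod_meas1 _ _ _ _ _ mu (@lebesgue_rV R n)) //.
  apply: integral0_eq => t _; rewrite /fubini_F.
  under eq_integral do rewrite fE.
  case: (boolP (t \in `]a, b[%R)) => tab /=; last exact: integral0.
  rewrite -[RHS](IH k (fun y => G (cons_rV (t, y))) (fun y => g (cons_rV (t, y)))).
  - by rewrite [RHS]integral_mkcond.
  - by move=> y; apply: continuous_comp; [exact: cons_cont'|exact: cg].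
  - by move=> y; apply: is_derive_consS; rewrite -jE.
  - by move=> y H; apply: G0; rewrite jE mxE liftK.
(* Here j is the split-off coordinate; the other order of integration makes it the inner
   variable. *)
rewrite -(@integral21_prod_meas1 _ _ _ _ _ mu (@lebesgue_rV R n)) //.
apply: integral0_eq => y _; rewrite /fubini_G.
under eq_integral do rewrite fE andbC.
case: (boolP (y \in cube a b)) => yab /=; last exact: integral0.
rewrite -[RHS](@integral_derive_eq0 (fun t => G (cons_rV (t, y)))
  (fun t => g (cons_rV (t, y))) a b ab).
- rewrite [RHS]integral_mkcond; apply: eq_integral => t _.
  by rewrite /patch mem_setE.
- by move=> t; apply: continuous_comp; [exact: cons_cont|exact: cg].
- by move=> t; apply: is_derive_cons0; rewrite -jE.
- by rewrite !G0 // jE mxE unlift_none; [right|left].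
Qed.

End CubeDivergence.

Section ComposeReal.
Context {R : realType} {n : nat}.
Implicit Types (f : 'rV[R]_n -> R) (x u : 'rV[R]_n).

Lemma differentiable_comp_real (phi : R -> R) f x (d : R) :
  is_derive (f x) (1 : R) phi d -> differentiable f x ->
  differentiable (fun y => phi (f y)) x.
Proof.
move=> dphi df; apply: differentiable_comp => //.
by apply/derivable1_diffP; exact: ex_derive.
Qed.

Lemma derive_comp_real (phi : R -> R) f x u (d : R) :
  is_derive (f x) (1 : R) phi d -> differentiable f x ->
  'D_u (fun y => phi (f y)) x = d * 'D_u f x.
Proof.
move=> dphi df.
have dphi' : differentiable phi (f x) by apply/derivable1_diffP; exact: ex_derive.
rewrite deriveE; last exact: differentiable_comp.
rewrite diff_comp //= -[in RHS](@derive_val _ _ _ _ _ _ _ dphi) !deriveE //.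
by rewrite -[X in 'd phi _ X]mulr1 [LHS]linearZ /= mulrC.
Qed.

Lemma Ck1_comp_real (phi dphi : R -> R) f (U : set 'rV[R]_n) : open U ->
  (forall t, is_derive t (1 : R) phi (dphi t)) -> continuous dphi ->
  Ck 1 U f -> Ck 1 U (fun y => phi (f y)).
Proof.
move=> oU dphiE cdphi Cf; split=> [x Ux|i].
  exact: differentiable_comp_real (dphiE _) (CkS_differentiable Cf Ux).
have C0 : Ck 0 U (fun y => dphi (f y) * 'D_(ebasis i) f y).
  apply: CkM => //; last exact: CkS_derive.
  move=> x Ux; apply: (@continuous_comp _ _ _ f dphi); last exact: cdphi.
  exact: Ck_continuous Cf Ux.
apply: Ck_ext C0 => // x /[1!inE] Ux.
by rewrite (derive_comp_real _ (dphiE _)) //; exact: CkS_differentiable Cf Ux.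
Qed.

Lemma derive_scale f x u (t : R) : differentiable f (t *: x) ->
  'D_u (fun y => f (t *: y)) x = t * 'D_u f (t *: x).
Proof.
move=> df.
have dZ y : differentiable (fun y : 'rV[R]_n => t *: y) y.
  exact: differentiableZ.
rewrite deriveE; last exact: (@differentiable_comp _ _ _ _ (fun y => t *: y)).
rewrite (@diff_comp _ _ _ _ (fun y => t *: y)) //= -!deriveE //.
have -> : 'D_u (fun y : 'rV[R]_n => t *: y) x = t *: u.
  by rewrite deriveE // diff_val.
by rewrite !deriveE // [LHS]linearZ.
Qed.

End ComposeReal.

(** * The Euclidean norm and the radial projection *)

Section Normalize.
Context {R : realType} {n : nat}.
Implicit Types (x y u : 'rV[R]_n).

Definition nonzero : set 'rV[R]_n := [set y | y != 0].

Lemma open_nonzero : open nonzero.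
Proof.
have -> : nonzero = ~` [set (0 : 'rV[R]_n)].
  by apply/seteqP; split=> y /=; [move/eqP|move/eqP].
apply/closed_openC/accessible_closed_set1/hausdorff_accessible.
exact: norm_hausdorff.
Qed.

Lemma enorm_sqr y : enorm y ^+ 2 = dot y y.
Proof. by rewrite sqr_sqrtr // dot_ge0. Qed.

Lemma enorm_gt0 y : y != 0 -> 0 < enorm y.
Proof. by move=> y0; rewrite sqrtr_gt0 dot_gt0. Qed.

Lemma enorm_neq0 y : y != 0 -> enorm y != 0.
Proof. by move=> /enorm_gt0/lt0r_neq0. Qed.

Lemma enormZ (t : R) y : 0 <= t -> enorm (t *: y) = t * enorm y.
Proof.
move=> t0; rewrite /enorm dotZl dotZr mulrA -expr2 sqrtrM ?sqr_ge0 //.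
by rewrite sqrtr_sqr ger0_norm.
Qed.

Lemma enorm_normalize y : y != 0 -> enorm (normalize y) = 1.
Proof.
move=> y0; rewrite /normalize enormZ ?invr_ge0 ?sqrtr_ge0 //.
by rewrite mulVf // enorm_neq0.
Qed.

Lemma dot_normalize y : y != 0 -> dot (normalize y) (normalize y) = 1.
Proof. by move=> /enorm_normalize; rewrite -enorm_sqr => ->; rewrite expr1n. Qed.

Lemma normalize_neq0 y : y != 0 -> normalize y != 0.
Proof. by move=> y0; rewrite -dot_eq0 dot_normalize // oner_neq0. Qed.

Lemma normalizeZ (t : R) y : 0 < t -> normalize (t *: y) = normalize y.
Proof.
move=> t0; have [->|y0] := eqVneq y 0; first by rewrite scaler0.
rewrite /normalize enormZ ?ltW // scalerA invfM mulrAC mulVf ?mul1r //.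
exact: lt0r_neq0.
Qed.

Lemma enormK y : enorm y *: normalize y = y.
Proof.
have [->|y0] := eqVneq y 0; first by rewrite /normalize !scaler0.
by rewrite /normalize scalerA divff ?scale1r // enorm_neq0.
Qed.

Lemma sphere_neq0 x : sphere x -> x != 0.
Proof.
rewrite /sphere /=; case: (eqVneq x 0) => // ->.
by rewrite dot0l => /eqP; rewrite eq_sym oner_eq0.
Qed.

Lemma sphere_enorm x : sphere x -> enorm x = 1.
Proof. by rewrite /sphere /enorm /= => ->; rewrite sqrtr1. Qed.

Lemma normalize_sphere x : sphere x -> normalize x = x.
Proof. by move=> sx; rewrite /normalize sphere_enorm // invr1 scale1r. Qed.

Lemma Ck_dot k (U : set 'rV[R]_n) : open U -> Ck k U (fun y => dot y y).
Proof. by move=> oU; apply: Ck_sum => // i _; apply: CkM => //; exact: Ck_coord. Qed.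

Lemma derive_coord y u (i : 'I_n) : 'D_u (fun z : 'rV[R]_n => z 0 i) y = u 0 i.
Proof.
apply: cvg_lim => //; apply: cvg_near_cst; near=> h.
rewrite /= !mxE addrK; apply: mulKf; near: h; exact: nbhs_dnbhs_neq.
Unshelve. all: by end_near. Qed.

Lemma differentiable_coord_rV y (i : 'I_n) : differentiable (fun z : 'rV[R]_n => z 0 i) y.
Proof. exact: differentiable_coord. Qed.

Lemma derive_dot_self y u : 'D_u (fun z => dot z z) y = 2 * dot u y.
Proof.
have H (i : 'I_n) : is_derive y u (fun z : 'rV[R]_n => z 0 i * z 0 i)
    (y 0 i * u 0 i + y 0 i * u 0 i).
  have d1 : is_derive y u (fun z : 'rV[R]_n => z 0 i) (u 0 i).
    rewrite -(derive_coord y u i); apply: derivableP.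
    exact/diff_derivable/differentiable_coord_rV.
  exact: is_deriveM.
rewrite (@derive_val _ _ _ _ _ _ _ (is_derive_sumr (index_enum _) H)).
rewrite mulr_sumr; apply: eq_bigr => i _.
by rewrite -mulr2n -(mulr_natl (_ * _)) [u 0 i * _]mulrC.
Qed.

Lemma differentiable_enorm y : y != 0 -> differentiable (@enorm R n) y.
Proof.
move=> y0; apply: (@differentiable_comp_real _ _ (@Num.sqrt R) (fun z => dot z z)).
  by apply: is_derive1_sqrt; exact: dot_gt0.
exact: (CkS_differentiable (Ck_dot 1 openT)).
Qed.

Lemma derive_enorm y u : y != 0 -> 'D_u (@enorm R n) y = dot u y / enorm y.
Proof.
move=> y0; have sq := is_derive1_sqrt (dot_gt0 y0).
rewrite (@derive_comp_real _ _ (@Num.sqrt R) (fun z => dot z z) _ _ _ sq).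
  rewrite derive_dot_self invfM mulrAC mulrA mulVf // mul1r mulrC.
  by rewrite /enorm.
exact: (CkS_differentiable (Ck_dot 1 openT)).
Qed.

Lemma Ck_enorm k : Ck k nonzero (@enorm R n).
Proof.
elim: k => [|k IH].
  by move=> y y0; apply: differentiable_continuous; exact: differentiable_enorm.
split=> [y y0|i]; first exact: differentiable_enorm.
have Cq : Ck k nonzero (fun y : 'rV[R]_n => y 0 i * (enorm y)^-1).
  apply: CkM open_nonzero _ _; first exact: Ck_coord.
  by apply: CkV open_nonzero _ IH => y; exact: enorm_neq0.
apply: Ck_ext open_nonzero _ Cq => y /[1!inE] y0.
by rewrite derive_enorm // dot_ebasisl.
Qed.

Lemma Ck_normalize k (j : 'I_n) : Ck k nonzero (fun y => normalize y 0 j).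
Proof.
have -> : (fun y : 'rV[R]_n => normalize y 0 j) = (fun y => (enorm y)^-1 * y 0 j).
  by apply/funext => y; rewrite mxE.
apply: CkM open_nonzero _ _; last exact: Ck_coord.
by apply: CkV open_nonzero _ (Ck_enorm k) => y; exact: enorm_neq0.
Qed.

Lemma derive_normalize y u (j : 'I_n) : y != 0 ->
  'D_u (fun z => normalize z 0 j) y =
  (u 0 j - dot u (normalize y) * normalize y 0 j) / enorm y.
Proof.
move=> y0; have e0 := enorm_neq0 y0.
have -> : (fun y : 'rV[R]_n => normalize y 0 j) = (fun y => y 0 j * (enorm y)^-1).
  by apply/funext => z; rewrite mxE mulrC.
have de : derivable (@enorm R n) y u by exact/diff_derivable/differentiable_enorm.
rewrite deriveM; last 2 first.
- exact/diff_derivable/differentiable_coord_rV.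
- exact: derivableV.
rewrite deriveV // derive_coord derive_enorm // /normalize dotZr mxE.
rewrite [X in X + _]/GRing.scale [X in _ + X]/GRing.scale /=.
rewrite [X in _ * X + _]/GRing.scale /=.
move: (dot u y) (u 0 j) (y 0 j) => a b c.
by field.
Qed.

End Normalize.

(** * A cutoff function of class C^1 *)

Section Cutoff.
Context {R : realType}.

(** Squaring the positive part makes it continuously differentiable, which is all that integrating
    first derivatives over a cube demands. *)
Definition pos_sqr (t : R) : R := Num.max 0 t ^+ 2.
Definition dpos_sqr (t : R) : R := 2 * Num.max 0 t.

Lemma is_derive_of_quadratic (f : R -> R) (t d : R) :
  (forall h, `|f (t + h) - f t - h * d| <= h ^+ 2) -> is_derive t (1 : R) f d.
Proof.
move=> H.
have cvgd : (fun h : R => h^-1 *: ((f \o shift t) (h *: 1) - f t)) @ 0^' --> d.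
  apply/cvgrPdist_le => e e0; near=> h.
  have h0 : h != 0 by near: h; exact: nbhs_dnbhs_neq.
  have he : `|h| <= e.
    by near: h; apply: nbhs_dnbhs; apply: (@nbhs0_le R R).
  rewrite /= [h *: 1]mulr1 distrC.
  have -> : h^-1 *: (f (h + t) - f t) - d = h^-1 * (f (t + h) - f t - h * d).
    by rewrite [LHS]/= /GRing.scale /= addrC [RHS]mulrBr mulKf // addrC [h + t]addrC.
  rewrite normrM normfV ler_pdivrMl ?normr_gt0 // [leRHS]mulrC.
  apply: (le_trans (H h)); rewrite -[h ^+ 2]ger0_norm ?sqr_ge0 // normrX expr2.
  by rewrite ler_wpM2r.
by apply: DeriveDef; [apply/cvg_ex; exists d|exact: cvg_lim].
Unshelve. all: by end_near. Qed.

Lemma is_derive_pos_sqr (t : R) : is_derive t (1 : R) pos_sqr (dpos_sqr t).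
Proof.
apply: is_derive_of_quadratic => h; rewrite /pos_sqr /dpos_sqr ler_norml.
have [t0|t0] := leP 0 t; have [th|th] := leP 0 (t + h); apply/andP; split; nra.
Qed.

Lemma continuous_dpos_sqr : continuous dpos_sqr.
Proof.
move=> t; apply: cvgM; first exact: cvg_cst.
by apply: continuous_max; [exact: cvg_cst|exact: cvg_id].
Qed.

(** A C^1 step: 1 for t <= 0, 0 for t >= 1, with values between 0 and 1. *)
Definition bump (t : R) : R := pos_sqr (1 - pos_sqr t).
Definition dbump (t : R) : R := dpos_sqr (1 - pos_sqr t) * - dpos_sqr t.

Lemma is_derive_bump (t : R) : is_derive t (1 : R) bump (dbump t).
Proof.
have d1 := is_derive_pos_sqr t; have d2 := is_derive_pos_sqr (1 - pos_sqr t).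
apply: (@is_derive1_comp _ pos_sqr (fun s => 1 - pos_sqr s)).
have : is_derive t (1 : R) (cst 1 - pos_sqr) (0 - dpos_sqr t) by exact: is_deriveB.
by rewrite sub0r.
Qed.

Lemma continuous_dbump : continuous dbump.
Proof.
have cp : continuous pos_sqr.
  move=> t; have d1 := is_derive_pos_sqr t.
  by apply/differentiable_continuous/derivable1_diffP; exact: ex_derive.
move=> t; apply: cvgM.
  apply: (@continuous_comp _ _ _ (fun t => 1 - pos_sqr t) dpos_sqr).
    by apply: cvgB; [exact: cvg_cst|exact: cp].
  exact: continuous_dpos_sqr.
by apply: cvgN; exact: continuous_dpos_sqr.
Qed.

Lemma bump_eq1 (t : R) : t <= 0 -> bump t = 1.
Proof. by move=> t0; rewrite /bump /pos_sqr (max_l t0) expr0n subr0 max_r // expr1n. Qed.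

Lemma bump_eq0 (t : R) : 1 <= t -> bump t = 0.
Proof.
move=> t1; rewrite /bump /pos_sqr; have t0 : 0 <= t by lra.
rewrite (max_r t0) (@max_l _ _ 0) ?expr0n //.
by rewrite subr_le0 expr_ge1.
Qed.

Lemma bump_ge0_le1 (t : R) : 0 <= bump t <= 1.
Proof.
rewrite /bump {1}/pos_sqr sqr_ge0 /= /pos_sqr.
have H : 0 <= Num.max 0 t ^+ 2 by exact: sqr_ge0.
have [|h] := leP 0 (1 - Num.max 0 t ^+ 2); last by rewrite expr0n ler01.
by move=> h; rewrite expr_le1 // lerBlDr lerDl.
Qed.

End Cutoff.

(** * The divergence theorem on the positive part of the sphere *)

Section SphericalDivergence.
Context {R : realType} {n : nat}.
Implicit Types (y u : 'rV[R]_n).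
Local Notation nonzero := (@nonzero R n).

(* [bump (2 - K r) * bump (K (r - 1))] is [1] for [2/K <= r <= 1] and vanishes
   for [r <= 1/K] and for [1 + 1/K <= r]; here [r] is the squared norm. *)
Definition cutoff (K : R) y : R :=
  bump (2 - K * dot y y) * bump (K * (dot y y - 1)).

Lemma Ck_cutoff (K : R) : Ck 1 setT (cutoff K).
Proof.
have oT : open [set: 'rV[R]_n] := openT.
have Cd := Ck_dot 1 oT.
have Cc (a : R) := Ck_cst (n := n) 1 setT a.
have C1 := CkB oT (Cc 2) (CkM oT (Cc K) Cd).
have C2 := CkM oT (Cc K) (CkB oT Cd (Cc 1)).
exact: (CkM oT
  (Ck1_comp_real oT (@is_derive_bump R) (@continuous_dbump R) C1)
  (Ck1_comp_real oT (@is_derive_bump R) (@continuous_dbump R) C2)).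
Qed.

(** The cutoff is radial, so its gradient is a multiple of y. The factor stays anonymous: it will
    multiply the radial component of a tangential field. *)
Lemma derive_cutoff (K : R) y : exists s, forall u, 'D_u (cutoff K) y = s * dot u y.
Proof.
have Cd := CkS_differentiable (Ck_dot (R := R) (n := n) 1 openT) (I : setT y).
exists (dbump (2 - K * dot y y) * (- K * 2) * bump (K * (dot y y - 1))
  + bump (2 - K * dot y y) * (dbump (K * (dot y y - 1)) * (K * 2))) => u.
have dd : is_derive y u (fun z => dot z z) (2 * dot u y).
  by rewrite -derive_dot_self; apply/derivableP/diff_derivable.
pose phi t := bump (2 - K * t) * bump (K * (t - 1)).
pose dphi := dbump (2 - K * dot y y) * - K * bump (K * (dot y y - 1))
  + bump (2 - K * dot y y) * (dbump (K * (dot y y - 1)) * K).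
have dphiE : is_derive (dot y y) (1 : R) phi dphi.
  have d1 : is_derive (dot y y) (1 : R) (fun t => bump (2 - K * t))
      (dbump (2 - K * dot y y) * - K).
    have b1 := is_derive_bump (2 - K * dot y y).
    apply: (@is_derive1_comp _ bump (fun t => 2 - K * t)).
    have : is_derive (dot y y) (1 : R) (cst 2 - K *: id) (0 - K *: 1) by exact: is_deriveB.
    by rewrite sub0r [K *: 1]mulr1.
  have d2 : is_derive (dot y y) (1 : R) (fun t => bump (K * (t - 1)))
      (dbump (K * (dot y y - 1)) * K).
    have b1 := is_derive_bump (K * (dot y y - 1)).
    apply: (@is_derive1_comp _ bump (fun t => K * (t - 1))).
    have : is_derive (dot y y) (1 : R) (K *: (id - cst 1)) (K *: (1 - 0)).
      by apply: is_deriveZ; exact: is_deriveB.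
    by rewrite subr0 [K *: 1]mulr1.
  apply: is_derive_eq; rewrite /dphi /GRing.scale /=.
  by rewrite addrC [in LHS]mulrC.
rewrite (@derive_comp_real _ _ phi (fun z => dot z z) _ _ _ dphiE Cd).
rewrite derive_dot_self /dphi.
move: (dot u y) (bump _) (bump _) (dbump _) (dbump _) => a b c d e; ring.
Qed.

Lemma cutoff_le1 (K : R) y : 0 <= cutoff K y <= 1.
Proof.
have /andP[a0 a1] := bump_ge0_le1 (2 - K * dot y y).
have /andP[b0 b1] := bump_ge0_le1 (K * (dot y y - 1)).
by rewrite mulr_ge0 //= mulr_ile1.
Qed.

Lemma cutoff_small (K : R) y : K * dot y y <= 1 -> cutoff K y = 0.
Proof. by move=> h; rewrite /cutoff bump_eq0 ?mul0r //; lra. Qed.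

Lemma cutoff_large (K : R) y : 1 <= K * (dot y y - 1) -> cutoff K y = 0.
Proof. by move=> h; rewrite /cutoff (bump_eq0 h) mulr0. Qed.

Lemma cutoff_mid (K : R) y : 0 <= K -> 2 <= K * dot y y -> dot y y <= 1 -> cutoff K y = 1.
Proof.
move=> K0 h y1; rewrite /cutoff !bump_eq1 ?mulr1 //; last lra.
by rewrite mulr_ge0_le0 // subr_le0.
Qed.

Lemma compact_sphere : compact (@sphere R n).
Proof.
apply: bounded_closed_compact.
  exists 1; split; first exact: num_real.
  move=> M M1 x sx /=; apply: (le_trans _ (ltW M1)).
  rewrite -(@ler_pXn2r _ 2) ?nnegrE // expr1n.
  by apply: (le_trans (norm2_le_dot x)); rewrite sx.
have -> : sphere = (fun x : 'rV[R]_n => dot x x) @^-1` [set 1].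
  by apply/seteqP; split.
apply: preimage_closed; last exact: closed_eq.
by move=> z _; exact: (Ck_continuous (Ck_dot 0 openT)).
Qed.

Definition orthant_ball : set 'rV[R]_n :=
  [set y : 'rV[R]_n | (forall i, 0 < y 0 i) /\ enorm y <= 1].

Section Field.
Variable B : 'I_n -> 'rV[R]_n -> R.
Hypothesis CB : forall j, Ck 1 nonzero (B j).
(** Homogeneity of degree 1 - n, with denominators cleared. *)
Hypothesis B_homog : forall j (t : R) y, 0 < t -> y != 0 ->
  t ^+ n * B j (t *: y) = t * B j y.

Let divB y := \sum_j 'D_(ebasis j) (B j) y.
(** [q] is the coefficient of the radial part of the field, of degree -n, and [T] is the tangential
    rest. *)
Let q y := (\sum_j B j y * y 0 j) * (dot y y)^-1.
Let T j y := B j y - q y * y 0 j.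

Let Cq : Ck 1 nonzero q.
Proof.
have oZ := open_nonzero (R := R) (n := n).
apply: (CkM oZ); last by apply: (CkV oZ) (Ck_dot _ oZ) => y; rewrite dot_eq0.
by apply: Ck_sum => // j _; exact: (CkM oZ (CB j) (Ck_coord _ _ j)).
Qed.

Let dotT y : y != 0 -> \sum_j y 0 j * T j y = 0.
Proof.
move=> y0; rewrite /T; under eq_bigr do rewrite mulrBr mulrCA.
rewrite sumrB -mulr_sumr -/(dot y y) /q mulfVK ?dot_eq0 //.
by apply/eqP; rewrite subr_eq0; apply/eqP/eq_bigr => j _; rewrite mulrC.
Qed.

Let q_homog (t : R) y : 0 < t -> y != 0 -> t ^+ n * q (t *: y) = q y.
Proof.
move=> t0 y0; have tn0 := lt0r_neq0 t0.
rewrite /q mulrA mulr_sumr dotZl dotZr.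
under eq_bigr do rewrite mulrA B_homog // mxE mulrACA.
rewrite -mulr_sumr !invfM.
move: (\sum_(_ | _) _) (dot y y)^-1 => a b; by field.
Qed.

(* Euler's relation for the degree [-n] function [q]. *)
Let q_euler y : y != 0 -> 'D_y q y = - (n%:R * q y).
Proof.
move=> y0; have dq := CkS_differentiable Cq y0.
have d1 : is_derive (0 : R) (1 : R) (fun t : R => q (y + t *: y)) ('D_y q y).
  have := @is_derive_line _ _ q y y 0; rewrite scale0r addr0; apply.
  exact: diff_derivable.
pose p := (fun t : R => (1 + t) ^+ n).
have d2 : is_derive (0 : R) (1 : R) p n%:R.
  have : is_derive (0 : R) (1 : R) ((cst 1 + id) ^+ n)
      ((n%:R * (cst 1 + id : R -> R) 0 ^+ n.-1) *: (0 + 1)).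
    by apply: is_deriveX.
  by rewrite /= add0r /cst !fctE /= addr0 expr1n mulr1 [X in is_derive _ _ _ X]mulr1.
have d3 : is_derive (0 : R) (1 : R) (p * (fun t => q (y + t *: y)))
    (p 0 *: 'D_y q y + q (y + 0 *: y) *: n%:R) by exact: is_deriveM.
have : 'D_(1 : R) (p * (fun t : R => q (y + t *: y))) (0 : R) = 0.
  transitivity ('D_(1 : R) (cst (q y : R)) (0 : R)); last exact: derive_cst.
  apply: (@near_eq_derive R R R).
  near=> t; rewrite !fctE /p /=.
  have -> : y + t *: y = (1 + t) *: y by rewrite scalerDl scale1r.
  apply: q_homog => //.
  have : `|t| < 1 by near: t; apply: (@nbhs0_lt R R).
  by rewrite ltr_norml => /andP[t1 _]; rewrite -ltrBlDl sub0r.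
rewrite (@derive_val _ _ _ _ _ _ _ d3) /p addr0 expr1n scale1r scale0r addr0.
by move/eqP; rewrite addr_eq0 => /eqP ->; rewrite mulrC.
Unshelve. all: by end_near. Qed.

(** This factor lifts the divergence from degree -n to degree 0, so that it depends on [normalize y]
    only. *)
Let w y := enorm y ^+ n.

Let Cw : Ck 1 nonzero w.
Proof. exact: (CkX _ (@open_nonzero R n) (Ck_enorm 1)). Qed.

Let derive_w y : y != 0 -> exists s, forall u, 'D_u w y = s * dot u y.
Proof.
move=> y0; exists (n%:R * enorm y ^+ n.-1 / enorm y) => u.
have dX : is_derive (enorm y) (1 : R) (fun t : R => t ^+ n) (n%:R * enorm y ^+ n.-1).
  apply: DeriveDef; first exact: exprn_derivable.
  by rewrite exp_derive [LHS]mulr1.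
rewrite (derive_comp_real _ dX) ?derive_enorm //; last exact: differentiable_enorm.
by rewrite mulrA mulrAC.
Qed.

Let V K j y := cutoff K y * (w y * T j y).

Let CT j : Ck 1 nonzero (T j).
Proof.
have oZ := open_nonzero (R := R) (n := n).
exact: (CkB oZ (CB j) (CkM oZ Cq (Ck_coord _ _ j))).
Qed.

Let CV K j : 0 < K -> Ck 1 setT (V K j).
Proof.
move=> K0; have oZ := open_nonzero (R := R) (n := n).
apply: Ck_local => y _; have [->|y0] := eqVneq y 0; last first.
  have C1 : Ck 1 nonzero (cutoff K) := Ck_sub (@subsetT _ _) (Ck_cutoff K).
  exists nonzero; first exact: y0.
  exact: (CkM oZ C1 (CkM oZ Cw (CT j))).
(* On this neighbourhood of the origin the cutoff is identically zero, so the singularity of the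
   field is invisible. *)
pose U : set 'rV[R]_n := (fun y => dot y y) @^-1` [set t | t < K^-1].
have oU : open U.
  apply: open_comp; last exact: open_lt.
  by move=> z _; exact: (Ck_continuous (Ck_dot 0 openT)).
exists U; first by rewrite /U /= dot0l invr_gt0.
apply: Ck_ext oU _ (Ck_cst 1 U 0) => z /[1!inE] Uz.
rewrite /V cutoff_small ?mul0r //.
by rewrite -ler_pdivlMl // mulr1 ltW.
Qed.

Let divV K y : 0 < K -> \sum_j 'D_(ebasis j) (V K j) y = cutoff K y * (w y * divB y).
Proof.
move=> K0; have [->|y0] := eqVneq y 0.
  rewrite [in RHS]cutoff_small ?dot0l ?mulr0 // mul0r big1 // => j _.
  transitivity ('D_(ebasis j) (cst (0 : R)) (0 : 'rV[R]_n)); last exact: derive_cst.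
  apply: (@near_eq_derive R 'rV[R]_n R).
  have : \forall z \near (0 : 'rV[R]_n), dot z z < K^-1.
    have := Ck_continuous (Ck_dot (R := R) (n := n) 0 openT) (I : setT (0 : 'rV[R]_n)).
    by move=> /(cvgr_lt _); apply; rewrite dot0l invr_gt0.
  apply: filterS => z zK; rewrite /V cutoff_small ?mul0r //.
  by rewrite -ler_pdivlMl // mulr1 ltW.
have [s1 dc] := derive_cutoff K y; have [s2 dw] := derive_w y0.
have dcut j : derivable (cutoff K) y (ebasis j).
  exact/diff_derivable/(CkS_differentiable (Ck_cutoff K)).
have dw' j : derivable w y (ebasis j) by exact/diff_derivable/(CkS_differentiable Cw).
have dT j : derivable (T j) y (ebasis j) by exact/diff_derivable/(CkS_differentiable (CT j)).
have dq := CkS_differentiable Cq y0.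
have dTE j : 'D_(ebasis j) (T j) y =
    'D_(ebasis j) (B j) y - (q y + y 0 j * 'D_(ebasis j) q y).
  have dB : derivable (B j) y (ebasis j) by exact/diff_derivable/(CkS_differentiable (CB j)).
  have dx : derivable (fun z : 'rV[R]_n => z 0 j) y (ebasis j).
    exact/diff_derivable/differentiable_coord_rV.
  have dq' : derivable q y (ebasis j) by exact: diff_derivable.
  have H := is_deriveB (derivableP dB) (is_deriveM (derivableP dq') (derivableP dx)).
  rewrite (@derive_val _ _ _ _ _ _ _ H) derive_coord mxE !eqxx.
  by rewrite [q y *: _]mulr1.
have E j : 'D_(ebasis j) (V K j) y =
    cutoff K y * (w y * 'D_(ebasis j) (T j) y)
    + (cutoff K y * s2 + w y * s1) * (y 0 j * T j y).
  have H := is_deriveM (derivableP (dcut j))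
    (is_deriveM (derivableP (dw' j)) (derivableP (dT j))).
  rewrite (@derive_val _ _ _ _ _ _ _ H) dc dw dot_ebasisl.
  rewrite -[(w * T j) y]/(w y * T j y) /GRing.scale /=.
  move: (cutoff K y) (w y) (T j y) (y 0 j) ('D_(ebasis j) (T j) y).
  by move=> a b c d e; ring.
rewrite (eq_bigr _ (fun j _ => E j)) big_split /=.
rewrite -[X in _ + X]mulr_sumr dotT // mulr0 addr0.
rewrite -!mulr_sumr; congr (_ * (_ * _)).
rewrite (eq_bigr _ (fun j _ => dTE j)) sumrB big_split /=.
rewrite sumr_const card_ord -derive_grad // q_euler // -(mulr_natl (q y)).
by rewrite subrr subr0.
Qed.

Let divB_homog (t : R) y : 0 < t -> y != 0 -> t ^+ n * divB (t *: y) = divB y.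
Proof.
move=> t0 y0; have tn0 := lt0r_neq0 t0.
rewrite mulr_sumr; apply: eq_bigr => j _.
have ty0 : t *: y != 0 by rewrite scaler_eq0 negb_or tn0.
have dB z : z != 0 -> differentiable (B j) z by exact: CkS_differentiable (CB j).
apply: (mulfI tn0); rewrite mulrCA -derive_scale; last exact: dB.
have d1 : derivable (fun z => B j (t *: z)) y (ebasis j).
  apply: diff_derivable; apply: (@differentiable_comp _ _ _ _ (fun z => t *: z)) => //.
  exact: dB.
have d2 : derivable (B j) y (ebasis j) by exact/diff_derivable/dB.
have := deriveZ (t ^+ n : R) d1; have := deriveZ (t : R) d2.
rewrite /GRing.scale /= => <- <-.
apply: (@near_eq_derive R 'rV[R]_n R).
have : nbhs y nonzero by apply: open_nbhs_nbhs; split => //; exact: open_nonzero.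
by apply: filterS => z z0; exact: B_homog.
Qed.

Hypothesis n_gt0 : (0 < n)%N.
Hypothesis B_boundary : forall j y, y != 0 -> y 0 j = 0 -> B j y = 0.

(** The truncated fields vanish on all faces of the cube, so their divergences have integral zero.
    As the cutoff sharpens these converge pointwise to the divergence at [normalize y] on the unit
    ball and to 0 outside, dominated by the maximum of |div B| on the sphere. *)
Lemma spherical_divergence :
  (\int[@lebesgue_rV R n]_(y in orthant_ball)
    (divB (normalize y))%:E = 0)%E.
Proof.
have mC : measurable (@cube R n 0 2) by exact: measurable_cube.
have cube_neq0 y : cube 0 2 y -> y != 0.
  move=> /(_ (Ordinal n_gt0)) /[!in_itv] /= /andP[+ _].
  by apply: contraTneq => ->; rewrite mxE ltxx.
have cont_dB x : x != 0 -> {for x, continuous divB}.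
  move=> x0; have : Ck 0 nonzero divB.
    apply: Ck_sum => [|j _]; first exact: open_nonzero.
    exact: CkS_derive (CB j).
  exact.
pose f_ (k : nat) y := cutoff k.+1%:R y * (w y * divB y).
have f_E k : f_ k = (fun y => \sum_j 'D_(ebasis j) (V k.+1%:R j) y).
  by apply/funext => y; rewrite divV.
have dV_cont k j : continuous (fun y => 'D_(ebasis j) (V k.+1%:R j) y).
  by move=> y; exact: (Ck_continuous (CkS_derive j (CV j (ltr0Sn R k))) (I : setT y)).
have cont_meas (g : 'rV[R]_n -> R) : continuous g -> measurable_fun setT g.
  by move=> cg; apply: continuous_on_measurable => [|x _]; [exact: openT|exact: cg].
have int_cont (g : 'rV[R]_n -> R) : continuous g ->
    (@lebesgue_rV R n).-integrable (cube 0 2) (EFin \o g).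
  move=> cg; apply: measurable_bounded_integrable => //.
  - exact: lebesgue_cube_lty.
  - by apply: measurable_funTS; exact: cont_meas.
  - have [M HM] := @cube_bounded_fun _ _ g 0 2 cg.
    exists M; split; first exact: num_real.
    by move=> M' MM' y cy; apply: (le_trans _ (ltW MM')); exact: HM.
have int0 k : (\int[@lebesgue_rV R n]_(y in cube 0 2) (f_ k y)%:E = 0)%E.
  rewrite f_E; under eq_integral do rewrite -sumEFin.
  rewrite integral_sum //; last by move=> j; exact: int_cont.
  rewrite big1 // => j _.
  apply: (@integral_cube_derive_eq0 _ _ j (V k.+1%:R j)) => //.
    move=> y; apply/derivableP/diff_derivable.
    exact: (CkS_differentiable (CV j (ltr0Sn R k)) (I : setT y)).
  move=> y [yj|yj]; rewrite /V.
    have [->|y0] := eqVneq y 0; first by rewrite cutoff_small ?mul0r // dot0l mulr0.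
    by rewrite /T B_boundary // yj mulr0 subr0 !mulr0.
  rewrite cutoff_large ?mul0r //.
  (* On the face y_j = 2 the squared norm is beyond 1 + 1/K for every K >= 1: this dictates the side
     of the cube. *)
  have : 4 <= dot y y.
    rewrite /dot (bigD1 j) //= yj -[4]addr0 lerD //; last first.
      by apply: sumr_ge0 => i _; rewrite -expr2 sqr_ge0.
    by rewrite -natrM.
  have : 1 <= k.+1%:R :> R by rewrite ler1n.
  by move: (dot y y) => a; nra.
pose F y := if enorm y <= 1 then divB (normalize y) else 0.
have [M HM] : exists M, forall x, sphere x -> `|divB x| <= M.
  apply: compact_bounded_fun => [|x /sphere_neq0]; last exact: cont_dB.
  exact: compact_sphere.
have wE y : y != 0 -> w y * divB y = divB (normalize y).
  move=> y0; rewrite -{2}(enormK y) divB_homog ?enorm_gt0 //.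
  exact: normalize_neq0.
have cvgF y : cube 0 2 y -> (fun k => (f_ k y)%:E) @ \oo --> (F y)%:E.
  move=> /cube_neq0 y0; apply: cvg_near_cst; rewrite /f_ /F wE //.
  have nK (a b : R) : 0 < a -> \forall k \near \oo, b <= k.+1%:R * a.
    move=> a0; near=> k; rewrite -ler_pdivrMr //.
    apply: (@le_trans _ _ k%:R); last by rewrite ler_nat.
    by near: k; exact: nbhs_infty_ger.
  case: ifPn => [y1|]; [|rewrite -ltNge => y1].
    have := nK _ 2 (dot_gt0 y0); apply: filterS => k yk; congr (_%:E).
    by rewrite cutoff_mid ?mul1r // -enorm_sqr expr_le1 // sqrtr_ge0.
  have d1 : 0 < dot y y - 1 by rewrite subr_gt0 -enorm_sqr expr_gt1 // sqrtr_ge0.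
  have := nK _ 1 d1; apply: filterS => k yk; congr (_%:E).
  by rewrite cutoff_large ?mul0r.
have cont_f k : continuous (f_ k).
  rewrite f_E => y; apply: (@cvg_sumr _ _ (nbhs y)) => j _; exact: dV_cont.
have lim := @dominated_cvg _ _ _ (@lebesgue_rV R n) _ mC (fun k y => (f_ k y)%:E)
  (fun y => (F y)%:E) (fun=> M%:E) _ cvgF _ _ _.
have : (fun k => \int[@lebesgue_rV R n]_(y in cube 0 2) (f_ k y)%:E)%E @ \oo -->
    (\int[@lebesgue_rV R n]_(y in cube 0 2) (F y)%:E)%E.
  apply: lim => [k|//||k y Cy].
  - by apply/measurable_EFinP; apply: measurable_funTS; exact: (cont_meas _ (cont_f k)).
  - exact: (int_cont (fun=> M) (@cst_continuous _ _ M)).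
  - rewrite /f_ wE ?cube_neq0 // lee_fin normrM.
    have /andP[c0 c1] := cutoff_le1 k.+1%:R y.
    rewrite (ger0_norm c0) -[M]mul1r ler_pM //.
    by apply/HM/dot_normalize/cube_neq0.
under eq_fun do rewrite int0.
move=> /(cvg_lim (@ereal_hausdorff R)); rewrite lim_cst // => int_F.
rewrite [RHS]int_F.
have -> : orthant_ball =
    cube 0 2 `&` [set y | enorm y <= 1].
  apply/seteqP; split=> y [yi y1]; split => // i; last first.
    by have := yi i; rewrite in_itv /= => /andP[].
  rewrite in_itv /= yi /=; apply: (@le_lt_trans _ _ 1); last by rewrite ltr1n.
  apply: le_trans y1; apply: (le_trans (ler_norm _)).
  apply: (le_trans (coord_le_norm y i)).
  by rewrite -(@ler_pXn2r _ 2) ?nnegrE ?sqrtr_ge0 // enorm_sqr norm2_le_dot.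
rewrite integral_mkcondr; apply: eq_integral => y _.
rewrite /patch /F.
have -> : (y \in [set y : 'rV[R]_n | enorm y <= 1]) = (enorm y <= 1).
  by apply/idP/idP; rewrite inE.
by case: ifP.
Unshelve. all: by end_near. Qed.

End Field.

End SphericalDivergence.

(** * Regularity of the support function *)

Section SmoothOn.
Context {R : realType} {n : nat}.

(** [smooth_on] speaks of iterated partial derivatives only; their continuity supplies the
    differentiability that [Ck] asks for. *)
Lemma smooth_on_Ck (U : set 'rV[R]_n) (f : 'rV[R]_n -> R) k :
  open U -> smooth_on U f -> Ck k U f.
Proof.
move=> oU sf; suff : forall s, Ck k U (iter_partial s f) by move=> /(_ [::]).
elim: k => [|k IH] s; first by move=> x Ux; exact: (sf s x Ux).1.
split=> [x Ux|i]; last exact: (IH (i :: s)).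
apply: continuous_partial_differentiable.
  have : nbhs x U by exact: open_nbhs_nbhs.
  by apply: filterS => y Uy; exact: (sf s y Uy).2.
by move=> i; exact: (sf (i :: s) x Ux).1.
Qed.

End SmoothOn.

Section UnitNormal.
Context {R : realType} {n : nat}.
Implicit Types (U : set 'rV[R]_n) (phi : 'rV[R]_n -> R).

Definition regular U phi : set 'rV[R]_n := U `&` [set z | grad phi z != 0].

Lemma Ck_grad k U phi (j : 'I_n) : Ck k.+1 U phi -> Ck k U (fun z => grad phi z 0 j).
Proof.
move=> C; have -> : (fun z => grad phi z 0 j) = (fun z => 'D_(ebasis j) phi z).
  by apply/funext => z; rewrite mxE.
exact: CkS_derive.
Qed.

Lemma continuous_grad U phi x : Ck 1 U phi -> U x -> {for x, continuous (grad phi)}.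
Proof.
move=> C Ux; apply: (@cvg_rV _ _ _ (nbhs x)) => j.
exact: (Ck_continuous (Ck_grad j C) Ux).
Qed.

Lemma open_regular U phi : open U -> Ck 1 U phi -> open (regular U phi).
Proof.
move=> oU C; rewrite openE => z [Uz gz]; apply: filterI; first exact: open_nbhs_nbhs.
have N : nbhs (grad phi z) nonzero by apply: open_nbhs_nbhs; split => //; exact: open_nonzero.
exact: (continuous_grad C Uz N).
Qed.

Lemma Ck_unit_normal k U phi (j : 'I_n) : open U -> Ck k.+1 U phi ->
  Ck k (regular U phi) (fun z => unit_normal phi z 0 j).
Proof.
move=> oU C; have C1 : Ck 1 U phi by exact: Ck_le C.
apply: (@Ck_comp _ _ _ _ nonzero (regular U phi) (fun z => normalize z 0 j) (grad phi)).
- exact: open_regular.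
- by move=> z [].
- exact: Ck_normalize.
- by move=> l; apply: Ck_sub (Ck_grad l C) => z [].
Qed.

End UnitNormal.

(** * Contact points of supporting hyperplanes *)

Section Maximizer.
Context {R : realType} {n : nat}.
Variable K : set 'rV[R]_n.
Hypotheses (Kcompact : compact K) (Kconvex : convex_set K) (Kint : K° !=set0).
Implicit Types (x y z p q u v : 'rV[R]_n) (phi : 'rV[R]_n -> R).

Definition maximizer y p := K p /\ forall z, K z -> dot z y <= dot p y.

(** The candidate for the gradient of the support function at y. The default 0 is not reached, as K
    is compact and nonempty. *)
Definition contact y : 'rV[R]_n := xget 0 [set p | maximizer y p].

Lemma contactP y : maximizer y (contact y).
Proof.
have [z /interior_subset Kz] := Kint.
have [c + H] : exists2 c, c \in K & forall t, t \in K -> dot t y <= dot c y.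
  apply: EVT_max_rV => //; first by exists z.
  by apply: continuous_subspaceT; exact: continuous_dotl.
rewrite inE => Kc; apply: (@xgetPex _ 0 [set p | maximizer y p]).
by exists c; split => // t Kt; apply: H; rewrite inE.
Qed.

Lemma support_maximizer y p : maximizer y p -> support_fun K y = dot p y.
Proof.
move=> [Kp Hp]; apply/eqP; rewrite eq_le; apply/andP; split.
  apply: ge_sup; first by exists (dot p y); exists p.
  by move=> _ [z Kz <-]; exact: Hp.
apply: ub_le_sup; last by exists p.
by exists (dot p y) => _ [z Kz <-]; exact: Hp.
Qed.

Lemma support_contact y : support_fun K y = dot (contact y) y.
Proof. exact/support_maximizer/contactP. Qed.

(** From an interior point a short move along y would stay in K and increase the pairing with y. *)
Lemma maximizer_boundary y p : y != 0 -> maximizer y p -> ~ K° p.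
Proof.
move=> y0 [Kp Hp] /nbhs_ballP[r /= r0 Hr].
have yn0 : 0 < `|y| by rewrite normr_gt0.
pose t := r / (2 * `|y|).
have t0 : 0 < t by rewrite divr_gt0 // mulr_gt0.
have : K (p + t *: y).
  apply: Hr; rewrite -ball_normE /ball_ /= opprD addNKr normrN normrZ gtr0_norm //.
  by rewrite /t invfM mulrA divfK ?lt0r_neq0 // ltr_pdivrMr // ltr_pMr // ltr1n.
move=> /Hp; rewrite dotDl dotZl gerDl leNgt => /negP; apply.
by rewrite mulr_gt0 // dot_gt0.
Qed.

Lemma convex_segment p q (t : R) : K p -> K q -> 0 <= t <= 1 -> K (p + t *: (q - p)).
Proof.
move=> Kp Kq /andP[t0 t1].
have := Kconvex (x := q) (y := p) (Itv01 t0 t1).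
rewrite !inE => /(_ Kq Kp).
by rewrite /conv /= scalerBl scale1r scalerBr addrCA.
Qed.

Lemma maximizer_segment y p q (t : R) : maximizer y p -> maximizer y q -> 0 <= t <= 1 ->
  maximizer y (p + t *: (q - p)).
Proof.
move=> [Kp Hp] [Kq Hq] t01; split; first exact: convex_segment.
have E : dot p y = dot q y by apply/eqP; rewrite eq_le Hp // Hq.
by move=> z Kz; rewrite dotDl dotZl dotBl E subrr mulr0 addr0; exact: Hq.
Qed.

(** A short move in a direction of strict descent of [phi] stays in K, where p already maximises the
    pairing with y. *)
Lemma descent_direction_nonpos y p U phi u : open U ->
  differentiable phi p -> U p -> (forall x, U x -> (K x <-> phi x <= 0)) ->
  maximizer y p -> dot u (grad phi p) < 0 -> dot u y <= 0.
Proof.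
move=> oU dphi Up KU [Kp Hp] ug.
have phip : phi p <= 0 by exact/KU.
have [->|u0] := eqVneq u 0; first by rewrite dot0l.
have un0 : 0 < `|u| by rewrite normr_gt0.
(* With this tolerance the remainder is at most the first-order decrease of [phi]. *)
pose e := - dot u (grad phi p) / `|u|.
have e0 : 0 < e by rewrite divr_gt0 // oppr_gt0.
have near1 := differentiable_dot dphi e0.
have near2 : \forall h \near (0 : 'rV[R]_n), U (p + h).
  have : \forall z \near p, U z by exact: open_nbhs_nbhs.
  rewrite [X in X -> _](near_shift 0).
  by apply: filterS => h /=; rewrite subr0 addrC.
have : \forall h \near (0 : 'rV[R]_n),
    `|phi (p + h) - phi p - dot h (grad phi p)| <= e * `|h| /\ U (p + h).
  exact: filterI near1 near2.
move=> /nbhs_ballP[r /= r0 H].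
pose t := r / (2 * `|u|).
have t0 : 0 < t by rewrite divr_gt0 // mulr_gt0.
have /H[] : ball (0 : 'rV[R]_n) r (t *: u).
  rewrite -ball_normE /ball_ /= sub0r normrN normrZ gtr0_norm //.
  by rewrite /t invfM mulrA divfK ?lt0r_neq0 // ltr_pdivrMr // ltr_pMr // ltr1n.
rewrite normrZ gtr0_norm // dotZl /e mulrCA divfK ?lt0r_neq0 // => h1 h2.
have : K (p + t *: u).
  apply: (KU _ h2).2.
  move: h1; rewrite ler_norml => /andP[_]; rewrite mulrN; lra.
by move=> /Hp; rewrite dotDl dotZl gerDl pmulr_rle0.
Qed.

(** Descent directions u satisfy dot u y <= 0. Testing this on y minus slightly more than its
    projection on the gradient g gives the equality case of Cauchy-Schwarz, so y is a positive
    multiple of g. *)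
Lemma unit_normal_maximizer y p U phi : open U -> Ck 1 U phi -> regular U phi p ->
  (forall x, U x -> (K x <-> phi x <= 0)) -> y != 0 -> maximizer y p ->
  unit_normal phi p = normalize y.
Proof.
move=> oU C [Up gp] KU y0 mp; rewrite /unit_normal; set g := grad phi p.
have g2 : 0 < dot g g by exact: dot_gt0.
have D u : dot u g < 0 -> dot u y <= 0.
  exact: (descent_direction_nonpos oU (CkS_differentiable C Up) Up KU mp).
have yg0 : 0 <= dot g y.
  by have := D (- g); rewrite !dotNl oppr_lt0 oppr_le0; apply.
have CS : dot y y * dot g g <= dot g y ^+ 2.
  apply/ler_addgt0Pr => e e0.
  (* The excess over the projection costs at most e; the summand 1 is there because dot g y is only
     known to be nonnegative. *)
  pose d := e / (dot g g * (dot g y + 1)).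
  have d0 : 0 < d by rewrite divr_gt0 // mulr_gt0 // ltr_wpDl.
  have := D (y - (dot g y / dot g g + d) *: g).
  rewrite !dotBl !dotZl mulrDl divfK ?lt0r_neq0 // (dotC y g) opprD addrA subrr sub0r.
  rewrite oppr_lt0 mulr_gt0 // => /(_ isT).
  rewrite subr_le0 mulrDl -(ler_pM2r g2) mulrDl mulrAC divfK ?lt0r_neq0 // -expr2.
  move=> /le_trans; apply; rewrite lerD2l /d.
  have -> : e / (dot g g * (dot g y + 1)) * dot g y * dot g g =
     e * (dot g y / (dot g y + 1)).
    by field; rewrite !lt0r_neq0 // ltr_wpDl.
  by rewrite ger_pMr // ler_pdivrMr ?ltr_wpDl // mul1r lerDl.
have E : dot g g *: y = dot g y *: g.
  apply/eqP; rewrite -subr_eq0 -dot_eq0 eq_le dot_ge0 andbT.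
  have -> : dot (dot g g *: y - dot g y *: g) (dot g g *: y - dot g y *: g) =
    dot g g * (dot y y * dot g g - dot g y ^+ 2).
    rewrite !(dotBl, dotBr, dotZl, dotZr) (dotC y g).
    by move: (dot g g) (dot g y) (dot y y) => a b c; ring.
  by rewrite pmulr_rle0 // subr_le0.
have yg : 0 < dot g y.
  rewrite lt_neqAle yg0 andbT eq_sym; apply: contraNneq y0 => yg.
  by move/eqP: E; rewrite yg scale0r scaler_eq0 (negPf (lt0r_neq0 g2)).
by rewrite -(normalizeZ g yg) -E normalizeZ.
Qed.

(** If [phi] were negative at p, continuity would make p an interior point of K. *)
Lemma defining_maximizer_eq0 y p U phi : open U -> Ck 0 U phi -> U p ->
  (forall x, U x -> (K x <-> phi x <= 0)) -> y != 0 -> maximizer y p -> phi p = 0.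
Proof.
move=> oU C Up KU y0 mp; have phi_le := (KU _ Up).1 mp.1.
apply/eqP; rewrite eq_le phi_le /= leNgt; apply/negP => phip.
apply: (maximizer_boundary y0 mp); rewrite /interior /=.
have A1 : \forall z \near p, phi z < 0 by exact: (cvgr_lt _ (C p Up)).
have A2 : nbhs p U by exact: open_nbhs_nbhs.
have A3 : nbhs p ([set z | phi z < 0] `&` U) by exact: filterI A1 A2.
have sub : [set z | phi z < 0] `&` U `<=` K by move=> z [/ltW z1 z2]; exact: (KU _ z2).2.
exact (@filterS _ _ (nbhs_filter p) _ _ sub A3).
Qed.

End Maximizer.

Lemma near_line {R : realType} {n : nat} (p v : 'rV[R]_n) (P : set 'rV[R]_n) :
  nbhs p P -> \forall t \near (0 : R), P (t *: v + p).
Proof.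
move=> /nbhs_ballP[r /= r0 H].
have v0 : 0 < `|v| + 1 by rewrite ltr_wpDl.
have r' : 0 < r / (`|v| + 1) by rewrite divr_gt0.
have := @nbhs0_lt R R _ r'; apply: filterS => t tr; apply: H.
rewrite -ball_normE /ball_ /= opprD addrCA subrr addr0 normrN normrZ.
apply: (@le_lt_trans _ _ (`|t| * (`|v| + 1))); first by rewrite ler_wpM2l // lerDl.
by rewrite -ltr_pdivlMr.
Qed.

(** * Uniqueness of the contact point and the gradient of the support function *)

Section StrictConvexity.
Context {R : realType} {n : nat}.
Variable K : set 'rV[R]_n.
Hypotheses (Kcompact : compact K) (Kconvex : convex_set K) (Kint : K° !=set0).
Hypothesis Ksmooth : Cinf_plus K.
Implicit Types (x y z p q u v : 'rV[R]_n) (phi : 'rV[R]_n -> R).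

Lemma tangent_det_kernel x (A : 'M[R]_n) v :
  tangent_det x A != 0 -> dot v x = 0 -> v *m A = 0 -> v = 0.
Proof.
move=> detA vx vA; apply/eqP; apply: contraNT detA => v0; apply/det0P.
exists v => //; have vxT : v *m x^T = 0 by rewrite dot_mulmx vx raddf0.
rewrite mulmxDr !mulmxA vxT mul0mx addr0.
have -> : v *m tangent_proj x = v.
  by rewrite /tangent_proj mulmxBr mulmx1 mulmxA vxT mul0mx subr0.
by rewrite vA mul0mx.
Qed.

Lemma differentiable_unit_normal U phi z : open U -> Ck 2 U phi ->
  regular U phi z -> differentiable (unit_normal phi) z.
Proof.
move=> oU C rz; apply: differentiable_rV => j.
exact: (CkS_differentiable (Ck_unit_normal j oU C) rz).
Qed.

(* The unit normal is constant on a segment of maximisers, so the direction of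
   the segment lies in the kernel of the Weingarten map. *)
Lemma maximizer_unique y p q : y != 0 -> maximizer K y p -> maximizer K y q -> p = q.
Proof.
move=> y0 mp mq.
have [U [phi [[oU Up sU KU gp] curv]]] : exists U phi, local_defining K p U phi /\
    0 < gauss_curvature phi p.
  by apply: Ksmooth; split; [exact: mp.1|exact: (maximizer_boundary y0 mp)].
have C2 : Ck 2 U phi by exact: smooth_on_Ck.
have C1 : Ck 1 U phi by exact: CkW.
have rp : regular U phi p by [].
have dn := differentiable_unit_normal oU C2 rp.
set v := q - p.
have np := unit_normal_maximizer oU C1 rp KU y0 mp.
have vy : dot v y = 0.
  apply/eqP; rewrite dotBl subr_eq0 eq_le.
  by rewrite (mp.2 _ mq.1) (mq.2 _ mp.1).
suff v0 : v = 0 by apply/esym/eqP; rewrite -subr_eq0 -/v v0.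
apply: (tangent_det_kernel (x := unit_normal phi p) (A := 'J (unit_normal phi) p)).
- exact: lt0r_neq0.
- by rewrite np dotZr vy mulr0.
rewrite -deriveEjacobian //.
have : derivable (unit_normal phi) p v by exact: diff_derivable.
(* Only the points with 0 < t < 1 are known to be maximisers, so the derivative is computed as a
   one-sided limit. *)
move=> /(@cvg_dnbhs_at_right _ _ _ _ _) cvgr.
have near1 : \forall t \near (0 : R), regular U phi (t *: v + p).
  by apply: near_line; apply: open_nbhs_nbhs; split => //; exact: open_regular.
have near2 : \forall t \near (0 : R)^'+, regular U phi (t *: v + p).
  exact: cvg_within near1.
have cvg0 : (fun h : R => h^-1 *: ((unit_normal phi \o shift p) (h *: v) - unit_normal phi p))
    @ 0^'+ --> (0 : 'rV[R]_n).
  apply: cvg_near_cst; near=> t.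
  have t0 : 0 < t by near: t; exact: nbhs_right_gt.
  have t1 : t < 1 by near: t; exact: nbhs_right_lt.
  have rt : regular U phi (t *: v + p) by near: t; exact: near2.
  have mt : maximizer K y (t *: v + p).
    by rewrite addrC; apply: maximizer_segment => //; rewrite !ltW.
  rewrite /= (unit_normal_maximizer oU C1 rt KU y0 mt) np.
  by rewrite subrr scaler0.
exact: cvg_unique cvgr cvg0.
Unshelve. all: by end_near. Qed.

Lemma contact_unique y p : y != 0 -> maximizer K y p -> contact K y = p.
Proof. by move=> y0 mp; apply: (maximizer_unique y0) mp; exact: contactP. Qed.

(** By uniqueness and compactness, points of K away from the contact point lose at least some d > 0
    in the pairing with y, and a small change of y cannot compensate that loss. *)
Lemma contact_continuous y : y != 0 -> {for y, continuous (contact K)}.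
Proof.
move=> y0 /= W /nbhs_ballP[r /= r0 HW].
pose L : set 'rV[R]_n := K `&` ~` ball (contact K y) r.
have [M HM] : exists M, forall z, K z -> `|z| <= M.
  have [M [_ HM]] := compact_bounded Kcompact.
  by exists (M + 1) => z Kz; apply: HM => //; rewrite ltrDl.
have [N [N0 HN]] : exists N, 0 < N /\
    forall z y', K z -> `|dot z (y' - y)| <= N * `|y' - y|.
  exists (n%:R * `|M| + 1); split; first by rewrite ltr_wpDl // mulr_ge0.
  move=> z y' Kz; apply: (le_trans (dot_le_norm _ _)); rewrite ler_wpM2r //.
  rewrite (@le_trans _ _ (n%:R * `|M|)) ?lerDl // ler_wpM2l //.
  by apply: (le_trans (HM z Kz)); exact: ler_norm.
have cL : compact L.
  apply: (subclosed_compact _ Kcompact); last by move=> z [].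
  apply: closedI; first exact: (compact_closed (@norm_hausdorff _ _) Kcompact).
  exact/open_closedC/ball_open.
have [d [d0 Hd]] : exists d, 0 < d /\ forall z, L z -> dot z y <= dot (contact K y) y - d.
  have [L0|/set0P/negP/negPn/eqP ->] := pselect (L !=set0); last by exists 1.
  have [c + Hc] : exists2 c, c \in L & forall t, t \in L -> dot t y <= dot c y.
    apply: EVT_max_rV => //.
    by apply: continuous_subspaceT; exact: continuous_dotl.
  rewrite inE => -[Kc nbc].
  exists (dot (contact K y) y - dot c y); split; last first.
    by move=> z Lz; rewrite subKr; apply: Hc; rewrite inE.
  rewrite subr_gt0 ltNge; apply/negP => le_c; apply: nbc.
  have -> : c = contact K y.
    apply: (maximizer_unique y0); last exact: contactP.
    by split => // z Kz; apply: le_trans le_c; exact: (contactP Kcompact Kint y).2.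
  exact: ballxx.
(* Within this radius the pairing with each point of K changes by less than d / 2, so the comparison
   of two points changes by less than d. *)
have N2 : 0 < d / (2 * N) by rewrite divr_gt0 // mulr_gt0.
apply/nbhs_ballP; exists (d / (2 * N)) => //= y' Hy'.
apply: HW; apply: contrapT => nb.
set p := contact K y; set p' := contact K y'.
have Kp' : K p' by exact: (contactP Kcompact Kint y').1.
have Kp : K p by exact: (contactP Kcompact Kint y).1.
have Lp' : L p' by split.
have h1 := Hd _ Lp'.
have h2 : dot p y' <= dot p' y' by exact: (contactP Kcompact Kint y').2.
have := HN p y' Kp; have := HN p' y' Kp'; rewrite !dotBr.
have : N * `|y' - y| < d / 2.
  have -> : d / 2 = N * (d / (2 * N)) by field; rewrite lt0r_neq0.
  by rewrite ltr_pM2l //; move: Hy'; rewrite -ball_normE /ball_ /= distrC.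
rewrite !ler_norml => hd /andP[a1 a2] /andP[b1 b2].
by move: h1 h2 hd a1 a2 b1 b2; rewrite -/p; lra.
Qed.

(** Maximality at y and at y + k puts the remainder h (y + k) - h y - dot (contact y) k between 0
    and dot (contact (y + k) - contact y) k, which is o(k) by continuity of the contact point. *)
Lemma differentiable_support y : y != 0 ->
  differentiable (support_fun K) y /\ inv_gauss K y = contact K y.
Proof.
move=> y0; apply: is_diff_dot => e e0.
pose e' := e / n.+1%:R.
have e'0 : 0 < e' by rewrite divr_gt0.
have : \forall h \near (0 : 'rV[R]_n), `|contact K (y + h) - contact K y| <= e'.
  have : \forall z \near y, `|contact K z - contact K y| <= e'.
    have /cvgrPdist_le/(_ _ e'0) : contact K @ y --> contact K y by exact: contact_continuous.
    by apply: filterS => z; rewrite distrC.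
  rewrite [X in X -> _](near_shift 0).
  by apply: filterS => h /=; rewrite subr0 (addrC h).
apply: filterS => h hh.
have cP := contactP Kcompact Kint.
rewrite !(support_contact Kcompact Kint) dotDr.
have h1 := (cP (y + h)).2 _ (cP y).1; have h2 := (cP y).2 _ (cP (y + h)).1.
have h3 : dot (contact K (y + h) - contact K y) h <= e * `|h|.
  apply: (le_trans (ler_norm _)); apply: (le_trans (dot_le_norm _ _)).
  rewrite ler_wpM2r //; apply: (@le_trans _ _ (n%:R * e')); first by rewrite ler_wpM2l.
  by rewrite /e' mulrCA ger_pMr // ler_pdivrMr // mul1r ler_nat.
move: h1 h3; rewrite !dotDr dotBl (dotC h) => h1 h3.
rewrite ger0_norm; first by move: h1 h2 h3; lra.
by move: h1 h2 h3; lra.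
Qed.

End StrictConvexity.

(** * Differentiability and smoothness of continuous right inverses *)

Section RightInverse.
Context {R : realType} {m n : nat}.

Lemma mulmx_norm_bound (B : 'M[R]_(m, n)) :
  exists2 C, 0 < C & forall u : 'rV[R]_m, `|u *m B| <= C * `|u|.
Proof.
exists (m%:R * `|B| + 1) => [|u]; first by rewrite ltr_wpDl // mulr_ge0.
apply: norm_le_coord => [|j].
  by rewrite mulr_ge0 // addr_ge0 // mulr_ge0.
rewrite mxE; apply: (le_trans (ler_norm_sum _ _ _)).
apply: (@le_trans _ _ (\sum_(k < m) `|B| * `|u|)); last first.
  by rewrite sumr_const card_ord -(mulr_natl (`|B| * _)) mulrA mulrDl lerDl mul1r.
apply: ler_sum => k _; rewrite normrM mulrC ler_pM ?coord_le_norm //.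
rewrite [leRHS]/Num.Def.normr /= mx_normrE.
exact: (le_bigmax _ (fun i : 'I_m * 'I_n => `|B i.1 i.2|) (k, j)).
Qed.

(** The differential of [Psi] at X y is normalised to the identity. Continuity of [X] first yields a
    Lipschitz bound on its increment, by absorbing half of that increment; this bound makes the
    remainder of [Psi] of order o(h). *)
Lemma right_inverse_differential (Psi : 'rV[R]_n -> 'rV[R]_n)
    (X N : 'rV[R]_m -> 'rV[R]_n) (y : 'rV[R]_m) (B : 'M[R]_(m, n)) :
  (forall e, 0 < e -> \forall k \near (0 : 'rV[R]_n),
     `|Psi (X y + k) - Psi (X y) - k| <= e * `|k|) ->
  (forall e, 0 < e -> \forall h \near (0 : 'rV[R]_m),
     `|N (y + h) - N y - h *m B| <= e * `|h|) ->
  {for y, continuous X} -> (\forall z \near y, Psi (X z) = N z) ->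
  forall e, 0 < e -> \forall h \near (0 : 'rV[R]_m),
     `|X (y + h) - X y - h *m B| <= e * `|h|.
Proof.
move=> HPsi HN cX PX e e0.
have [C C0 HC] := mulmx_norm_bound B.
(* The value 1/2 serves the absorption; the other one turns the Lipschitz constant 2 (C + 1) into an
   error of e / 2. *)
pose e1 := Num.min (1 / 2) (e / (4 * (C + 1))).
have C1 : 0 < 4 * (C + 1) by rewrite mulr_gt0 // addr_gt0.
have e10 : 0 < e1 by rewrite lt_min !divr_gt0.
have e2 : 0 < Num.min 1 (e / 2) by rewrite lt_min ltr01 divr_gt0.
have shiftX (P : set 'rV[R]_m) : nbhs y P -> \forall h \near (0 : 'rV[R]_m), P (y + h).
  move=> NP; have : \forall z \near y, P z by [].
  by rewrite [X in X -> _](near_shift 0); apply: filterS => h /=; rewrite subr0 addrC.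
have A1 : \forall h \near (0 : 'rV[R]_m), `|Psi (X y + (X (y + h) - X y)) - Psi (X y)
    - (X (y + h) - X y)| <= e1 * `|X (y + h) - X y|.
  apply: (shiftX (fun z => `|Psi (X y + (X z - X y)) - Psi (X y)
    - (X z - X y)| <= e1 * `|X z - X y|)).
  have /nbhs_ballP[r /= r0 Hr] := HPsi e1 e10.
  have : \forall z \near y, ball (X y) r (X z).
    by apply: cX; exact: nbhsx_ballx.
  apply: filterS => z bz; apply: Hr.
  by move: bz; rewrite -!ball_normE /ball_ /= sub0r normrN distrC.
have A2 := HN _ e2.
have A3 := shiftX _ PX.
have A0 : Psi (X y) = N y by exact: (nbhs_singleton PX).
near=> h.
have a1 : `|Psi (X y + (X (y + h) - X y)) - Psi (X y)
    - (X (y + h) - X y)| <= e1 * `|X (y + h) - X y| by near: h.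
have a2 : `|N (y + h) - N y - h *m B| <= Num.min 1 (e / 2) * `|h| by near: h.
have a3 : Psi (X (y + h)) = N (y + h) by near: h.
move: a1; rewrite (addrC (X y) (_ - _)) subrK a3 A0; set k := X (y + h) - X y => a1.
set d := N (y + h) - N y in a1 a2.
have k2 : `|k| <= 2 * ((C + 1) * `|h|).
  have h1 : `|k| <= `|d - k| + (`|d - h *m B| + `|h *m B|).
    apply: (@le_trans _ _ (`|d - k| + `|d|)).
      by rewrite -{1}(subKr d k) (le_trans (ler_normB d (d - k))) // addrC.
    by rewrite lerD2l -{1}(subrK (h *m B) d) ler_normD.
  have h2 : `|d - k| <= 1 / 2 * `|k|.
    by apply: (le_trans a1); rewrite ler_wpM2r // ge_min lexx.
  have h3 : `|d - h *m B| <= 1 * `|h|.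
    by apply: (le_trans a2); rewrite ler_wpM2r // ge_min lexx.
  by have h4 := HC h; move: h1 h2 h3 h4; lra.
rewrite -/k.
apply: (@le_trans _ _ (`|d - k| + `|d - h *m B|)).
  have -> : k - h *m B = (d - h *m B) - (d - k) by rewrite opprB [RHS]addrC addrA subrK.
  by rewrite (le_trans (ler_normB _ _)) // addrC.
rewrite [e in leRHS]splitr mulrDl lerD //; last first.
  by apply: (le_trans a2); rewrite ler_wpM2r // ge_min lexx orbT.
apply: (le_trans a1); apply: (@le_trans _ _ (e / (4 * (C + 1)) * (2 * ((C + 1) * `|h|)))).
  by rewrite ler_pM // ?ge_min ?lexx ?orbT // ltW.
rewrite le_eqVlt; apply/orP; left; apply/eqP.
by field; rewrite lt0r_neq0 // addr_gt0.
Unshelve. all: by end_near. Qed.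

End RightInverse.

Section DifferentialVec.
Context {R : realType} {m n : nat}.

Lemma differential_rV (f : 'rV[R]_m -> 'rV[R]_n) x :
  (forall j, differentiable (fun z => f z 0 j) x) ->
  forall e, 0 < e -> \forall h \near (0 : 'rV[R]_m),
    `|f (x + h) - f x - h *m \matrix_(i, j) 'D_(ebasis i) (fun z => f z 0 j) x| <= e * `|h|.
Proof.
move=> df e e0.
have : \forall h \near (0 : 'rV[R]_m), forall j,
    `|f (x + h) 0 j - f x 0 j - dot h (grad (fun z => f z 0 j) x)| <= e * `|h|.
  apply: (@filter_forall _ _ (fun j h => `|f (x + h) 0 j - f x 0 j -
     dot h (grad (fun z => f z 0 j) x)| <= e * `|h|) (nbhs (0 : 'rV[R]_m)) _) => j.
  exact: (differentiable_dot (df j)).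
apply: filterS => h H; apply: norm_le_coord => [|j]; first by rewrite mulr_ge0 // ltW.
have := H j; rewrite !mxE; congr (`|_ - _| <= _).
by apply: eq_bigr => i _; rewrite !mxE.
Qed.

Lemma differential_rV_converse (f : 'rV[R]_m -> 'rV[R]_n) x (B : 'M[R]_(m, n)) :
  (forall e, 0 < e -> \forall h \near (0 : 'rV[R]_m),
    `|f (x + h) - f x - h *m B| <= e * `|h|) ->
  forall j, differentiable (fun z => f z 0 j) x.
Proof.
move=> H j; apply: (proj1 (@is_diff_dot _ _ _ x (col j B)^T _)) => e e0.
apply: filterS (H e e0) => h; apply: le_trans.
have := coord_le_norm (f (x + h) - f x - h *m B) j; rewrite !mxE.
congr (`|_ - _| <= _); apply: eq_bigr => i _; by rewrite !mxE.
Qed.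

End DifferentialVec.

Section LocalInverse.
Context {R : realType} {n : nat}.
Variables (U V : set 'rV[R]_n) (Psi X N : 'rV[R]_n -> 'rV[R]_n).
Hypotheses (oV : open V) (VU : forall z, V z -> U (X z)).
Hypothesis CPsi : forall k j, Ck k U (fun z => Psi z 0 j).
Hypothesis CN : forall k j, Ck k V (fun z => N z 0 j).
Hypothesis cX : forall z, V z -> {for z, continuous X}.
Hypothesis PsiX : forall z, V z -> Psi (X z) = N z.

Let A z : 'M[R]_n := \matrix_(i, j) 'D_(ebasis i) (fun z => Psi z 0 j) z.
Let DN z : 'M[R]_n := \matrix_(i, j) 'D_(ebasis i) (fun z => N z 0 j) z.
Hypothesis A_unit : forall z, U z -> \det (A z) != 0.

Let dPsi z j : U z -> differentiable (fun z => Psi z 0 j) z.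
Proof. by move=> Uz; exact: (CkS_differentiable (CPsi 1 j) Uz). Qed.

Let dN z j : V z -> differentiable (fun z => N z 0 j) z.
Proof. by move=> Vz; exact: (CkS_differentiable (CN 1 j) Vz). Qed.

(** Composing [Psi] and [N] with the inverse of the differential of [Psi] at X z reduces to the
    normalised case. *)
Let dX z j : V z -> differentiable (fun z => X z 0 j) z.
Proof.
move=> Vz; have Uz := VU Vz.
have uA : A (X z) \in unitmx by rewrite unitmxE unitfE A_unit.
pose I := invmx (A (X z)).
have [C C0 HC] := mulmx_norm_bound I.
apply: (differential_rV_converse (B := DN z *m I)).
apply: (@right_inverse_differential _ _ _ (fun w => Psi w *m I) X (fun w => N w *m I)).
- move=> e e0; have eC : 0 < e / C by rewrite divr_gt0.
  have := differential_rV (fun j => dPsi j Uz) eC.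
  apply: filterS => k Hk.
  have -> : Psi (X z + k) *m I - Psi (X z) *m I - k =
      (Psi (X z + k) - Psi (X z) - k *m A (X z)) *m I.
    by rewrite !mulmxBl -mulmxA mulmxV // mulmx1.
  apply: (le_trans (HC _)).
  apply: (le_trans (ler_wpM2l (ltW C0) Hk)).
  by rewrite mulrA mulrCA divff ?mulr1 ?lt0r_neq0.
- move=> e e0; have eC : 0 < e / C by rewrite divr_gt0.
  have := differential_rV (fun j => dN j Vz) eC.
  apply: filterS => k Hk; rewrite mulmxA -!mulmxBl.
  apply: (le_trans (HC _)).
  apply: (le_trans (ler_wpM2l (ltW C0) Hk)).
  by rewrite mulrA mulrCA divff ?mulr1 ?lt0r_neq0.
- exact: cX.
- have : nbhs z V by exact: open_nbhs_nbhs.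
  by apply: filterS => w /PsiX ->.
Qed.

(** Cramer's rule. The right side contains [X] itself but none of its derivatives, so regularity of
    order k of [X] yields order k + 1. *)
Let DX z i j : V z -> 'D_(ebasis i) (fun w => X w 0 j) z =
  \sum_l 'D_(ebasis i) (fun w => N w 0 l) z *
    ((\det (A (X z)))^-1 * \det (set_row j (ebasis l) (A (X z)))).
Proof.
move=> Vz; have Uz := VU Vz.
have uA : A (X z) \in unitmx by rewrite unitmxE unitfE A_unit.
pose D : 'M[R]_n := \matrix_(i, j) 'D_(ebasis i) (fun w => X w 0 j) z.
have DA : D *m A (X z) = DN z.
  apply/matrixP => a b; rewrite !mxE.
  transitivity ('D_(ebasis a) (fun w => Psi (X w) 0 b) z).
    rewrite (@derive_comp_rV _ _ _ (fun w => Psi w 0 b) X) => [||l]; last exact: dX.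
      by apply: eq_bigr => l _; rewrite !mxE.
    exact: dPsi.
  apply: (@near_eq_derive R 'rV[R]_n R).
  have : nbhs z V by exact: open_nbhs_nbhs.
  by apply: filterS => w /PsiX ->.
have -> : 'D_(ebasis i) (fun w => X w 0 j) z = D i j by rewrite mxE.
have -> : D = DN z *m invmx (A (X z)) by rewrite -DA mulmxK.
rewrite mxE; apply: eq_bigr => l _; rewrite mxE; congr (_ * _).
rewrite /invmx uA !mxE; congr (_ * _).
by rewrite det_set_row_ebasis.
Qed.

Lemma Ck_local_inverse k j : Ck k V (fun z => X z 0 j).
Proof.
elim: k j => [|k IH] j.
  move=> z Vz; apply: (@continuous_comp _ _ _ X (fun w : 'rV[R]_n => w 0 j)).
    exact: cX.
  exact: coord_continuous.
split=> [z Vz|i]; first exact: dX.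
have C1 l : Ck k V (fun z => 'D_(ebasis i) (fun w => N w 0 l) z *
    ((\det (A (X z)))^-1 * \det (set_row j (ebasis l) (A (X z))))).
  have CA a b : Ck k V (fun z => A (X z) a b).
    have -> : (fun z => A (X z) a b) = (fun z => 'D_(ebasis a) (fun w => Psi w 0 b) (X z)).
      by apply/funext => z; rewrite mxE.
    apply: (Ck_comp (f := fun w => 'D_(ebasis a) (fun w => Psi w 0 b) w)) oV VU _ IH.
    exact: CkS_derive.
  apply: (CkM oV); first exact: (CkS_derive i (CN k.+1 l)).
  apply: (CkM oV).
    apply: (CkV oV); last exact: (Ck_det oV).
    by move=> z Vz; apply: A_unit; exact: VU.
  apply: (Ck_det oV) => a b.
  have -> : (fun z => set_row j (ebasis l) (A (X z)) a b) =
      (fun z => if a == j then (ebasis l : 'rV[R]_n) 0 b else A (X z) a b).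
    by apply/funext => z; rewrite [LHS]mxE.
  by case: eqP => _; [exact: Ck_cst|exact: CA].
have C2 := @Ck_sum _ _ k V _ (index_enum 'I_n) xpredT _ oV (fun l _ => C1 l).
apply: (Ck_ext oV _ C2) => z /[1!inE] Vz.
by rewrite DX.
Qed.

End LocalInverse.

Lemma open_preimage_on (S T : topologicalType) (f : S -> T) (D : set S) (W : set T) :
  open D -> (forall z, D z -> {for z, continuous f}) -> open W ->
  open (D `&` f @^-1` W).
Proof.
move=> oD cf oW; rewrite openE => z [Dz Wz]; apply: filterI.
  exact: open_nbhs_nbhs.
have N : nbhs (f z) W by exact: open_nbhs_nbhs.
exact: (cf z Dz W N).
Qed.

(** * Smoothness of the contact map and the Hessian of the support function *)

Section ContactSmooth.
Context {R : realType} {n : nat}.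
Variable K : set 'rV[R]_n.
Hypotheses (Kcompact : compact K) (Kconvex : convex_set K) (Kint : K° !=set0).
Hypothesis Ksmooth : Cinf_plus K.
Implicit Types (x y z p q u v : 'rV[R]_n) (phi : 'rV[R]_n -> R).

Let defining y : y != 0 -> exists U phi, [/\ open U, (forall k, Ck k U phi),
  (forall x, U x -> (K x <-> phi x <= 0)), regular U phi (contact K y) &
  0 < gauss_curvature phi (contact K y)].
Proof.
move=> y0; have mc := contactP Kcompact Kint y.
have [U [phi [[oU Up sU KU gp] curv]]] : exists U phi,
    local_defining K (contact K y) U phi /\ 0 < gauss_curvature phi (contact K y).
  by apply: Ksmooth; split; [exact: mc.1|exact: (maximizer_boundary y0 mc)].
by exists U, phi; split => // k; exact: smooth_on_Ck.
Qed.

(** A boundary point has a single outer unit normal, that of its local defining function. *)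
Lemma contact_inj_normalize y z : y != 0 -> z != 0 -> contact K y = contact K z ->
  normalize y = normalize z.
Proof.
move=> y0 z0 yz; have [U [phi [oU C KU rp _]]] := defining y0.
rewrite -(unit_normal_maximizer oU (C 1%N) rp KU y0 (contactP Kcompact Kint y)).
rewrite yz in rp *.
exact: (unit_normal_maximizer oU (C 1%N) rp KU z0 (contactP Kcompact Kint z)).
Qed.

(* An extension of the Gauss map off the boundary [phi = 0] whose differential
   is also injective in the normal direction. *)
Let gauss_ext phi z : 'rV[R]_n := (1 + phi z) *: unit_normal phi z.

Let Ck_gauss_ext U phi k j : open U -> (forall k, Ck k U phi) ->
  Ck k (regular U phi) (fun z => gauss_ext phi z 0 j).
Proof.
move=> oU C; have oU' := open_regular oU (C 1%N).
have -> : (fun z => gauss_ext phi z 0 j) = (fun z => (1 + phi z) * unit_normal phi z 0 j).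
  by apply/funext => z; rewrite mxE.
have C1 : Ck k (regular U phi) phi by apply: Ck_sub (C k) => z [].
exact: (CkM oU' (CkD oU' (Ck_cst _ _ 1) C1) (Ck_unit_normal j oU (C k.+1))).
Qed.

(** For u in the kernel, D_u nu + (D_u phi) nu = 0. As nu has unit length, pairing with nu leaves
    D_u phi = 0; thus u is tangent and killed by the Weingarten map, which positive curvature
    excludes unless u = 0. *)
Let gauss_ext_det U phi p : open U -> (forall k, Ck k U phi) -> regular U phi p ->
  phi p = 0 -> 0 < gauss_curvature phi p ->
  \det (\matrix_(i, j) 'D_(ebasis i) (fun z => gauss_ext phi z 0 j) p) != 0.
Proof.
move=> oU C rp phip curv; set A := \matrix_(_, _) _.
have oU' := open_regular oU (C 1%N).
set nu := unit_normal phi.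
have Cnu j := Ck_unit_normal j oU (C 2%N).
have dnu j : differentiable (fun z => nu z 0 j) p := CkS_differentiable (Cnu j) rp.
have dphi : differentiable phi p := CkS_differentiable (C 1%N) rp.1.
have nu1 z : regular U phi z -> dot (nu z) (nu z) = 1.
  by move=> [_ gz]; exact: dot_normalize.
have Dnu_nu u : \sum_j nu p 0 j * 'D_u (fun z => nu z 0 j) p = 0.
  have H j : is_derive p u (fun z => nu z 0 j * nu z 0 j)
     (2 * (nu p 0 j * 'D_u (fun z => nu z 0 j) p)).
    have d1 : is_derive p u (fun z => nu z 0 j) ('D_u (fun z => nu z 0 j) p).
      exact/derivableP/diff_derivable.
    have := is_deriveM d1 d1; rewrite /GRing.scale /=.
    by rewrite -mulr2n -(mulr_natl (_ * _)).
  have E := @derive_val _ _ _ _ _ _ _ (is_derive_sumr (index_enum _) H).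
  have E0 : 'D_u (fun y => \sum_j nu y 0 j * nu y 0 j) p = 0.
    transitivity ('D_u (cst (1 : R)) p); last exact: derive_cst.
    apply: (@near_eq_derive R 'rV[R]_n R).
    have : nbhs p (regular U phi) by exact: open_nbhs_nbhs.
    by apply: filterS => z; exact: nu1.
  move: E; rewrite E0 -mulr_sumr => /esym/eqP.
  by rewrite mulf_eq0 pnatr_eq0 => /eqP.
apply/negP => /det0P[u u0 uA].
have DE j : 'D_u (fun z => nu z 0 j) p + 'D_u phi p * nu p 0 j = 0.
  have dA : differentiable (fun z => gauss_ext phi z 0 j) p.
    exact: (CkS_differentiable (Ck_gauss_ext 1 j oU C) rp).
  have : 'D_u (fun z => gauss_ext phi z 0 j) p = 0.
    rewrite derive_grad //; transitivity ((u *m A) 0 j); last by rewrite uA mxE.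
    by rewrite mxE; apply: eq_bigr => i _; rewrite mxE.
  have -> : (fun z => gauss_ext phi z 0 j) = (fun z => (1 + phi z) * nu z 0 j).
    by apply/funext => z; rewrite mxE.
  have d1 : is_derive p u (fun z => 1 + phi z) ('D_u phi p).
    have d0 : is_derive p u (cst (1 : R)) 0 by exact: is_derive_cst.
    have := is_deriveD d0 (derivableP (diff_derivable (v := u) dphi)).
    by rewrite add0r.
  have d2 : is_derive p u (fun z => nu z 0 j) ('D_u (fun z => nu z 0 j) p).
    exact/derivableP/diff_derivable.
  rewrite (@derive_val _ _ _ _ _ _ _ (is_deriveM d1 d2)) phip addr0.
  by rewrite /GRing.scale /= mul1r => <-; congr (_ + _); exact: mulrC.
have Dphi0 : 'D_u phi p = 0.
  have : \sum_j nu p 0 j * ('D_u (fun z => nu z 0 j) p + 'D_u phi p * nu p 0 j) = 0.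
    by rewrite big1 // => j _; rewrite DE mulr0.
  under eq_bigr do rewrite mulrDr mulrCA.
  by rewrite big_split /= Dnu_nu add0r -mulr_sumr -/(dot _ _) nu1 // mulr1.
move/eqP: u0; apply.
apply: (tangent_det_kernel (x := nu p) (A := 'J nu p)).
- exact: lt0r_neq0.
- by rewrite /nu /unit_normal /normalize dotZr -derive_grad_dot // Dphi0 mulr0.
rewrite -deriveEjacobian; last exact: differentiable_rV.
apply/rowP => j; rewrite derive_mx; last exact/diff_derivable/differentiable_rV.
by rewrite !mxE; have := DE j; rewrite Dphi0 mul0r addr0.
Qed.

(** [Psi] is kept in the conclusion because differentiating Psi (contact z) = normalize z also
    bounds the kernel of the Hessian, in [hess_kernel]. *)
Lemma contact_local_inverse y : y != 0 -> exists V (Psi : 'rV[R]_n -> 'rV[R]_n),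
  [/\ V y, open V, (forall k j, Ck k V (fun z => contact K z 0 j)),
      (forall j, differentiable (fun w => Psi w 0 j) (contact K y)) &
      forall z, V z -> Psi (contact K z) = normalize z].
Proof.
move=> y0; have [U [phi [oU C KU rp curv]]] := defining y0.
have oU' := open_regular oU (C 1%N).
pose A z : 'M[R]_n := \matrix_(i, j) 'D_(ebasis i) (fun w => gauss_ext phi w 0 j) z.
have CA i j : Ck 0 (regular U phi) (fun z => A z i j).
  have -> : (fun z => A z i j) = (fun z => 'D_(ebasis i) (fun w => gauss_ext phi w 0 j) z).
    by apply/funext => z; rewrite mxE.
  exact: (CkS_derive i (Ck_gauss_ext 1 j oU C)).
pose W := regular U phi `&` [set z | \det (A z) != 0].
have phi0 z : z != 0 -> U (contact K z) -> phi (contact K z) = 0.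
  move=> z0 Uz; apply: (defining_maximizer_eq0 oU (C 0%N) Uz KU z0).
  exact: contactP.
have oW : open W.
  apply: (@open_preimage_on _ _ (fun z => \det (A z)) _ [set t : R | t != 0]) => //.
    by move=> z; exact: Ck_continuous (Ck_det oU' CA).
pose V := nonzero `&` contact K @^-1` W.
have cc z : z != 0 -> {for z, continuous (contact K)}.
  exact: contact_continuous.
have oV : open V by exact: (open_preimage_on (@open_nonzero R n) cc oW).
have Psi_contact z : V z -> gauss_ext phi (contact K z) = normalize z.
  move=> [z0 [rz _]]; rewrite /gauss_ext phi0 //; last exact: rz.1.
  rewrite addr0 scale1r.
  exact: (unit_normal_maximizer oU (C 1%N) rz KU z0 (contactP Kcompact Kint z)).
exists V, (gauss_ext phi); split => //.
- split => //; split => //; apply: (gauss_ext_det oU) => //.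
  by apply: phi0 => //; exact: rp.1.
- move=> k j; apply: (@Ck_local_inverse _ _ W V (gauss_ext phi) (contact K) (@normalize R n)).
  + exact: oV.
  + by move=> z [].
  + by move=> l i; apply: Ck_sub (Ck_gauss_ext l i oU C) => z [].
  + by move=> l i; apply: Ck_sub (Ck_normalize l i) => z [].
  + by move=> z [z0 _]; exact: cc.
  + exact: Psi_contact.
  + by move=> z [].
- by move=> j; exact: (CkS_differentiable (Ck_gauss_ext 1 j oU C) rp).
Qed.

Lemma Ck_contact k j : Ck k nonzero (fun z => contact K z 0 j).
Proof.
apply: Ck_local => y y0; have [V [Psi [Vy oV CV _ _]]] := contact_local_inverse y0.
by exists V.
Qed.

Lemma derive_support y i : y != 0 -> 'D_(ebasis i) (support_fun K) y = contact K y 0 i.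
Proof.
move=> y0; have [_ <-] := differentiable_support Kcompact Kconvex Kint Ksmooth y0.
by rewrite mxE.
Qed.

Lemma Ck_support k : Ck k nonzero (support_fun K).
Proof.
apply: (@CkW _ _ k); split=> [y y0|i].
  by have [] := differentiable_support Kcompact Kconvex Kint Ksmooth y0.
by apply: Ck_ext open_nonzero _ (Ck_contact k i) => y /[1!inE] y0; rewrite derive_support.
Qed.

Definition hess y : 'M[R]_n := \matrix_(i, j) 'D_(ebasis i) (fun z => contact K z 0 j) y.

Let dcontact y j : y != 0 -> differentiable (fun z => contact K z 0 j) y.
Proof. by move=> y0; exact: (CkS_differentiable (Ck_contact 1 j) y0). Qed.

Lemma hess_derive y u j : y != 0 -> 'D_u (fun z => contact K z 0 j) y = (u *m hess y) 0 j.
Proof.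
move=> y0; rewrite derive_grad ?mxE; last exact: dcontact.
by apply: eq_bigr => i _; rewrite mxE.
Qed.

Lemma hess_sym y : y != 0 -> (hess y)^T = hess y.
Proof.
move=> y0; apply/matrixP => i j; rewrite !mxE.
have E (k l : 'I_n) : 'D_(ebasis k) (fun z => contact K z 0 l) y =
    'D_(ebasis k) ('D_(ebasis l) (support_fun K)) y.
  apply: (@near_eq_derive R 'rV[R]_n R).
  have : nbhs y nonzero by apply: open_nbhs_nbhs; split => //; exact: open_nonzero.
  by apply: filterS => z z0; rewrite derive_support.
by rewrite !E; exact: (Ck_schwarz _ _ open_nonzero (Ck_support 2)).
Qed.

Lemma contactZ (t : R) y : 0 < t -> y != 0 -> contact K (t *: y) = contact K y.
Proof.
move=> t0 y0; apply: (contact_unique Kcompact Kconvex Kint Ksmooth).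
  by rewrite scaler_eq0 negb_or y0 lt0r_neq0.
have [Kc Hc] := contactP Kcompact Kint y.
by split => // z Kz; rewrite !dotZr ler_pM2l // Hc.
Qed.

(** Euler's relation for [contact], which is constant along rays. *)
Lemma hess_radial y : y != 0 -> y *m hess y = 0.
Proof.
move=> y0; apply/rowP => j; rewrite -hess_derive // mxE.
have H : is_derive (0 : R) (1 : R) (fun t : R => contact K (y + t *: y) 0 j)
    ('D_y (fun z => contact K z 0 j) y).
  have := @is_derive_line _ _ (fun z => contact K z 0 j) y y 0.
  by rewrite scale0r addr0; apply; exact/diff_derivable/dcontact.
rewrite -(@derive_val _ _ _ _ _ _ _ H).
transitivity ('D_(1 : R) (cst (contact K y 0 j : R)) (0 : R)); last exact: derive_cst.
apply: (@near_eq_derive R R R); near=> t.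
have -> : y + t *: y = (1 + t) *: y by rewrite scalerDl scale1r.
rewrite contactZ //.
have : `|t| < 1 by near: t; apply: (@nbhs0_lt R R).
by rewrite ltr_norml => /andP[t1 _]; rewrite -ltrBlDl sub0r.
Unshelve. all: by end_near. Qed.

(** [Psi] recovers [normalize] from [contact], so u is killed by the differential of [normalize],
    which is injective on the complement of y. *)
Lemma hess_kernel y u : y != 0 -> u *m hess y = 0 -> dot u y = 0 -> u = 0.
Proof.
move=> y0 uH uy; have [V [Psi [Vy oV CV dPsi PsiE]]] := contact_local_inverse y0.
apply/rowP => j; rewrite mxE.
have : 'D_u (fun z => normalize z 0 j) y = 0.
  transitivity ('D_u (fun z => Psi (contact K z) 0 j) y).
    apply: (@near_eq_derive R 'rV[R]_n R).
    have : nbhs y V by exact: open_nbhs_nbhs.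
    by apply: filterS => z /PsiE ->.
  rewrite (@derive_comp_rV _ _ _ (fun w => Psi w 0 j) (contact K)) //; last first.
    by move=> l; exact: dcontact.
  by rewrite big1 // => l _; rewrite hess_derive // uH mxE mul0r.
rewrite derive_normalize // /normalize dotZr uy mulr0 mul0r subr0.
by move/eqP; rewrite mulf_eq0 invr_eq0 (negPf (enorm_neq0 y0)) orbF => /eqP.
Qed.

Lemma contact_monotone y z : 0 <= dot (contact K y - contact K z) (y - z).
Proof.
have h1 := (contactP Kcompact Kint y).2 _ (contactP Kcompact Kint z).1.
have h2 := (contactP Kcompact Kint z).2 _ (contactP Kcompact Kint y).1.
by rewrite dotBr !dotBl; move: h1 h2; lra.
Qed.

Lemma supportZ (t : R) y : 0 < t -> y != 0 -> support_fun K (t *: y) = t * support_fun K y.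
Proof.
move=> t0 y0; rewrite !(support_contact Kcompact Kint) contactZ // dotZr.
by [].
Qed.

End ContactSmooth.

Lemma fin_num_pmull {R : realType} (r : R) (e : \bar R) : 0 < r ->
  (r%:E * e)%E \is a fin_num -> e \is a fin_num.
Proof.
move=> r0; case: e => [s| |]; first by [].
  by rewrite mulry gtr0_sg // mul1e.
by rewrite mulrNy gtr0_sg // mul1e.
Qed.

(** * Integrals over the positive part of the sphere as cone integrals *)

Section SphereIntegral.
Context {R : realType} {n : nat}.
Hypothesis n_gt0 : (0 < n)%N.

Definition positive_orthant : set 'rV[R]_n := [set x | forall i : 'I_n, 0 < x 0 i].

Definition positive_sphere : set 'rV[R]_n := sphere `&` positive_orthant.

Lemma measurable_positive_orthant : measurable positive_orthant.
Proof.
have -> : positive_orthant = \bigcap_(i in [set: 'I_n]) [set y : 'rV[R]_n | y 0 i \in `]0, +oo[%R].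
  apply/seteqP; split => y H; [move=> i _|move=> i].
    by rewrite /= in_itv /= andbT; exact: H.
  by have := H i I; rewrite /= in_itv /= andbT.
apply: fin_bigcap_measurable => // i _.
exact: (measurable_coord_preimage i (A := [set` `]0, +oo[%R])).
Qed.

Lemma measurable_positive_sphere : measurable positive_sphere.
Proof.
apply: measurableI; last exact: measurable_positive_orthant.
have -> : @sphere R n = ~` (~` sphere) by rewrite setCK.
apply: measurableC; apply: open_measurable_rV; apply: closed_openC.
exact: (compact_closed (@norm_hausdorff _ _) (@compact_sphere R n)).
Qed.

Lemma positive_neq0 (y : 'rV[R]_n) : positive_orthant y -> y != 0.
Proof.
move=> /(_ (Ordinal n_gt0)); apply: contraTneq => ->.
by rewrite mxE ltxx.
Qed.

(** Points off the punctured ball are sent to the default value 0, which is not on the sphere;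
    preimages of sets of unit vectors thus stay in the ball. *)
Let ball_proj : 'rV[R]_n -> 'rV[R]_n := (@normalize R n) \_ (@punctured_ball R n).

Let measurable_ball_proj : measurable_fun setT ball_proj.
Proof.
apply/(measurable_restrictT _ _).1; first exact: measurable_punctured_ball.
by apply: measurable_funTS; exact: measurable_normalize.
Qed.

Let point_rV : point = 0 :> 'rV[R]_n.
Proof. by apply/rowP => i; rewrite !mxE. Qed.

Let ball_proj_preimage (A : set 'rV[R]_n) : A `<=` positive_sphere ->
  ball_proj @^-1` A = @normalize R n @^-1` A `&` @punctured_ball R n.
Proof.
move=> As; apply/seteqP; split=> y; rewrite /ball_proj /= /patch.
  case: ifPn => [|_ /As[/sphere_neq0]]; first by rewrite inE.
  by rewrite point_rV eqxx.
by move=> [Ay yb]; rewrite ifT // inE.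
Qed.

Let ball_proj_positive : ball_proj @^-1` positive_sphere = orthant_ball.
Proof.
rewrite ball_proj_preimage //; apply/seteqP; split=> y.
  move=> [[_ Hy] /andP[y0 y1]]; split => // i.
  by rewrite -(enormK y) mxE mulr_gt0.
move=> [Hy y1]; have y0 := positive_neq0 Hy.
have e0 := enorm_gt0 y0; split; last by rewrite /punctured_ball /= e0.
split; first exact: dot_normalize.
by move=> i; rewrite mxE mulr_gt0 // invr_gt0.
Qed.

Let mu : {measure set 'rV[R]_n -> \bar R} :=
  measure_function_pushforward__canonical__measure_function_Measure
    (@lebesgue_rV R n) measurable_ball_proj.

(** On subsets of the positive sphere, [sphere_measure] is n times the image of Lebesgue measure
    under [ball_proj]. *)
Let integral_sphere_ge0 (f : 'rV[R]_n -> \bar R) :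
  measurable_fun positive_sphere f -> (forall x, positive_sphere x -> (0 <= f x)%E) ->
  (\int[@sphere_measure R n]_(x in positive_sphere) f x =
   n%:R%:E * \int[@lebesgue_rV R n]_(y in orthant_ball) f (normalize y))%E.
Proof.
move=> mf f0.
rewrite (@eq_measure_integral _ _ _ _ (mscale (n%:R%:nng : {nonneg R}) mu)); last first.
  move=> A mA As; rewrite /sphere_measure /= /mscale /= /pushforward /=.
  by rewrite ball_proj_preimage.
rewrite ge0_integral_mscale //; last exact: measurable_positive_sphere.
rewrite ge0_integral_pushforward //=; last 2 first.
- exact: measurable_positive_sphere.
- by move=> x /[1!inE]; exact: f0.
congr (_ * _)%E; rewrite ball_proj_positive; apply: eq_integral => y /[1!inE] -[Hy y1].
rewrite /= /ball_proj /patch ifT // inE /punctured_ball /= y1 andbT.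
exact/enorm_gt0/positive_neq0.
Qed.

Lemma sphere_measure_positive_lty : (@sphere_measure R n positive_sphere < +oo)%E.
Proof.
rewrite /sphere_measure lte_mul_pinfty //.
rewrite -ball_proj_preimage // ball_proj_positive.
apply: le_lt_trans (lebesgue_cube_lty n 0 2); apply: le_measure.
- rewrite inE -ball_proj_positive -[X in measurable X]setTI.
  exact: measurable_ball_proj measurable_positive_sphere.
- by rewrite inE; exact: measurable_cube.
move=> y [yi y1] i; rewrite in_itv /= yi /=; apply: (@le_lt_trans _ _ 1); last by rewrite ltr1n.
apply: le_trans y1; apply: (le_trans (ler_norm _)).
apply: (le_trans (coord_le_norm y i)).
by rewrite -(@ler_pXn2r _ 2) ?nnegrE ?sqrtr_ge0 // enorm_sqr norm2_le_dot.
Qed.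

Section Continuous.
Variable c : 'rV[R]_n -> R.
Hypothesis cc : forall x, x != 0 -> {for x, continuous c}.

Let mc : measurable_fun positive_sphere c.
Proof.
apply: (measurable_funS (E := nonzero)).
- by apply: open_measurable_rV; exact: open_nonzero.
- by move=> x [sx _]; exact: sphere_neq0.
- by apply: continuous_on_measurable; [exact: open_nonzero|exact: cc].
Qed.

Lemma integrable_positive_sphere :
  (@sphere_measure R n).-integrable positive_sphere (EFin \o c).
Proof.
apply: measurable_bounded_integrable.
- exact: measurable_positive_sphere.
- exact: sphere_measure_positive_lty.
- exact: mc.
have [M HM] := compact_bounded_fun (@compact_sphere R n) (f := c)
  (fun x sx => cc (sphere_neq0 sx)).
exists M; split; first exact: num_real.
by move=> M' MM' x [sx _]; apply: (le_trans _ (ltW MM')); exact: HM.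
Qed.

(** The cone formula is available for nonnegative functions, so it is applied to the positive and
    negative parts, whose integrals are finite. *)
Lemma Rintegral_positive_sphere_eq0 :
  (\int[@lebesgue_rV R n]_(y in orthant_ball) (c (normalize y))%:E = 0)%E ->
  \int[@sphere_measure R n]_(x in positive_sphere) c x = 0.
Proof.
move=> int0; rewrite /Rintegral.
have ic := integrable_positive_sphere.
have mE : measurable_fun positive_sphere (EFin \o c) by exact/measurable_EFinP.
have n0 : 0 < n%:R :> R by rewrite ltr0n.
have ep := integral_sphere_ge0 (measurable_funepos mE) (fun x _ => funepos_ge0 _ x).
have en := integral_sphere_ge0 (measurable_funeneg mE) (fun x _ => funeneg_ge0 _ x).
have fp := integrable_pos_fin_num measurable_positive_sphere ic.
have fn := integrable_neg_fin_num measurable_positive_sphere ic.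
have {}int0 : (\int[@lebesgue_rV R n]_(y in orthant_ball) (EFin \o c)^\+ (normalize y) -
    \int[@lebesgue_rV R n]_(y in orthant_ball) (EFin \o c)^\- (normalize y) = 0)%E.
  rewrite -int0 [RHS]integralE.
  by congr (_ - _)%E; apply: eq_integral => y _; rewrite ?funeposE ?funenegE.
rewrite integralE ep en; move: fp fn int0; rewrite ep en.
set a := integral _ _ _; set b := integral _ _ _; move: a b => a b.
move=> fpa fpb; have fa := fin_num_pmull n0 fpa; have fb := fin_num_pmull n0 fpb.
rewrite -(fineK fa) -(fineK fb) -EFinB => -[/eqP].
by rewrite subr_eq0 => /eqP ->; rewrite -EFinM -EFinB subrr.
Qed.

End Continuous.
End SphereIntegral.

(** * Coordinate reflections and unconditional bodies *)

Section Reflection.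
Context {R : realType} {n : nat}.
Implicit Types (i : 'I_n) (y u v : 'rV[R]_n).

Lemma coord_reflectionK i : involutive (@coord_reflection R n i).
Proof.
by move=> y; apply/rowP => j; rewrite !mxE; case: eqP => // _; rewrite opprK.
Qed.

Lemma coord_reflectionD i u v :
  coord_reflection i (u + v) = coord_reflection i u + coord_reflection i v.
Proof. by apply/rowP => j; rewrite !mxE; case: eqP => // _; rewrite opprD. Qed.

Lemma dot_reflection i u v : dot (coord_reflection i u) v = dot u (coord_reflection i v).
Proof.
by apply: eq_bigr => j _; rewrite !mxE; case: eqP => // _; rewrite mulrN mulNr.
Qed.

Lemma norm_reflection i u : `|coord_reflection i u| = `|u|.
Proof.
suff H v : `|coord_reflection i v| <= `|v|.
  by apply/eqP; rewrite eq_le H -{1}(coord_reflectionK i u) H.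
apply: norm_le_coord => // j; rewrite mxE.
by case: eqP => _; rewrite ?normrN coord_le_norm.
Qed.

Lemma reflection_neq0 i y : y != 0 -> coord_reflection i y != 0.
Proof. by rewrite -!normr_gt0 norm_reflection. Qed.

Lemma reflection_id i y : y 0 i = 0 -> coord_reflection i y = y.
Proof. by move=> yi; apply/rowP => j; rewrite mxE; case: eqP => // ->; rewrite yi oppr0. Qed.

Lemma enorm_reflection i y : enorm (coord_reflection i y) = enorm y.
Proof. by rewrite /enorm dot_reflection coord_reflectionK. Qed.

End Reflection.

Section Unconditional.
Context {R : realType} {n : nat}.
Variable K : set 'rV[R]_n.
Hypotheses (Kcompact : compact K) (Kconvex : convex_set K) (Kint : K° !=set0).
Hypotheses (Ksmooth : Cinf_plus K) (Kuncond : unconditional K).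
Implicit Types (x y z u v : 'rV[R]_n).

(** The gradient of a function invariant under a linear isometry commutes with it; the remainder
    estimate at y is used with the reflected increment. *)
Lemma contact_reflection i y : y != 0 ->
  contact K (coord_reflection i y) = coord_reflection i (contact K y).
Proof.
move=> y0; have [dh gh] := differentiable_support Kcompact Kconvex Kint Ksmooth y0.
have [_ <-] := differentiable_support Kcompact Kconvex Kint Ksmooth (reflection_neq0 i y0).
apply: (proj2 (@is_diff_dot _ _ (support_fun K) (coord_reflection i y)
   (coord_reflection i (contact K y)) _)) => e e0.
have /nbhs_ballP[r /= r0 H] := differentiable_dot dh e0.
apply/nbhs_ballP; exists r => //= k kr.
have kr' : ball (0 : 'rV[R]_n) r (coord_reflection i k).
  by move: kr; rewrite -!ball_normE /ball_ /= !sub0r !normrN norm_reflection.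
have := H _ kr'; rewrite -[grad _ _]/(inv_gauss K y) gh norm_reflection dot_reflection.
have -> : coord_reflection i y + k = coord_reflection i (y + coord_reflection i k).
  by rewrite coord_reflectionD coord_reflectionK.
by rewrite !Kuncond.
Qed.

Lemma contact_coord0 i y : y != 0 -> y 0 i = 0 -> contact K y 0 i = 0.
Proof.
move=> y0 yi; have := congr1 (fun v : 'rV[R]_n => v 0 i) (contact_reflection i y0).
rewrite reflection_id // mxE eqxx => /eqP.
by rewrite -subr_eq0 opprK -mulr2n mulrn_eq0 => /eqP.
Qed.

(** Monotonicity of the gradient between y and its reflection gives a nonnegative coordinate. If it
    were zero, both would share a contact point and hence a direction, against
    [contact_inj_normalize]. *)
Lemma contact_coord_pos i y : 0 < y 0 i -> 0 < contact K y 0 i.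
Proof.
move=> yi; have y0 : y != 0 by apply: contraTneq yi => ->; rewrite mxE ltxx.
have E : y - coord_reflection i y = (2 * y 0 i) *: ebasis i.
  apply/rowP => j; rewrite !mxE; case: eqP => [->|_] /=; last by rewrite subrr mulr0.
  by rewrite mulr1 opprK mulr_natl mulr2n.
have := contact_monotone Kcompact Kint y (coord_reflection i y).
rewrite contact_reflection // E dotZr dot_ebasisr !mxE eqxx opprK.
rewrite pmulr_rge0 ?mulr_gt0 // => H.
rewrite lt_neqAle; apply/andP; split; last by lra.
rewrite eq_sym; apply/eqP => Xi.
have := contact_reflection i y0; rewrite (reflection_id Xi) => E2.
have := contact_inj_normalize Kcompact Kint Ksmooth (reflection_neq0 i y0) y0 E2.
move=> /(congr1 (fun v : 'rV[R]_n => v 0 i)).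
rewrite /normalize enorm_reflection !mxE eqxx mulrN => /eqP.
rewrite eq_sym -subr_eq0 opprK -mulr2n mulrn_eq0 /= mulf_eq0 invr_eq0.
by rewrite (negPf (enorm_neq0 y0)) (negPf (lt0r_neq0 yi)).
Qed.

Lemma contact_coord_neg i y : y 0 i < 0 -> contact K y 0 i < 0.
Proof.
move=> yi; have y0 : y != 0 by apply: contraTneq yi => ->; rewrite mxE ltxx.
have := @contact_coord_pos i (coord_reflection i y).
by rewrite contact_reflection // !mxE eqxx !oppr_gt0; apply.
Qed.

Lemma inv_gauss_contact y : y != 0 -> inv_gauss K y = contact K y.
Proof. by move=> y0; have [] := differentiable_support Kcompact Kconvex Kint Ksmooth y0. Qed.

Lemma Omega_plus_positive_sphere : Omega_plus K = positive_sphere.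
Proof.
apply/seteqP; split=> x [sx H]; split=> // i; have x0 := sphere_neq0 sx.
  have := H i; rewrite inv_gauss_contact //.
  have [//|xi Xi|/esym xi] := ltgtP 0 (x 0 i).
    by have := lt_trans Xi (contact_coord_neg xi); rewrite ltxx.
  by rewrite contact_coord0 // ltxx.
by rewrite inv_gauss_contact //; exact/contact_coord_pos/H.
Qed.

Lemma support_gt0 y : y != 0 -> 0 < support_fun K y.
Proof.
move=> y0; rewrite (support_contact Kcompact Kint) /dot.
have P i : 0 <= contact K y 0 i * y 0 i.
  have [yi|yi|yi] := ltgtP 0 (y 0 i); last by rewrite -yi mulr0.
    by rewrite mulr_ge0 ?ltW // contact_coord_pos.
  by rewrite mulr_le0 ?ltW // contact_coord_neg.
have [i yi] : exists i, y 0 i != 0.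
  apply: contrapT => H; move/eqP: y0; apply; apply/rowP => i; rewrite mxE.
  by apply/eqP; apply: contrapT => /negP yi; apply: H; exists i.
rewrite (bigD1 i) //= ltr_wpDr ?sumr_ge0 //.
have [yi'|yi'|yi'] := ltgtP 0 (y 0 i); last by rewrite -yi' eqxx in yi.
  by rewrite mulr_gt0 // contact_coord_pos.
by rewrite nmulr_lgt0 // contact_coord_neg.
Qed.

End Unconditional.

(** * The dual map and the logarithmic metric *)

Section RankOne.
Context {R : realType} {n : nat}.
Implicit Types (u v x : 'rV[R]_n) (H A : 'M[R]_n).

Lemma det_one_plus_rank1 u v : \det (1%:M + u^T *m v) = 1 + dot u v.
Proof.
pose L : 'M[R]_(1 + n) := block_mx 1%:M 0 (- u^T) 1%:M.
pose A : 'M[R]_(1 + n) := block_mx 1%:M v 0 (1%:M + u^T *m v).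
pose B : 'M[R]_(1 + n) := block_mx (1 + dot u v)%:M v 0 1%:M.
have E : L *m A = B *m L.
  rewrite /L /A /B !mulmx_block !(mul0mx, mulmx0, mul1mx, mulmx1, addr0, add0r).
  rewrite mulmxN dot_mulmx dotC mulNmx addrC addrK; congr (block_mx _ _ _ _).
  by rewrite -raddfB /= addrK.
have dL : \det L = 1 by rewrite det_lblock !det1 mulr1.
have := congr1 determinant E; rewrite !det_mulmx dL mul1r mulr1.
by rewrite !det_ublock !det1 mul1r mulr1 det_scalar1.
Qed.

(* Both rank-one terms can be traded for [x^T *m x] by unimodular-type factors
   because [x] spans the kernel of [H] on either side. *)
Lemma det_rank1_kernel H x u v : x *m H = 0 -> H *m x^T = 0 -> dot x x = 1 ->
  \det (H + u^T *m v) = dot u x * dot v x * \det (H + x^T *m x).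
Proof.
move=> xH Hx xx.
have xxT : x *m x^T = 1%:M by rewrite dot_mulmx xx.
have xE : x *m (H + x^T *m x) = x.
  by rewrite mulmxDr xH add0r mulmxA xxT mul1mx.
have Ex : (H + u^T *m x) *m x^T = u^T.
  by rewrite mulmxDl Hx add0r -mulmxA xxT mulmx1.
have E1 : (1%:M + (u - x)^T *m x) *m (H + x^T *m x) = H + u^T *m x.
  rewrite mulmxDl mul1mx -mulmxA xE linearB /= mulmxBl.
  by rewrite -addrA (addrC (x^T *m x)) subrK.
have E2 : (H + u^T *m x) *m (1%:M + x^T *m (v - x)) = H + u^T *m v.
  rewrite mulmxDr mulmx1 mulmxA Ex mulmxBr.
  by rewrite -addrA (addrC (u^T *m x)) subrK.
rewrite -E2 det_mulmx -E1 det_mulmx !det_one_plus_rank1.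
rewrite dotBl dotBr xx (dotC x v).
by rewrite addrC subrK (addrC 1) subrK mulrAC.
Qed.

Lemma det_set_rowD (k : 'I_n) (a b : R) u v A :
  \det (set_row k (a *: u + b *: v) A) =
  a * \det (set_row k u A) + b * \det (set_row k v A).
Proof.
rewrite !det_set_row !mulr_sumr -big_split; apply: eq_bigr => j _.
by rewrite !mxE mulrDl !mulrA.
Qed.

Lemma det_set_rowZ (k : 'I_n) (a : R) u A :
  \det (set_row k (a *: u) A) = a * \det (set_row k u A).
Proof. by have := det_set_rowD k a 0 u u A; rewrite scale0r addr0 mul0r addr0. Qed.

Lemma det_set_row_mulmx (k : 'I_n) u A :
  \det (set_row k (u *m A) A) = u 0 k * \det A.
Proof.
rewrite mulmx_sum_row det_set_row_sum (bigD1 k) //= det_set_row_row big1 ?addr0 //.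
by move=> l lk; rewrite det_set_row_other ?mulr0 // eq_sym.
Qed.

End RankOne.

(** * The dual map, its Jacobian and the homogeneous weights *)

Section Fields.
Context {R : realType} {n : nat}.
Variable K : set 'rV[R]_n.
Hypotheses (Kcompact : compact K) (Kconvex : convex_set K) (Kint : K° !=set0).
Hypotheses (Ksmooth : Cinf_plus K) (Kuncond : unconditional K).
Implicit Types (x y z u v : 'rV[R]_n).

Local Notation h := (support_fun K).
Local Notation X := (contact K).
Local Notation H := (hess K).

Let oZ := @open_nonzero R n.
Let Ch k : Ck k nonzero h := Ck_support Kcompact Kconvex Kint Ksmooth k.
Let CX k j : Ck k nonzero (fun y => X y 0 j) := Ck_contact Kcompact Kconvex Kint Ksmooth k j.
Let h_gt0 y (y0 : y != 0) : 0 < h y := support_gt0 Kcompact Kconvex Kint Ksmooth Kuncond y0.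
Let h_neq0 y (y0 : y != 0) : h y != 0 := lt0r_neq0 (h_gt0 y0).
Let H_sym y (y0 : y != 0) : (H y)^T = H y := hess_sym Kcompact Kconvex Kint Ksmooth y0.
Let yH y (y0 : y != 0) : y *m H y = 0 := hess_radial Kcompact Kconvex Kint Ksmooth y0.

Let Hy y : y != 0 -> H y *m y^T = 0.
Proof. by move=> y0; rewrite -{1}(H_sym y0) -trmx_mul yH // trmx0. Qed.

Let Xy y : dot (X y) y = h y.
Proof. by rewrite support_contact. Qed.

Let dotH u v y : y != 0 -> dot (u *m H y) v = dot u (v *m H y).
Proof.
move=> y0; have E (a b : 'rV[R]_n) : a *m b^T = b *m a^T by rewrite !dot_mulmx dotC.
have : (dot (u *m H y) v)%:M = (dot u (v *m H y))%:M :> 'M[R]_1.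
  by rewrite -!dot_mulmx trmx_mul H_sym // mulmxA.
by move=> /(congr1 (fun A : 'M[R]_1 => A 0 0)); rewrite !mxE.
Qed.

(* The gradient of [h ^ 2 / 2], whose inverse is the gradient of half the
   squared gauge; the fields below are its Piola transforms. *)
Definition dual_map k y : R := h y * X y 0 k.

Lemma Ck_dual_map l k : Ck l nonzero (dual_map k).
Proof. exact: (CkM oZ (Ch l) (CX l k)). Qed.

Let dh y : y != 0 -> differentiable h y.
Proof. by move=> y0; exact: (CkS_differentiable (Ch 1) y0). Qed.

Let dX y j : y != 0 -> differentiable (fun z => X z 0 j) y.
Proof. by move=> y0; exact: (CkS_differentiable (CX 1 j) y0). Qed.

Let Dh y u : y != 0 -> 'D_u h y = dot u (X y).
Proof.
move=> y0; rewrite derive_grad; last exact: dh.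
by apply: eq_bigr => i _; rewrite derive_support.
Qed.

Let DX y u j : y != 0 -> 'D_u (fun z => X z 0 j) y = (u *m H y) 0 j.
Proof. exact: hess_derive. Qed.

Let is_derive_h y u : y != 0 -> is_derive y u h (dot u (X y)).
Proof. by move=> y0; rewrite -Dh //; apply/derivableP/diff_derivable/dh. Qed.

Let is_derive_X y u j : y != 0 -> is_derive y u (fun z => X z 0 j) ((u *m H y) 0 j).
Proof. by move=> y0; rewrite -DX //; apply/derivableP/diff_derivable/dX. Qed.

Let is_derive_coord y u j : is_derive y u (fun z : 'rV[R]_n => z 0 j) (u 0 j).
Proof.
by rewrite -(derive_coord y u j); apply/derivableP/diff_derivable/differentiable_coord_rV.
Qed.

Local Notation J := (jac dual_map).

Lemma jac_dual_map y : y != 0 -> J y = (X y)^T *m X y + h y *: H y.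
Proof.
move=> y0; apply/matrixP => k l; rewrite mxE.
have E := is_deriveM (is_derive_h (ebasis l) y0) (is_derive_X (ebasis l) k y0).
rewrite (@derive_val _ _ _ _ _ _ _ E) -rowE dot_ebasisl mxE.
rewrite -{1}(H_sym y0) [in RHS]mxE [X in _ = X + _]mxE big_ord1 !mxE.
by rewrite addrC /GRing.scale.
Qed.

Lemma dual_mapZ (t : R) k y : 0 < t -> y != 0 -> dual_map k (t *: y) = t * dual_map k y.
Proof.
by move=> t0 y0; rewrite /dual_map contactZ // supportZ // mulrA.
Qed.

Let tneq0 (t : R) y : 0 < t -> y != 0 -> t *: y != 0.
Proof. by move=> t0 y0; rewrite scaler_eq0 negb_or y0 lt0r_neq0. Qed.

Lemma jac_dual_mapZ (t : R) y : 0 < t -> y != 0 -> J (t *: y) = J y.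
Proof.
move=> t0 y0; apply/matrixP => k l; rewrite !mxE.
have dk z : z != 0 -> differentiable (dual_map k) z by exact: CkS_differentiable (Ck_dual_map 1 k).
apply: (mulfI (lt0r_neq0 t0)); rewrite -derive_scale; last exact/dk/tneq0.
have := deriveZ (t : R) (diff_derivable (v := ebasis l) (dk y y0)).
rewrite [X in _ = X -> _]/GRing.scale /= => <-; apply: (@near_eq_derive R 'rV[R]_n R).
have : nbhs y nonzero by apply: open_nbhs_nbhs; split => //; exact: open_nonzero.
by apply: filterS => z z0; rewrite dual_mapZ.
Qed.

Lemma mul_jac_radial y : y != 0 -> y *m J y = h y *: X y.
Proof.
move=> y0; rewrite jac_dual_map // mulmxDr mulmxA dot_mulmx dotC Xy mul_scalar_mx.
by rewrite -scalemxAr yH // scaler0 addr0.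
Qed.

Lemma jac_dual_map_sym y : y != 0 -> (J y)^T = J y.
Proof.
move=> y0; rewrite jac_dual_map // linearD /= trmx_mul trmxK linearZ /=.
by rewrite H_sym.
Qed.

(** Pairing a kernel equation with y removes the Hessian term, so v is orthogonal to X and v H = 0.
    Then v is a multiple c y, and c h = dot v X = 0. *)
Lemma det_jac_dual_map_neq0 y : y != 0 -> \det (J y) != 0.
Proof.
move=> y0; apply/negP => /det0P[v v0 vJ].
have vE : dot v (X y) *: X y + h y *: (v *m H y) = 0.
  by rewrite -vJ jac_dual_map // mulmxDr mulmxA dot_mulmx mul_scalar_mx scalemxAr.
have vX : dot v (X y) = 0.
  have : dot (dot v (X y) *: X y + h y *: (v *m H y)) y = 0 by rewrite vE dot0l.
  rewrite dotDl !dotZl Xy dotH // yH // dot0r mulr0 addr0 => /eqP.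
  by rewrite mulf_eq0 (negPf (h_neq0 y0)) orbF => /eqP.
have vH : v *m H y = 0.
  move/eqP: vE; rewrite vX scale0r add0r scaler_eq0 (negPf (h_neq0 y0)).
  by move=> /eqP.
pose c := dot v y / dot y y.
have y2 : dot y y != 0 by rewrite dot_eq0.
have E : v - c *: y = 0.
  apply: (hess_kernel Kcompact Kconvex Kint Ksmooth y0).
    by rewrite mulmxBl vH -scalemxAl yH // scaler0 subr0.
  by rewrite dotBl dotZl /c divfK // subrr.
have vc : v = c *: y by apply/eqP; rewrite -subr_eq0 E.
move: vX; rewrite vc dotZl dotC Xy => /eqP.
rewrite mulf_eq0 (negPf (h_neq0 y0)) orbF => /eqP c0.
by move/eqP: v0; apply; rewrite vc c0 scale0r.
Qed.

(** Of the n + 1 factors h, n come from scaling the matrix and one is the pairing of X with x in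
    [det_rank1_kernel]. *)
Lemma det_jac_sphere x : sphere x ->
  \det (J x) = h x ^+ n.+1 * \det (H x + x^T *m x).
Proof.
move=> sx; have x0 := sphere_neq0 sx.
have -> : J x = h x *: (H x + (X x)^T *m ((h x)^-1 *: X x)).
  rewrite jac_dual_map // scalerDr -scalemxAr scalerA divff ?scale1r 1?addrC //.
  exact: h_neq0.
rewrite detZ (det_rank1_kernel (X x) ((h x)^-1 *: X x) (yH x0) (Hy x0) sx).
rewrite dotZl Xy mulVf ?mulr1 ?h_neq0 //.
by rewrite mulrA -exprSr.
Qed.

Section Index.
Variable i : 'I_n.

(** A component of the conormal of (log X_1, ..., log X_n) relative to (1, ..., 1): these components
    sum to 1 since dot X y = h, and annihilate d log X since y is orthogonal to dX. *)
Definition log_conormal y : R := y 0 i * X y 0 i / h y.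

Local Notation nu := log_conormal.

Lemma Ck_log_conormal k : Ck k nonzero nu.
Proof.
exact: (CkM oZ (CkM oZ (Ck_coord k _ i) (CX k i)) (CkV oZ h_neq0 (Ch k))).
Qed.

Lemma derive_log_conormal y u : y != 0 -> 'D_u nu y =
  (h y)^-1 * (u 0 i * X y 0 i + y 0 i * (u *m H y) 0 i - nu y * dot u (X y)).
Proof.
move=> y0; have hy := h_neq0 y0.
have hV : is_derive y u (fun z => (h z)^-1) (- (h y) ^- 2 * dot u (X y)).
  apply: DeriveDef; first by apply: derivableV => //; exact/diff_derivable/dh.
  by rewrite deriveV // ?Dh //; exact/diff_derivable/dh.
have E := is_deriveM (is_deriveM (is_derive_coord y u i) (is_derive_X u i y0)) hV.
rewrite (@derive_val _ _ _ _ _ _ _ E) /nu /GRing.scale /=.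
rewrite -[((fun z : 'rV[R]_n => z 0 i) * (fun z => X z 0 i)) y]/(y 0 i * X y 0 i).
move: (h y) hy (y 0 i) (X y 0 i) (u 0 i) ((u *m H y) 0 i) (dot u (X y)).
by move=> a a0 b c d e f; field.
Qed.

Lemma log_conormalZ (t : R) y : 0 < t -> y != 0 -> nu (t *: y) = nu y.
Proof.
move=> t0 y0; rewrite /nu contactZ // supportZ // mxE.
move: (h y) (h_neq0 y0) (y 0 i) (X y 0 i) => a a0 b c.
by field; rewrite a0 lt0r_neq0.
Qed.

Definition field_weight y : R := dual_map i y * (h y)^-1 ^+ n.

Let CkhV k : Ck k nonzero (fun y => (h y)^-1) := CkV oZ h_neq0 (Ch k).

Lemma Ck_field_weight k : Ck k nonzero field_weight.
Proof. exact: (CkM oZ (Ck_dual_map k i) (CkX n oZ (CkhV k))). Qed.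

Lemma field_weightZ (t : R) y : 0 < t -> y != 0 ->
  t ^+ n * field_weight (t *: y) = t * field_weight y.
Proof.
move=> t0 y0; rewrite /field_weight dual_mapZ // supportZ // invfM exprMn.
rewrite [t^-1 ^+ n]exprVn; have tn : t ^+ n != 0 by rewrite expf_neq0 // lt0r_neq0.
move: (t ^+ n) tn (dual_map i y) ((h y)^-1 ^+ n) => a a0 b c.
by field.
Qed.

Definition cone_weight y : R := (h y)^-1 ^+ n * \det (J y).

(** The gradient of the weight is a multiple of row i of J plus a multiple of X, and X = (y J) / h
    is a combination of rows in which row i has coefficient y_i / h. *)
Lemma det_field_weight y : y != 0 ->
  \det (set_row i (grad field_weight y) (J y)) = cone_weight y * (1 - n%:R * nu y).
Proof.
move=> y0; have hy := h_neq0 y0.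
have hV : is_derive (h y) (1 : R) (fun t : R => t^-1 ^+ n)
    (- (n%:R * (h y)^-1 ^+ n.+1)).
  have e : is_derive (h y) (1 : R) (fun t : R => t^-1) (- (h y) ^- 2).
    by have := @is_deriveV R id (h y) 1 1 hy (is_derive_id _ _); rewrite [_ *: 1]mulr1.
  have X1 : is_derive (h y)^-1 (1 : R) (fun t : R => t ^+ n) (n%:R * (h y)^-1 ^+ n.-1).
    apply: DeriveDef; first exact: exprn_derivable.
    by rewrite exp_derive [LHS]mulr1.
  have := @is_derive1_comp R (fun t => t ^+ n) (fun t => t^-1) (h y) _ _ X1 e.
  have pred m (a : R) : m%:R * a ^+ m.-1 * a ^+ 2 = m%:R * a ^+ m.+1.
    by case: m => [|m]; rewrite ?mul0r // -mulrA -exprD addn2.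
  by rewrite mulrN -exprVn pred.
have gE : grad field_weight y = (h y)^-1 ^+ n *: row i (J y) +
    (- (n%:R * dual_map i y * (h y)^-1 ^+ n.+1)) *: X y.
  apply/rowP => j; rewrite !mxE.
  have dP : is_derive y (ebasis j) (dual_map i) ('D_(ebasis j) (dual_map i) y).
    by apply/derivableP/diff_derivable/(CkS_differentiable (Ck_dual_map 1 i) y0).
  have dV : is_derive y (ebasis j) (fun z => (h z)^-1 ^+ n)
      (- (n%:R * (h y)^-1 ^+ n.+1) * X y 0 j).
    apply: DeriveDef; last by rewrite (derive_comp_real _ hV) ?Dh ?dot_ebasisl //; exact: dh.
    by apply/diff_derivable/(differentiable_comp_real hV)/dh.
  rewrite (@derive_val _ _ _ _ _ _ _ (is_deriveM dP dV)) /GRing.scale /=.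
  by ring.
rewrite {}gE det_set_rowD det_set_row_row.
have -> : X y = (h y)^-1 *: (y *m J y).
  by rewrite mul_jac_radial // scalerA mulVf // scale1r.
rewrite det_set_rowZ det_set_row_mulmx /cone_weight /nu /dual_map exprS.
move: (h y) hy ((h y)^-1 ^+ n) (\det (J y)) (X y 0 i) (y 0 i).
by move=> a a0 b c d e; field.
Qed.

End Index.

End Fields.

(** * Intrinsic calculus on the sphere in Euclidean terms *)

Section SphereGeometry.
Context {R : realType} {n : nat}.
Implicit Types (x y z u v : 'rV[R]_n).

Lemma tangent_projE x u : u *m tangent_proj x = u - dot u x *: x.
Proof. by rewrite /tangent_proj mulmxBr mulmx1 mulmxA dot_mulmx mul_scalar_mx. Qed.

Lemma sdiff_sphere (f : 'rV[R]_n -> R) x u : sphere x -> differentiable f x ->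
  sdiff f x u = 'D_(u - dot u x *: x) f x.
Proof.
move=> sx df; have x0 := sphere_neq0 sx.
have df' : differentiable f (normalize x) by rewrite normalize_sphere.
rewrite /sdiff (@derive_comp_rV _ _ _ f (@normalize R n)) //; last first.
  by move=> j; exact: (CkS_differentiable (Ck_normalize 1 j) x0).
rewrite normalize_sphere // derive_grad //; apply: eq_bigr => j _.
by rewrite derive_normalize // normalize_sphere // sphere_enorm // divr1 !mxE.
Qed.

Variable K : set 'rV[R]_n.
Hypotheses (Kcompact : compact K) (Kconvex : convex_set K) (Kint : K° !=set0).
Hypotheses (Ksmooth : Cinf_plus K) (Kuncond : unconditional K).

Local Notation h := (support_fun K).
Local Notation X := (contact K).
Local Notation H := (hess K).
Local Notation J := (jac (dual_map K)).

Let Ch k : Ck k nonzero h := Ck_support Kcompact Kconvex Kint Ksmooth k.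
Let CX k j : Ck k nonzero (fun y => X y 0 j) := Ck_contact Kcompact Kconvex Kint Ksmooth k j.
Let h_gt0 y (y0 : y != 0) : 0 < h y := support_gt0 Kcompact Kconvex Kint Ksmooth Kuncond y0.
Let h_neq0 y (y0 : y != 0) : h y != 0 := lt0r_neq0 (h_gt0 y0).
Let H_sym y (y0 : y != 0) : (H y)^T = H y := hess_sym Kcompact Kconvex Kint Ksmooth y0.
Let yH y (y0 : y != 0) : y *m H y = 0 := hess_radial Kcompact Kconvex Kint Ksmooth y0.

Let Hy y : y != 0 -> H y *m y^T = 0.
Proof. by move=> y0; rewrite -{1}(H_sym y0) -trmx_mul yH // trmx0. Qed.

Let Xy y : dot (X y) y = h y.
Proof. by rewrite support_contact. Qed.

Let dotH u v y : y != 0 -> dot (u *m H y) v = dot u (v *m H y).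
Proof.
move=> y0.
have : (dot (u *m H y) v)%:M = (dot u (v *m H y))%:M :> 'M[R]_1.
  by rewrite -!dot_mulmx trmx_mul H_sym // mulmxA.
by move=> /(congr1 (fun A : 'M[R]_1 => A 0 0)); rewrite !mxE.
Qed.

Let dh y : y != 0 -> differentiable h y.
Proof. by move=> y0; exact: (CkS_differentiable (Ch 1) y0). Qed.

Let dX y j : y != 0 -> differentiable (fun z => X z 0 j) y.
Proof. by move=> y0; exact: (CkS_differentiable (CX 1 j) y0). Qed.

Let DX y u j : y != 0 -> 'D_u (fun z => X z 0 j) y = (u *m H y) 0 j.
Proof. exact: hess_derive. Qed.

Let near_nonzero y : y != 0 -> \forall z \near y, z != 0.
Proof.
move=> y0; have : nbhs y nonzero by apply: open_nbhs_nbhs; split => //; exact: open_nonzero.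
exact.
Qed.

(** Needed at all nonzero y, because the connection differentiates the gradient through its radially
    constant extension. *)
Let sgrad_normalize y : y != 0 -> sgrad h (normalize y) =
  X y - h (normalize y) *: normalize y.
Proof.
move=> y0; have n0 := normalize_neq0 y0; have sn : sphere (normalize y) by exact: dot_normalize.
have Xn : X (normalize y) = X y.
  by rewrite -{2}(enormK y) contactZ // enorm_gt0.
apply/rowP => j; rewrite !mxE sdiff_sphere //; last exact: dh.
rewrite derive_grad; last exact: dh.
transitivity (dot (ebasis j - dot (ebasis j) (normalize y) *: normalize y) (X y)).
  by apply: eq_bigr => l _; rewrite derive_support // Xn.
rewrite dotBl dotZl !dot_ebasisl [dot (normalize y) _]dotC -Xn Xy mxE.
by rewrite mulrC.
Qed.

(** The intrinsic Hessian plus h times the round metric is the Euclidean Hessian on tangent vectors.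
    The derivative of h inside the normal part of the gradient gives a multiple of x, removed by the
    tangential projection. *)
Lemma shess_support x u v : sphere x ->
  shess h x u v = dot (u *m H x - h x *: (u *m tangent_proj x)) v.
Proof.
move=> sx; have x0 := sphere_neq0 sx; rewrite /shess; congr (dot _ _).
rewrite /sconn; set G := sgrad h \o _.
pose a := 'D_u (fun z => h (normalize z)) x.
have hn : differentiable (fun z => h (normalize z)) x.
  apply: differentiable_comp_rV => [|j]; first by rewrite normalize_sphere //; exact: dh.
  exact: (CkS_differentiable (Ck_normalize 1 j) x0).
have dn j : differentiable (fun z : 'rV[R]_n => normalize z 0 j) x.
  exact: (CkS_differentiable (Ck_normalize 1 j) x0).
have GE j : \forall z \near x, X z 0 j - h (normalize z) * normalize z 0 j = G z 0 j.
  by apply: filterS (near_nonzero x0) => z z0; rewrite /G /= sgrad_normalize // !mxE.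
have dG j : is_derive x u (fun z => G z 0 j) ((u *m H x) 0 j -
    (h x * (u 0 j - dot u x * x 0 j) + x 0 j * a)).
  apply: (near_eq_is_derive (GE j)).
  have d1 : is_derive x u (fun z => X z 0 j) ((u *m H x) 0 j).
    by rewrite -DX //; apply/derivableP/diff_derivable/dX.
  have d2 : is_derive x u (fun z => h (normalize z)) a.
    exact/derivableP/diff_derivable.
  have d3 : is_derive x u (fun z : 'rV[R]_n => normalize z 0 j) (u 0 j - dot u x * x 0 j).
    have := derivableP (diff_derivable (v := u) (dn j)).
    by rewrite derive_normalize // normalize_sphere // sphere_enorm // divr1.
  have := is_deriveB d1 (is_deriveM d2 d3).
  by rewrite normalize_sphere.
have -> : 'D_u G x = u *m H x - (h x *: (u *m tangent_proj x) + a *: x).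
  rewrite derive_mx; last by apply/derivable_mxP => k j; rewrite ord1; exact: ex_derive.
  apply/rowP => j; rewrite mxE (@derive_val _ _ _ _ _ _ _ (dG j)) tangent_projE.
  by rewrite !mxE (mulrC (x 0 j)).
have xx : dot x x = 1 := sx.
have E : dot (u *m H x - (h x *: (u - dot u x *: x) + a *: x)) x = - a.
  rewrite dotBl dotDl !dotZl dotBl dotZl xx dotH // yH // dot0r !mulr1 subrr.
  by rewrite mulr0 sub0r add0r.
by rewrite !tangent_projE E scaleNr opprK opprD addrA subrK.
Qed.

(** Compressed to the tangent space, intrinsic Hessian plus h I is the Euclidean Hessian, and
    [det_jac_sphere] expresses its determinant through J. *)
Lemma cone_density_weight x : sphere x -> cone_density K x = cone_weight K x.
Proof.
move=> sx; have x0 := sphere_neq0 sx; have hx := h_neq0 x0.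
set P := tangent_proj x.
have xxT : x *m x^T = 1%:M by rewrite dot_mulmx sx.
have PP : P *m P = P.
  rewrite {2}/P /tangent_proj mulmxBr mulmx1 mulmxA.
  have -> : P *m x^T = 0 by rewrite /P /tangent_proj mulmxBl mul1mx -mulmxA xxT mulmx1 subrr.
  by rewrite mul0mx subr0.
have HP : H x *m P = H x by rewrite /P /tangent_proj mulmxBr mulmx1 mulmxA Hy // mul0mx subr0.
have PH : P *m H x = H x by rewrite /P /tangent_proj mulmxBl mul1mx -mulmxA yH // mulmx0 subr0.
have E : shess_mx h x = H x - h x *: P.
  apply/matrixP => i j; rewrite mxE shess_support // dot_ebasisr /ebasis -!rowE.
  by rewrite !mxE.
rewrite /cone_density /tangent_det E -/P.
move: P PP HP PH {E} => P PP HP PH.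
have -> : P *m (H x - h x *: P + (h x)%:M) *m P = H x.
  by rewrite mulmxDr mulmxBr PH -scalemxAr PP mul_mx_scalar subrK HP.
rewrite /cone_weight det_jac_sphere // exprS exprVn.
have hn : h x ^+ n != 0 by rewrite expf_neq0.
move: (\det _) (h x ^+ n) hn => c a a0; by field.
Qed.

Section Gradient.
Variable i : 'I_n.
Local Notation nu := (log_conormal K i).

Let inv_gaussE y : y != 0 -> inv_gauss K y = X y.
Proof. exact: inv_gauss_contact. Qed.

Let sdiff_F x u : sphere x -> dot u x = 0 -> sdiff (F_extremal K i) x u = 'D_u nu x.
Proof.
move=> sx ux; have x0 := sphere_neq0 sx.
have FE : \forall z \near x, nu z - n%:R^-1 = F_extremal K i z.
  by apply: filterS (near_nonzero x0) => z z0; rewrite /F_extremal inv_gaussE.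
have dnu : differentiable nu x.
  exact: (CkS_differentiable (Ck_log_conormal Kcompact Kconvex Kint Ksmooth Kuncond i 1) x0).
have dF : differentiable (F_extremal K i) x.
  have C0 : Ck 1 nonzero (fun z => nu z - n%:R^-1).
    apply: (CkB (@open_nonzero R n)); last exact: Ck_cst.
    exact: Ck_log_conormal.
  have C1 : Ck 1 nonzero (F_extremal K i).
    apply: (Ck_ext (@open_nonzero R n) _ C0) => z /[1!inE] z0.
    by rewrite /F_extremal inv_gaussE.
  exact: (CkS_differentiable C1 x0).
rewrite sdiff_sphere // ux scale0r subr0.
rewrite -(near_eq_derive u FE) deriveB; last 2 first.
- exact: diff_derivable.
- exact: derivable_cst.
by rewrite derive_cst subr0.
Qed.

Let sdiff_ln x u k : sphere x -> 0 < X x 0 k -> dot u x = 0 ->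
  sdiff (fun y => ln (inv_gauss K y 0 k)) x u = (u *m H x) 0 k / X x 0 k.
Proof.
move=> sx Xk ux; have x0 := sphere_neq0 sx.
have E : \forall z \near x, ln (X z 0 k) = ln (inv_gauss K z 0 k).
  by apply: filterS (near_nonzero x0) => z z0; rewrite inv_gaussE.
have dln := is_derive1_ln Xk.
have d0 : differentiable (fun z => ln (X z 0 k)) x.
  exact: (@differentiable_comp_real _ _ (@ln R) (fun z => X z 0 k) _ _ dln (dX k x0)).
have dn : differentiable (fun z => ln (X (normalize z) 0 k)) x.
  apply: (@differentiable_comp_rV _ _ _ (fun z => ln (X z 0 k)) (@normalize R n)).
    by rewrite normalize_sphere.
  by move=> j; exact: (CkS_differentiable (Ck_normalize 1 j) x0).
have -> : sdiff (fun y => ln (inv_gauss K y 0 k)) x u = sdiff (fun y => ln (X y 0 k)) x u.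
  apply/esym; apply: (@near_eq_derive R 'rV[R]_n R).
  apply: filterS (near_nonzero x0) => z z0 /=.
  by rewrite inv_gaussE // normalize_neq0.
rewrite sdiff_sphere // ux scale0r subr0.
rewrite (@derive_comp_real _ _ (@ln R) (fun z => X z 0 k) _ _ _ dln (dX k x0)).
by rewrite DX // mulrC.
Qed.

Let g_logE x u v : positive_sphere x -> dot u x = 0 -> dot v x = 0 ->
  g_log K x u v = (h x)^-1 * (dot (u *m H x) v +
    \sum_k x 0 k / X x 0 k * ((u *m H x) 0 k * (v *m H x) 0 k)).
Proof.
move=> [sx xp] ux vx; have x0 := sphere_neq0 sx.
have Xp k : 0 < X x 0 k by exact/contact_coord_pos/xp.
rewrite /g_log /centro_affine_metric shess_support // tangent_projE ux scale0r subr0.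
rewrite dotBl dotZl subrK mulrDr; congr (_ + _); rewrite mulr_sumr.
apply: eq_bigr => k _; rewrite !sdiff_ln // inv_gaussE //.
have := h_neq0 x0; have := lt0r_neq0 (Xp k).
move: (h x) (X x 0 k) (x 0 k) ((u *m H x) 0 k) ((v *m H x) 0 k) => a b c d e b0 a0.
by field; rewrite a0 b0.
Qed.

Let g_log_sym x u v : positive_sphere x -> dot u x = 0 -> dot v x = 0 ->
  g_log K x u v = g_log K x v u.
Proof.
move=> px ux vx; have x0 := sphere_neq0 px.1.
rewrite !g_logE // dotH // dotC; congr (_ * (_ + _)).
by apply: eq_bigr => k _; rewrite [X in _ * X]mulrC.
Qed.

Let cofactor_dot (A : 'M[R]_n) v : A^T = A -> \det A != 0 ->
  dot (ebasis i *m invmx A) v = (\det A)^-1 * \det (set_row i v A).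
Proof.
move=> AT dA; rewrite -rowE det_set_row mulr_sumr; apply: eq_bigr => j _.
have cT : cofactor A j i = cofactor A i j by rewrite -{1}AT cofactor_tr.
by rewrite mxE /invmx unitmxE unitfE dA !mxE cT -mulrA [X in _ * X]mulrC.
Qed.

Let D_nu x u : x != 0 -> 'D_u nu x =
  (h x)^-1 * (u 0 i * X x 0 i + x 0 i * (u *m H x) 0 i - nu x * dot u (X x)).
Proof. exact: derive_log_conormal. Qed.

Lemma grad_log_sqnorm_weight x : positive_sphere x ->
  grad_log_sqnorm K (F_extremal K i) x * cone_density K x =
  field_weight K i x * \det (set_row i (grad nu x) (J x)).
Proof.
move=> px; have [sx xp] := px; have x0 := sphere_neq0 sx; have hx := h_neq0 x0.
have dJ : \det (J x) != 0 by exact: det_jac_dual_map_neq0.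
have Jsym : (J x)^T = J x by exact: jac_dual_map_sym.
have xx : dot x x = 1 := sx.
(* [V0] is the vector that [dual_map] sends to [Phi_i e_i]; as [grad_log F] and
   its tangential part [V] satisfy the same defining equation, symmetry of
   [g_log] gives [g_log (grad_log F) (grad_log F) = dF V]. *)
pose V0 := dual_map K i x *: (ebasis i *m invmx (J x)).
pose V := V0 - dot V0 x *: x.
have uJ : J x \in unitmx by rewrite unitmxE unitfE.
have V0J : V0 *m J x = dual_map K i x *: ebasis i.
  by rewrite /V0 -scalemxAl -mulmxA mulVmx // mulmx1.
have V0X : dot V0 (X x) *: X x + h x *: (V0 *m H x) = dual_map K i x *: ebasis i.
  rewrite -V0J jac_dual_map // mulmxDr mulmxA dot_mulmx mul_scalar_mx.
  by rewrite scalemxAr.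
have V0X' : dot V0 (X x) = x 0 i * X x 0 i.
  have E : dot V0 (X x) * h x = dual_map K i x * x 0 i.
    have := congr1 (fun v => dot v x) V0X.
    by rewrite dotDl !dotZl Xy dotH // yH // dot0r mulr0 addr0 dot_ebasisl.
  apply: (mulIf hx); rewrite E /dual_map.
  by move: (h x) (X x 0 i) (x 0 i) => a b c; ring.
have V0H : V0 *m H x = X x 0 i *: ebasis i - nu x *: X x.
  apply: (scalerI hx); rewrite scalerBr !scalerA.
  have -> : h x * nu x = x 0 i * X x 0 i by rewrite /log_conormal mulrC divfK.
  by rewrite -V0X' -[in RHS]/(dual_map K i x) -V0X addrC addKr.
have VH : V *m H x = X x 0 i *: ebasis i - nu x *: X x.
  have cx (c : R) : (c *: x) *m H x = 0 by rewrite -scalemxAl yH // scaler0.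
  by rewrite /V mulmxBl cx subr0.
have Vx : dot V x = 0 by rewrite /V dotBl dotZl xx mulr1 subrr.
have dF u : dot u x = 0 -> g_log K x V u = sdiff (F_extremal K i) x u.
  move=> ux; rewrite sdiff_F // D_nu // g_logE // VH; congr (_ * _).
  (* The weights x_k / X_k single out x_i (u H)_i from the e_i term and turn the X term into a
     multiple of dot x (u H), zero because x H = 0. *)
  have -> : \sum_k x 0 k / X x 0 k * ((X x 0 i *: ebasis i - nu x *: X x) 0 k *
      (u *m H x) 0 k) = x 0 i * (u *m H x) 0 i.
    transitivity (\sum_k (x 0 k * (u *m H x) 0 k * (ebasis i : 'rV[R]_n) 0 k
        - nu x * (x 0 k * (u *m H x) 0 k))).
      apply: eq_bigr => k _; have := lt0r_neq0 (contact_coord_pos Kcompact Kconvex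
        Kint Ksmooth Kuncond (xp k)).
      rewrite !mxE /=; case: (eqVneq k i) => [->|_] /=.
        move: (X x 0 i) (x 0 i) (nu x) => a b c; move: (\sum_(_ < _) _) => d a0.
        by field.
      move: (X x 0 k) (x 0 k) (nu x) => a b c; move: (\sum_(_ < _) _) => d a0.
      by field.
    rewrite sumrB -mulr_sumr -/(dot x (u *m H x)) dotC dotH // yH // dot0r mulr0 subr0.
    have eb k : (ebasis i : 'rV[R]_n) 0 k = (k == i)%:R by rewrite mxE eqxx.
    rewrite (bigD1 i) //= eb eqxx mulr1 big1 ?addr0 // => k ki.
    by rewrite eb (negPf ki) mulr0.
  rewrite dotBl !dotZl dot_ebasisl (dotC (X x)) (mulrC (u 0 i)).
  by rewrite addrAC.
set W := grad_log K (F_extremal K i) x.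
have [Wx Wspec] : tangent x W /\ forall u, tangent x u ->
    g_log K x W u = sdiff (F_extremal K i) x u.
  by apply: (@xgetPex _ 0 [set V | tangent x V /\ forall u, tangent x u ->
    g_log K x V u = sdiff (F_extremal K i) x u]); exists V.
have -> : grad_log_sqnorm K (F_extremal K i) x = 'D_V nu x.
  by rewrite /grad_log_sqnorm -/W Wspec // -dF // g_log_sym // Wspec // sdiff_F.
have dnu : differentiable nu x.
  exact: (CkS_differentiable (Ck_log_conormal Kcompact Kconvex Kint Ksmooth Kuncond i 1) x0).
(* As [nu] is constant along rays, its derivatives along V and V0 agree. *)
have Dx : 'D_x nu x = 0.
  rewrite D_nu // yH // mxE mulr0 addr0 dotC Xy /log_conormal divfK //.
  by rewrite subrr mulr0.
have -> : 'D_V nu x = dot V0 (grad nu x).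
  by rewrite derive_grad_dot // /V dotBl dotZl -(derive_grad_dot x dnu) Dx mulr0 subr0.
rewrite /V0 dotZl cofactor_dot // cone_density_weight // /cone_weight /field_weight.
move: (\det (set_row _ _ _)) (\det (J x)) dJ => a b b0.
by field.
Qed.

End Gradient.

End SphereGeometry.

(** * Integrals of Piola divergences *)

Section FieldIntegral.
Context {R : realType} {n : nat}.
Hypothesis n_gt0 : (0 < n)%N.
Variable K : set 'rV[R]_n.
Hypotheses (Kcompact : compact K) (Kconvex : convex_set K) (Kint : K° !=set0).
Hypotheses (Ksmooth : Cinf_plus K) (Kuncond : unconditional K).
Variable i : 'I_n.
Implicit Types (x y z u v : 'rV[R]_n) (G : 'rV[R]_n -> R).

Local Notation h := (support_fun K).
Local Notation X := (contact K).
Local Notation J := (jac (dual_map K)).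
Local Notation nu := (log_conormal K i).

Let oZ := @open_nonzero R n.
Let CPhi k l : Ck k nonzero (dual_map K l) := Ck_dual_map Kcompact Kconvex Kint Ksmooth k l.

(** By [divergence_cofactor], the divergence of G times row i of the cofactors of J. *)
Definition piola_div G y : R := \det (set_row i (grad G y) (J y)).

(** X_j vanishes on the whole hyperplane y_j = 0, so row j of J is J_jj e_j there. Copying it into
    row i gives 0 = J_jj times the cofactor (i, j), and J_jj is nonzero as det J is. *)
Lemma cofactor_jac_boundary j y : y != 0 -> y 0 j = 0 -> j != i ->
  cofactor (J y) i j = 0.
Proof.
move=> y0 yj ji.
have dJ := det_jac_dual_map_neq0 Kcompact Kconvex Kint Ksmooth Kuncond y0.
have Xj := contact_coord0 Kcompact Kconvex Kint Ksmooth Kuncond y0 yj.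
have Hj l : l != j -> hess K y j l = 0.
  move=> lj; rewrite -(hess_sym Kcompact Kconvex Kint Ksmooth y0) !mxE.
  transitivity ('D_(1 : R) (cst (0 : R)) (0 : R)); last exact: derive_cst.
  have dX : derivable (fun z => X z 0 j) y (ebasis l).
    apply: diff_derivable.
    exact: (CkS_differentiable (Ck_contact Kcompact Kconvex Kint Ksmooth 1 j) y0).
  have H : is_derive (0 : R) (1 : R) (fun t : R => X (y + t *: ebasis l) 0 j)
      ('D_(ebasis l) (fun z => X z 0 j) y).
    have := @is_derive_line _ _ (fun z => X z 0 j) y (ebasis l) 0.
    by rewrite scale0r addr0; apply.
  rewrite -(@derive_val _ _ _ _ _ _ _ H); apply: (@near_eq_derive R R R).
  have N : nbhs y nonzero by apply: open_nbhs_nbhs.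
  apply: filterS (near_line (ebasis l) N) => t t0; rewrite addrC contact_coord0 //.
  by rewrite !mxE yj [j == l]eq_sym (negPf lj) andbF mulr0 addr0.
have E : row j (J y) = J y j j *: ebasis j.
  apply/rowP => l; rewrite (jac_dual_map Kcompact Kconvex Kint Ksmooth y0) !mxE !big_ord1 !mxE Xj.
  rewrite !mul0r !add0r eqxx /=; case: (eqVneq l j) => [->|lj]; first by rewrite mulr1.
  by have := Hj l lj; rewrite mxE => ->; rewrite !mulr0.
have ij : i != j by rewrite eq_sym.
have := det_set_row_other (J y) ij; rewrite E det_set_rowZ det_set_row_ebasis => /eqP.
rewrite mulf_eq0 => /orP[/eqP Jj|/eqP //].
by move: dJ; rewrite -(det_set_row_row j) E det_set_rowZ Jj mul0r eqxx.
Qed.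

Lemma integral_piola_div G : Ck 1 nonzero G ->
  (forall (t : R) y, 0 < t -> y != 0 -> t ^+ n * G (t *: y) = t * G y) ->
  (forall y, y != 0 -> y 0 i = 0 -> G y = 0) ->
  (\int[@lebesgue_rV R n]_(y in orthant_ball) (piola_div G (normalize y))%:E = 0)%E.
Proof.
move=> CG Ghom G0.
have CB j : Ck 1 nonzero (fun y => G y * cofactor (J y) i j).
  exact: (CkM oZ CG (Ck_cofactor_jac i j oZ (CPhi 2))).
have Bhom j (t : R) y : 0 < t -> y != 0 ->
    t ^+ n * (G (t *: y) * cofactor (J (t *: y)) i j) = t * (G y * cofactor (J y) i j).
  by move=> t0 y0; rewrite mulrA Ghom // jac_dual_mapZ // mulrA.
have B0 j y : y != 0 -> y 0 j = 0 -> G y * cofactor (J y) i j = 0.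
  move=> y0 yj; have [ji|ji] := eqVneq j i; first by rewrite G0 ?mul0r // -ji.
  by rewrite cofactor_jac_boundary // mulr0.
rewrite -[RHS](spherical_divergence CB Bhom n_gt0 B0).
apply: eq_integral => y /[1!inE] -[yp _]; congr (_%:E).
have y0 : normalize y != 0 by exact/normalize_neq0/(positive_neq0 n_gt0).
by rewrite (divergence_cofactor i oZ (CPhi 2) CG y0).
Qed.

Lemma Ck_piola_div G : Ck 1 nonzero G -> Ck 0 nonzero (piola_div G).
Proof.
move=> CG; apply: (Ck_det oZ) => a b.
have -> : (fun y => set_row i (grad G y) (J y) a b) =
    (fun y => if a == i then grad G y 0 b else 'D_(ebasis b) (dual_map K a) y).
  by apply/funext => y; rewrite [LHS]mxE; case: eqP => // _; rewrite mxE.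
by case: eqP => _; [exact: Ck_grad|exact: CkS_derive].
Qed.

End FieldIntegral.

(** * Combination of the two integral identities *)

Unset Implicit Arguments.

Theorem theorem8p13 (R : realType) (n : nat) (n_ge2 : (2 <= n)%N)
    (K : set 'rV[R]_n) (K_body : convex_body K) (K_smooth : Cinf_plus K)
    (K_uncond : unconditional K) (i : 'I_n) :
  let F := F_extremal K i in
  let Omega := Omega_plus K in
  [/\ dV_integrable K Omega (cst 1),
      dV_integrable K Omega F,
      dV_integrable K Omega (fun x => (F x - mean_plus K F) ^+ 2),
      dV_integrable K Omega (grad_log_sqnorm K F) &
      n%:R * dV_integral K Omega (fun x => (F x - mean_plus K F) ^+ 2) =
      dV_integral K Omega (grad_log_sqnorm K F)].
Proof.
move=> F Omega; have [Kc Kx Ki] := K_body.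
have n_gt0 : (0 < n)%N by exact: ltnW.
pose g := field_weight K i; pose nu := log_conormal K i; pose w := cone_weight K.
pose D1 := piola_div K i g; pose D2 := piola_div K i (fun y => g y * nu y).
have oZ := @open_nonzero R n.
have Cg : Ck 1 nonzero g by exact: Ck_field_weight.
have Cnu : Ck 1 nonzero nu by exact: Ck_log_conormal.
have Cgnu : Ck 1 nonzero (fun y => g y * nu y) by exact: CkM.
have Cw : Ck 0 nonzero w.
  apply: (CkM oZ).
    apply: (CkX n oZ); apply: (CkV oZ); last exact: Ck_support.
    by move=> y y0; apply: lt0r_neq0; exact: support_gt0.
  apply: (Ck_det oZ) => a b.
  have -> : (fun y => jac (dual_map K) y a b) =
      (fun y => 'D_(ebasis b) (dual_map K a) y) by apply/funext => y; rewrite mxE.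
  exact: (CkS_derive b (Ck_dual_map Kc Kx Ki K_smooth 1 a)).
have CD1 : Ck 0 nonzero D1 by exact: Ck_piola_div.
have CD2 : Ck 0 nonzero D2 by exact: Ck_piola_div.
have D1E y : y != 0 -> D1 y = w y * (1 - n%:R * nu y).
  exact: det_field_weight.
have D2E y : y != 0 -> D2 y = nu y * D1 y + g y * \det (set_row i (grad nu y) (jac (dual_map K) y)).
  move=> y0; rewrite -det_set_rowD; congr (\det (set_row _ _ _)).
  apply/rowP => j; rewrite [LHS]mxE.
  have dg : derivable g y (ebasis j) by exact/diff_derivable/(CkS_differentiable Cg y0).
  have dnu : derivable nu y (ebasis j) by exact/diff_derivable/(CkS_differentiable Cnu y0).
  have E := is_deriveM (derivableP dg) (derivableP dnu).
  by rewrite (@derive_val _ _ _ _ _ _ _ E) addrC !mxE.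
have mP := @measurable_positive_sphere R n.
have OmE : Omega = positive_sphere by exact: Omega_plus_positive_sphere.
have boundary (y : 'rV[R]_n) : y != 0 -> y 0 i = 0 -> g y = 0.
  by move=> y0 yi; rewrite /g /field_weight /dual_map contact_coord0 // mulr0 mul0r.
have int1 : \int[sphere_measure]_(x in positive_sphere) D1 x = 0.
  apply: (Rintegral_positive_sphere_eq0 n_gt0) => [y y0|].
    exact: (Ck_continuous CD1 y0).
  by apply: integral_piola_div => // t y; exact: field_weightZ.
have int2 : \int[sphere_measure]_(x in positive_sphere) D2 x = 0.
  apply: (Rintegral_positive_sphere_eq0 n_gt0) => [y y0|].
    exact: (Ck_continuous CD2 y0).
  apply: integral_piola_div => // [t y t0 y0|y y0 yi]; last by rewrite boundary ?mul0r.
  by rewrite /nu log_conormalZ // mulrA field_weightZ // mulrA.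
have intC (c : 'rV[R]_n -> R) : Ck 0 nonzero c ->
    sphere_measure.-integrable positive_sphere (EFin \o c).
  by move=> Cc; exact: (integrable_positive_sphere n_gt0 (fun x x0 => Ck_continuous Cc x0)).
have dVE (f c : 'rV[R]_n -> R) : Ck 0 nonzero c ->
    (forall x, positive_sphere x -> c x = f x * cone_density K x) ->
    dV_integrable K Omega f /\
    dV_integral K Omega f = \int[sphere_measure]_(x in positive_sphere) c x.
  move=> Cc fc; rewrite /dV_integrable /dV_integral OmE; split.
    by apply: eq_integrable (intC c Cc) => // x /[1!inE] px; rewrite /= fc.
  by apply: eq_Rintegral => x /[1!inE] px; rewrite fc.
have cdE x : positive_sphere x -> cone_density K x = w x.
  by move=> [sx _]; exact: cone_density_weight.
have FE x : positive_sphere x -> F x = nu x - n%:R^-1.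
  by move=> [sx _]; rewrite /F /F_extremal (inv_gauss_contact Kc) //; exact: sphere_neq0.
have n0 : n%:R != 0 :> R by rewrite pnatr_eq0 -lt0n.
have pos0 x : positive_sphere x -> x != 0 by move=> [sx _]; exact: sphere_neq0.
have int_1 : dV_integrable K Omega (cst 1).
  by apply: (proj1 (dVE _ w Cw _)) => x px; rewrite cdE // mul1r.
(* Since nu - 1/n = -(1/n) (1 - n nu), the density of F dV is itself a multiple of a divergence. *)
pose cF y := - n%:R^-1 * D1 y.
have CcF : Ck 0 nonzero cF by exact: (CkM oZ (Ck_cst _ _ _) CD1).
have [int_F intF] : dV_integrable K Omega F /\ dV_integral K Omega F =
    \int[sphere_measure]_(x in positive_sphere) cF x.
  apply: (dVE _ cF CcF) => x px; rewrite cdE // FE // /cF D1E ?pos0 //.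
  by move: (w x) (nu x) => a b; field.
have mean0 : mean_plus K F = 0.
  rewrite /mean_plus intF RintegralZl //; last exact: intC.
  by rewrite int1 mulr0 mul0r.
pose cF2 y := (nu y - n%:R^-1) ^+ 2 * w y.
have CcF2 : Ck 0 nonzero cF2.
  apply: (CkM oZ) Cw; apply: (CkX 2 oZ); apply: (CkB oZ); last exact: Ck_cst.
  exact: CkW.
have [int_F2 intF2] : dV_integrable K Omega (fun x => (F x - mean_plus K F) ^+ 2) /\
    dV_integral K Omega (fun x => (F x - mean_plus K F) ^+ 2) =
    \int[sphere_measure]_(x in positive_sphere) cF2 x.
  by apply: (dVE _ cF2 CcF2) => x px; rewrite mean0 subr0 cdE // FE.
(* The coefficient 1/n makes n (nu - 1/n)^2 w + [cR] equal |grad_log F|^2 times the density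
   pointwise: all terms in nu alone cancel. *)
pose cR y := D2 y - n%:R^-1 * D1 y.
have CcR : Ck 0 nonzero cR by exact: (CkB oZ CD2 (CkM oZ (Ck_cst _ _ _) CD1)).
pose cG y := n%:R * cF2 y + cR y.
have CnF2 : Ck 0 nonzero (fun y => n%:R * cF2 y) by exact: (CkM oZ (Ck_cst _ _ _) CcF2).
have CcG : Ck 0 nonzero cG by exact: (CkD oZ CnF2 CcR).
have [int_G intG] : dV_integrable K Omega (grad_log_sqnorm K F) /\
    dV_integral K Omega (grad_log_sqnorm K F) =
    \int[sphere_measure]_(x in positive_sphere) cG x.
  apply: (dVE _ cG CcG) => x px; rewrite grad_log_sqnorm_weight //.
  rewrite -/g -/nu /cG /cR /cF2 D2E ?pos0 // D1E ?pos0 //.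
  by move: (w x) (nu x) (g x * _) => a b c; field.
split => //; rewrite intF2 intG RintegralD //; [|exact: intC|exact: intC].
rewrite RintegralZl //; last exact: intC.
rewrite RintegralB //; [|exact: intC|exact: (intC _ (CkM oZ (Ck_cst _ _ _) CD1))].
rewrite RintegralZl //; last exact: intC.
by rewrite int1 int2 mulr0 subrr addr0.
Qed.
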